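(* Let $E,F$ be exact operator spaces and let $C=d_{SK}(E)\,d_{SK}(F)$. Let $u\colon E\to F^*$ be a tracially bounded linear map. Let $(x_t)_{t\in F_\infty}$ (resp. $(y_t)_{t\in F_\infty}$) be a finitely supported family of elements of $E$ (resp. $F$). Then $$\Big|\sum_{t} \langle u(x_t),y_t\rangle\Big|\le C\,\|u\|_{tb}\,\Big\|\sum_t\lambda(t)\otimes x_t\Big\|_{\min}\Big\|\sum_t\lambda(t)\otimes y_t\Big\|_{\min}.$$ In particular, for all $n$ and all $x_i\in E$, $y_i\in F$ ($i=1,\dots,n$), $$\Big|\sum_{i=1}^n \langle u(x_i),y_i\rangle\Big|\le C\,\|u\|_{tb}\,\Big\|\sum_i\lambda(g_i)\otimes x_i\Big\|_{\min}\Big\|\sum_i\lambda(g_i)\otimes y_i\Big\|_{\min},$$ and hence $$\Big|\sum_{i=1}^n \langle u(x_i),y_i\rangle\Big|\le 4C\,\|u\|_{tb}\max\Big\{\Big\|\sum x_i^*x_i\Big\|^{1/2},\Big\|\sum x_ix_i^*\Big\|^{1/2}\Big\}\max\Big\{\Big\|\sum y_i^*y_i\Big\|^{1/2},\Big\|\sum y_iy_i^*\Big\|^{1/2}\Big\}.$$ Furthermore, if $A,B$ are $C^*$-algebras such that $E\subset A$, $F\subset B$ (completely isometrically), then there is a linear map $\tilde u\colon A\to B^*$ such that $$\|\tilde u\|\le\|\tilde u\|_{tb}\le 4C\|u\|_{tb}$$ and $\langle\tilde u(x),y\rangle=\langle u(x),y\rangle$ for all $(x,y)\in E\times F$.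
   Context: An operator space is a closed subspace of $B(H)$ for some Hilbert space $H$; it carries the matrix norms on $M_n(E)=M_n\otimes_{\min}E$, and $\|\cdot\|_{\min}$ denotes the minimal (spatial) tensor norm. $\|v\|_{cb}$ denotes the completely bounded norm, and $d_{cb}(E,G)=\inf\{\|v\|_{cb}\|v^{-1}\|_{cb}\}$ over all isomorphisms $v\colon E\to G$ ($=\infty$ if none). For a finite dimensional operator space $E$, $d_{SK}(E)=\inf\{d_{cb}(E,G): G\subset K(\ell_2)\}$, where $K(\ell_2)$ is the algebra of compact operators on $\ell_2$. For an infinite dimensional operator space $X$, $d_{SK}(X)=\sup d_{SK}(E)$ over all finite dimensional subspaces $E\subset X$. $X$ is called exact if $d_{SK}(X)<\infty$. A linear map $u\colon E\to F^*$ ($F^*$ the dual of $F$) is called tracially bounded if the bilinear forms $u_n\colon M_n(E)\times M_n(F)\to\mathbb{C}$, $u_n((x_{ij}),(y_{ij}))=\frac1n\sum_{i,j}\langle u(x_{ij}),y_{ij}\rangle$, are bounded uniformly in $n$; then $\|u\|_{tb}=\sup_{n\ge1}\|u_n\|$. $F_\infty$ is the free group with countably many generators $g_1,g_2,\dots$; $\lambda\colon F_\infty\to B(\ell_2(F_\infty))$ is the left regular representation, and $C_\lambda$ is the reduced $C^*$-algebra of $F_\infty$. The norms $\|\sum_t\lambda(t)\otimes x_t\|_{\min}$ are taken in $C_\lambda\otimes_{\min}E$ (resp. $C_\lambda\otimes_{\min}F$). The expressions $\sum x_i^*x_i$, $\sum x_ix_i^*$ are computed in a $C^*$-algebra containing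 the operator space completely isometrically. *)

(* Defs.v *)
From HB Require Import structures.
From mathcomp Require Import all_boot all_order all_algebra.
From mathcomp Require Import all_classical all_reals all_analysis.
From mathcomp Require Import complex.
From mathcomp Require Import finmap ring lra.
Set Implicit Arguments.
Unset Strict Implicit.
Unset Printing Implicit Defensive.
Import Order.TTheory GRing.Theory Num.Theory.
Import numFieldNormedType.Exports.
Local Open Scope classical_set_scope.
Local Open Scope ring_scope.

(* The norm of a complex normed space takes its values in R[i]; [nrm] is the
   same norm read as a real number. *)
Definition nrm {R : realType} {V : normedZmodType R[i]} (x : V) : R :=
  complex.Re `|x|.

Section Nrm.
Context {R : realType}.

Lemma nrmE {V : normedZmodType R[i]} (x : V) : `|x| = ((nrm x)%:C)%C.
Proof. by rewrite /nrm RRe_real// ger0_real. Qed.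

Lemma nrm_ge0 {V : normedZmodType R[i]} (x : V) : 0 <= nrm x.
Proof. by have := normr_ge0 x; rewrite nrmE ler0c. Qed.

Lemma nrm0 {V : normedZmodType R[i]} : nrm (0 : V) = 0.
Proof. by rewrite /nrm normr0. Qed.

Lemma nrm0_eq0 {V : normedZmodType R[i]} (x : V) : nrm x = 0 -> x = 0.
Proof. by move=> x0; apply/normr0_eq0; rewrite nrmE x0. Qed.

Lemma nrmD {V : normedZmodType R[i]} (x y : V) : nrm (x + y) <= nrm x + nrm y.
Proof. by have := ler_normD x y; rewrite !nrmE -rmorphD lecR. Qed.

Lemma nrmZ {V : normedModType R[i]} (a : R[i]) (x : V) :
  nrm (a *: x) = nrm a * nrm x.
Proof. by apply/complexI; rewrite rmorphM/= -!nrmE normrZ. Qed.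

Lemma nrmN {V : normedZmodType R[i]} (x : V) : nrm (- x) = nrm x.
Proof. by rewrite /nrm normrN. Qed.

Lemma nrmR (r : R) : nrm (r%:C)%C = `|r|.
Proof. by rewrite /nrm normc_def/= expr0n addr0 sqrtr_sqr. Qed.

End Nrm.

Section BoundedOperators.
Context {R : realType}.
Implicit Types V W : normedModType R[i].

Definition bounded_op V W : {pred V -> W} :=
  [pred f : V -> W | `[< linear f /\
     exists M : R, forall x, nrm (f x) <= M * nrm x >]].

Lemma bounded_op_submod V W : submod_closed (@bounded_op V W).
Proof.
split=> [|a f g /asboolP[lf [M Mf]] /asboolP[lg [N Ng]]]; apply/asboolP.
  split=> [b x y|]; first by rewrite -[LHS]/(0 : W) scaler0 addr0.
  by exists 0 => x; rewrite -[X in nrm X]/(0 : W) nrm0 mul0r.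
have E x : (a *: f + g) x = a *: f x + g x by [].
split=> [b x y|].
  by rewrite !E lf lg !scalerDr !scalerA [b * a]mulrC addrACA.
exists (nrm a * M + N) => x; rewrite E (le_trans (nrmD _ _))// mulrDl lerD// nrmZ -mulrA ler_wpM2l//.
exact: nrm_ge0.
Qed.

HB.instance Definition _ V W :=
  GRing.isSubmodClosed.Build R[i] (V -> W) (@bounded_op V W)
    (@bounded_op_submod V W).

Record BL V W := MkBL { BL_fun :> V -> W; BLP : BL_fun \in @bounded_op V W }.
HB.instance Definition _ V W := [isSub for @BL_fun V W].
HB.instance Definition _ V W := [Choice of BL V W by <:].
HB.instance Definition _ V W := [SubChoice_isSubLmodule of BL V W by <:].

Variables V W : normedModType R[i].
Implicit Types f g : BL V W.

Lemma BL_linear f : linear (f : V -> W).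
Proof. by case: f => f /= /asboolP[]. Qed.

HB.instance Definition _ f := GRing.isLinear.Build R[i] V W _ f (BL_linear f).

Lemma BL_bounded f : exists M : R, forall x, nrm (f x) <= M * nrm x.
Proof. by case: f => f /= /asboolP[]. Qed.

Definition opnorm f : R := sup [set nrm (f x) | x in [set x | nrm x <= 1]].

Lemma has_sup_opnorm f :
  has_sup [set nrm (f x) | x in [set x | nrm x <= 1]].
Proof.
split; first by exists (nrm (f 0)), 0 => //=; rewrite nrm0.
have [M Mf] := BL_bounded f; exists `|M| => _ [x /= x1 <-].
rewrite (le_trans (Mf x))// (le_trans (ler_wpM2r (nrm_ge0 x) (ler_norm M)))//.
by rewrite ler_piMr.
Qed.

Lemma opnorm_ub f x : nrm x <= 1 -> nrm (f x) <= opnorm f.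
Proof.
move=> x1; apply: (ub_le_sup (has_sup_opnorm f).2).
by exists x.
Qed.

Lemma opnorm_le f (r : R) :
  (forall x, nrm x <= 1 -> nrm (f x) <= r) -> opnorm f <= r.
Proof.
move=> fr; apply: ge_sup; first exact: (has_sup_opnorm f).1.
by move=> _ [x /= x1 <-]; exact: fr.
Qed.

Lemma opnorm_ge0 f : 0 <= opnorm f.
Proof. by rewrite (le_trans (nrm_ge0 (f 0)))// opnorm_ub// nrm0. Qed.

Lemma nrm_opnorm f x : nrm (f x) <= opnorm f * nrm x.
Proof.
have [->|x0] := eqVneq x 0; first by rewrite linear0 !nrm0 mulr0.
have nx : 0 < nrm x.
  by rewrite lt_neqAle nrm_ge0 andbT eq_sym; apply: contra_neq x0 => /nrm0_eq0.
have := @opnorm_ub f ((nrm x)^-1%:C%C *: x).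
rewrite linearZ/= !nrmZ !nrmR ger0_norm ?invr_ge0 ?nrm_ge0//.
rewrite mulVf ?gt_eqF// => /(_ (lexx _)).
by rewrite mulrC ler_pdivrMr.
Qed.

Lemma opnormD f g : opnorm (f + g) <= opnorm f + opnorm g.
Proof.
apply: opnorm_le => x x1.
by rewrite (le_trans (nrmD (f x) (g x)))// lerD ?opnorm_ub.
Qed.

Lemma opnormZ (a : R[i]) f : opnorm (a *: f) = nrm a * opnorm f.
Proof.
have le b h : opnorm (b *: h) <= nrm b * opnorm h.
  apply: opnorm_le => x x1.
  rewrite -[X in nrm X]/(b *: h x) nrmZ ler_wpM2l ?nrm_ge0//.
  exact: opnorm_ub.
have [->|a0] := eqVneq a 0.
  apply/le_anti; rewrite le //= nrm0 mul0r; exact: opnorm_ge0.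
apply/le_anti; rewrite le /=.
have na : 0 < nrm a.
  by rewrite lt_neqAle nrm_ge0 andbT eq_sym; apply: contra_neq a0 => /nrm0_eq0.
rewrite mulrC -ler_pdivlMr// mulrC.
have := le a^-1 (a *: f); rewrite scalerA mulVf// scale1r.
rewrite (_ : nrm a^-1 = (nrm a)^-1)//.
by apply/complexI; rewrite /= -nrmE normfV nrmE fmorphV.
Qed.

Lemma opnorm_eq0 f : opnorm f = 0 -> f = 0.
Proof.
move=> f0; apply/val_inj/funext => x; apply: nrm0_eq0.
by apply/le_anti; rewrite nrm_ge0 andbT (le_trans (nrm_opnorm f x))// f0 mul0r.
Qed.

Let cnorm f : R[i] := (opnorm f)%:C%C.

Let cnormD f g : cnorm (f + g) <= cnorm f + cnorm g.
Proof. by rewrite -rmorphD lecR opnormD. Qed.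

Let cnormZ (a : R[i]) f : cnorm (a *: f) = `|a| * cnorm f.
Proof. by rewrite nrmE -rmorphM /= -opnormZ. Qed.

Let cnorm_eq0 f : cnorm f = 0 -> f = 0.
Proof. by move=> /complexI; exact: opnorm_eq0. Qed.

HB.instance Definition _ :=
  @Lmodule_isNormed.Build R[i] (BL V W) cnorm cnormD cnormZ cnorm_eq0.

Lemma nrm_BL f : nrm f = opnorm f.
Proof. by []. Qed.

End BoundedOperators.

HB.mixin Record isHilbert (R : realType) H of CompleteNormedModule R[i] H := {
  hdot : H -> H -> R[i];
  hdotP : forall (a : R[i]) (x y z : H),
    hdot (a *: x + y) z = a * hdot x z + hdot y z;
  hdotC : forall x y : H, hdot y x = (hdot x y)^*;
  hdotxx : forall x : H, hdot x x = `|x| ^+ 2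
}.
#[short(type="hilbertType")]
HB.structure Definition Hilbert (R : realType) :=
  {H of CompleteNormedModule R[i] H & isHilbert R H}.

Section Sums.
Context {R : realType} {I : choiceType}.
Implicit Types (a b : I -> R) (f g : I -> R[i]).

Definition psum a : \bar R := \esum_(i in [set: I]) (a i)%:E.

Lemma psum_ge0 a : (forall i, 0 <= a i) -> (0 <= psum a)%E.
Proof. by move=> a0; apply: esum_ge0 => i _; rewrite lee_fin. Qed.

Lemma psum_le a b : (forall i, 0 <= a i) -> (forall i, a i <= b i) -> (psum a <= psum b)%E.
Proof. by move=> _ ab; apply: le_esum => i _; rewrite lee_fin. Qed.

Lemma psumD a b : (forall i, 0 <= a i) -> (forall i, 0 <= b i) ->
  psum (fun i => a i + b i) = (psum a + psum b)%E.
Proof.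
by move=> a0 b0; rewrite /psum -esumD// => i _; rewrite lee_fin.
Qed.

Lemma psumZ (r : R) a : 0 <= r -> (forall i, 0 <= a i) ->
  psum (fun i => r * a i) = (r%:E * psum a)%E.
Proof.
move=> r0 a0.
have le s c : 0 <= s -> (forall i, 0 <= c i) ->
    (psum (fun i => s * c i)%R <= s%:E * psum c)%E.
  move=> s0 c0; apply: ge_ereal_sup => _ [F [finF _] <-].
  under eq_fsbigr do rewrite EFinM.
  rewrite -ge0_mule_fsumr; last by move=> i; rewrite lee_fin.
  rewrite lee_wpmul2l ?lee_fin//.
  by apply: ereal_sup_ubound; exists F.
apply/le_anti; rewrite le //=.
have [r_eq0|r_neq0] := eqVneq r 0.
  by rewrite r_eq0 mul0e psum_ge0// => i; rewrite mul0r.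
have rp : 0 < r by rewrite lt_neqAle eq_sym r_neq0.
have := le r^-1 (fun i => r * a i).
rewrite invr_ge0 r0 => /(_ isT (fun i => mulr_ge0 r0 (a0 i))).
under eq_fun do rewrite mulKf//.
move=> h; rewrite (le_trans (lee_wpmul2l _ h)) ?lee_fin//.
by rewrite muleA -EFinM divff// mul1e.
Qed.


Definition psummable a := (forall i, 0 <= a i) /\ (psum a < +oo)%E.
(* equal to 0 when the family is not summable *)
Definition psumr a : R := fine (psum a).

Lemma psumrK a : psummable a -> psum a = (psumr a)%:E.
Proof.
move=> [a0 aoo]; rewrite /psumr fineK// ge0_fin_numE//; exact: psum_ge0.
Qed.

Lemma psumr_ge0 a : (forall i, 0 <= a i) -> 0 <= psumr a.
Proof. by move=> a0; rewrite fine_ge0// psum_ge0. Qed.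

Lemma psummable0 : psummable (fun=> 0).
Proof. by split=> //; rewrite /psum esum1. Qed.

Lemma psumr0 : psumr (fun=> 0) = 0.
Proof. by rewrite /psumr /psum esum1. Qed.

Lemma psummableD a b : psummable a -> psummable b ->
  psummable (fun i => a i + b i).
Proof.
move=> [a0 aoo] [b0 boo]; split=> [i|]; first exact: addr_ge0.
by rewrite psumD// lte_add_pinfty.
Qed.

Lemma psumrD a b : psummable a -> psummable b ->
  psumr (fun i => a i + b i) = psumr a + psumr b.
Proof.
move=> sa sb; rewrite /psumr psumD ?(sa.1, sb.1)//; [|exact: sa.1|exact: sb.1].
by rewrite !psumrK.
Qed.

Lemma psummableZ (r : R) a : 0 <= r -> psummable a ->
  psummable (fun i => r * a i).
Proof.
move=> r0 sa; split=> [i|]; first by rewrite mulr_ge0// sa.1.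
by rewrite psumZ//; [rewrite psumrK// -EFinM ltry|exact: sa.1].
Qed.

Lemma psumrZ (r : R) a : 0 <= r -> psummable a ->
  psumr (fun i => r * a i) = r * psumr a.
Proof.
by move=> r0 sa; rewrite /psumr psumZ//; [rewrite psumrK|exact: sa.1].
Qed.

Lemma psummable_le a b : (forall i, 0 <= a i) -> (forall i, a i <= b i) ->
  psummable b -> psummable a.
Proof. by move=> a0 ab [b0]; split=> //; apply: le_lt_trans (psum_le _ _) _. Qed.

Lemma psumr_le a b : (forall i, 0 <= a i) -> (forall i, a i <= b i) ->
  psummable b -> psumr a <= psumr b.
Proof.
move=> a0 ab sb; have sa := psummable_le a0 ab sb.
by rewrite -lee_fin -!psumrK// psum_le.
Qed.

Lemma psumr_ge1 a i : psummable a -> a i <= psumr a.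
Proof.
move=> sa; rewrite -lee_fin -psumrK//; apply: ereal_sup_ubound.
exists [set i]; first by split.
by rewrite fsbig_set1.
Qed.

Lemma psumr_ub a (r : R) : (forall i, 0 <= a i) ->
  (forall J : {fset I}, \sum_(i <- J) a i <= r) -> psummable a /\ psumr a <= r.
Proof.
move=> a0 ar.
have le : (psum a <= r%:E)%E.
  apply: ge_ereal_sup => _ [F [finF _] <-].
  by rewrite fsbig_finite//= sumEFin lee_fin.
have sa : psummable a by split=> //; apply: le_lt_trans le (ltry _).
by split=> //; rewrite -lee_fin -psumrK.
Qed.

Lemma psumr_fset a (J : {fset I}) : psummable a ->
  \sum_(i <- J) a i <= psumr a.
Proof.
move=> sa; rewrite -lee_fin -psumrK//; apply: ereal_sup_ubound.
exists [set` J]; first by split=> //; exact: finite_fset.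
by rewrite fsbig_finite//= ?set_fsetK ?sumEFin//; exact: finite_fset.
Qed.

(* meaningful on absolutely summable families only *)
Definition asum a : R :=
  psumr (fun i => Num.max (a i) 0) - psumr (fun i => Num.max (- a i) 0).
Definition csum f : R[i] :=
  (asum (fun i => complex.Re (f i)) +i* asum (fun i => complex.Im (f i)))%C.

Lemma asum_diff a p q : psummable p -> psummable q ->
  (forall i, a i = p i - q i) -> asum a = psumr p - psumr q.
Proof.
move=> sp sq apq; rewrite /asum.
have p0 := sp.1; have q0 := sq.1.
have s1 : psummable (fun i => Num.max (a i) 0).
  apply: psummable_le sp => i; first by rewrite le_max lexx orbT.
  by rewrite ge_max p0 apq gerBl q0.
have s2 : psummable (fun i => Num.max (- a i) 0).
  apply: psummable_le sq => i; first by rewrite le_max lexx orbT.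
  by rewrite ge_max q0 apq opprB gerBl p0.
apply/eqP; rewrite subr_eq addrAC eq_sym subr_eq -!psumrD//.
apply/eqP; congr psumr; apply/funext => i; rewrite apq opprB.
have [pq|pq] := leP (p i) (q i).
  rewrite (@max_r _ _ (p i - q i)) ?subr_le0//.
  by rewrite (@max_l _ _ (q i - p i)) ?subr_ge0//; ring.
rewrite (@max_l _ _ (p i - q i)) ?subr_ge0 ?ltW//.
by rewrite (@max_r _ _ (q i - p i)) ?subr_le0 ?ltW//; ring.
Qed.

Definition asummable a := exists p q,
  [/\ psummable p, psummable q & forall i, a i = p i - q i].

Lemma asumD a b : asummable a -> asummable b ->
  asum (fun i => a i + b i) = asum a + asum b.
Proof.
move=> [p [q [sp sq pq]]] [p' [q' [sp' sq' pq']]].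
rewrite (asum_diff sp sq pq) (asum_diff sp' sq' pq').
rewrite (@asum_diff _ (fun i => p i + p' i) (fun i => q i + q' i)).
- by rewrite !psumrD//; ring.
- exact: psummableD.
- exact: psummableD.
- by move=> i; rewrite pq pq'; ring.
Qed.

Lemma asummableD a b : asummable a -> asummable b ->
  asummable (fun i => a i + b i).
Proof.
move=> [p [q [sp sq pq]]] [p' [q' [sp' sq' pq']]].
exists (fun i => p i + p' i), (fun i => q i + q' i); split.
- exact: psummableD.
- exact: psummableD.
- by move=> i; rewrite pq pq'; ring.
Qed.

Lemma asum_summableN a : asummable a ->
  asummable (fun i => - a i) /\ asum (fun i => - a i) = - asum a.
Proof.
move=> [p [q [sp sq pq]]].
have npq i : - a i = q i - p i by rewrite pq opprB.
split; first by exists q, p; split.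
by rewrite (asum_diff sq sp npq) (asum_diff sp sq pq) opprB.
Qed.

Lemma asum_summableZ (r : R) a : asummable a ->
  asummable (fun i => r * a i) /\ asum (fun i => r * a i) = r * asum a.
Proof.
have pos s b : 0 <= s -> asummable b ->
    asummable (fun i => s * b i) /\ asum (fun i => s * b i) = s * asum b.
  move=> s0 [p [q [sp sq pq]]].
  have spq i : s * b i = s * p i - s * q i by rewrite pq mulrBr.
  have ssp := psummableZ s0 sp; have ssq := psummableZ s0 sq.
  split; first by do 2 eexists; split; [exact: ssp|exact: ssq|].
  by rewrite (asum_diff ssp ssq spq) (asum_diff sp sq pq) !psumrZ// mulrBr.
have [r0 sa|r0 sa] := leP 0 r; first exact: pos.
have [|s e] := pos (- r) a _ sa; first by rewrite oppr_ge0 ltW.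
have [s' e'] := asum_summableN s.
have E : (fun i => r * a i) = (fun i => - (- r * a i)).
  by apply/funext => i; rewrite mulNr opprK.
by rewrite E; split=> //; rewrite e' e mulNr opprK.
Qed.

Lemma asummable_bound a b : psummable b -> (forall i, `|a i| <= b i) ->
  asummable a.
Proof.
move=> sb ab; exists (fun i => a i + b i), b; split=> //.
  apply: (@psummable_le _ (fun i => b i + b i)).
  - by move=> i; move: (ab i); rewrite ler_norml => /andP[]; lra.
  - by move=> i; move: (ab i); rewrite ler_norml => /andP[]; lra.
  - exact: psummableD.
by move=> i; rewrite addrK.
Qed.

Lemma asum_psum a : (forall i, 0 <= a i) -> asum a = psumr a.
Proof.
move=> a0; rewrite /asum.
rewrite (_ : (fun i => Num.max (a i) 0) = a).
  rewrite (_ : (fun i => Num.max (- a i) 0) = fun=> 0) ?psumr0 ?subr0//.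
  by apply/funext => i; rewrite max_r// oppr_le0.
by apply/funext => i; rewrite max_l.
Qed.

End Sums.

Section ComplexFacts.
Context {R : realType}.
Implicit Types z w : R[i].

Lemma sqr_nrm z : nrm z ^+ 2 = complex.Re z ^+ 2 + complex.Im z ^+ 2.
Proof.
rewrite /nrm normc_def/= sqr_sqrtr//; exact: addr_ge0 (sqr_ge0 _) (sqr_ge0 _).
Qed.

Lemma ReMJ z w : complex.Re (z * w^*) =
  complex.Re z * complex.Re w + complex.Im z * complex.Im w.
Proof. by case: z w => [a b] [c d] /=; rewrite mulrN opprK. Qed.

Lemma ImMJ z w : complex.Im (z * w^*) =
  complex.Im z * complex.Re w - complex.Re z * complex.Im w.
Proof. by case: z w => [a b] [c d] /=; rewrite mulrN addrC. Qed.

Lemma abs_le_squares (a b c d : R) :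
  `|a * c + b * d| <= a ^+ 2 + b ^+ 2 + (c ^+ 2 + d ^+ 2).
Proof.
have h1 := sqr_ge0 (a - c); have h2 := sqr_ge0 (a + c).
have h3 := sqr_ge0 (b - d); have h4 := sqr_ge0 (b + d).
have h5 := sqr_ge0 a; have h6 := sqr_ge0 b; have h7 := sqr_ge0 c.
have h8 := sqr_ge0 d; rewrite ler_norml; apply/andP.
rewrite !sqrrD ?sqrrB in h1 h2 h3 h4; split; lra.
Qed.

Lemma Re_bound z w : `|complex.Re (z * w^*)| <= nrm z ^+ 2 + nrm w ^+ 2.
Proof. by rewrite ReMJ !sqr_nrm; exact: abs_le_squares. Qed.

Lemma Im_bound z w : `|complex.Im (z * w^*)| <= nrm z ^+ 2 + nrm w ^+ 2.
Proof.
rewrite ImMJ !sqr_nrm.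
have := abs_le_squares (complex.Im z) (- complex.Re z) (complex.Re w) (complex.Im w).
by rewrite mulNr sqrrN [complex.Im z ^+ 2 + _]addrC.
Qed.

Lemma sqr_nrmD (s t : R) z w : 0 < t -> s * t = 1 ->
  nrm (z + w) ^+ 2 <= (1 + t) * nrm z ^+ 2 + (1 + s) * nrm w ^+ 2.
Proof.
move=> t0 st; have s0 : 0 < s by rewrite -(pmulr_lgt0 _ t0) st.
have h : nrm (z + w) ^+ 2 <= (nrm z + nrm w) ^+ 2.
  by rewrite lerXn2r ?nnegrE ?nrm_ge0 ?addr_ge0 ?nrm_ge0// nrmD.
apply: le_trans h _; set x := nrm z; set y := nrm w.
have : 0 <= s * (t * x - y) ^+ 2 by rewrite mulr_ge0 ?sqr_ge0// ltW.
have -> : s * (t * x - y) ^+ 2 =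
  (s * t) * t * x ^+ 2 - 2 * (s * t) * (x * y) + s * y ^+ 2 by ring.
by rewrite st sqrrD; lra.
Qed.

End ComplexFacts.

Section Ell2.
Context {R : realType} {I : choiceType}.
Implicit Types f g : I -> R[i].

Definition sqsum f : R := psumr (fun i => nrm (f i) ^+ 2).

Definition sqsummable : {pred I -> R[i]} :=
  [pred f : I -> R[i] | `[< (\esum_(i in [set: I]) ((nrm (f i) ^+ 2)%:E) < +oo)%E >]].

Lemma sqsummableP f :
  reflect (psummable (fun i => nrm (f i) ^+ 2)) (f \in sqsummable).
Proof.
apply: (iffP (asboolP _)) => [foo|[]//]; by split=> // i; rewrite sqr_ge0.
Qed.

Lemma sqsummable_submod : submod_closed sqsummable.
Proof.
split=> [|a f g /sqsummableP sf /sqsummableP sg]; apply/sqsummableP.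
  rewrite (_ : (fun _ => _) = fun=> 0); first exact: psummable0.
  by apply/funext => i; rewrite -[X in nrm X]/(0 : R[i]) nrm0 expr0n.
have s1 : psummable (fun i => 2 * nrm a ^+ 2 * nrm (f i) ^+ 2 + 2 * nrm (g i) ^+ 2).
  by apply: psummableD; apply: psummableZ => //; rewrite mulr_ge0// sqr_ge0.
apply: psummable_le s1 => i; first by rewrite sqr_ge0.
have /= := @sqr_nrmD _ 1 1 (a * f i) (g i) ltr01 (mulr1 _).
rewrite (nrmZ a (f i : R[i]^o)) exprMn.
rewrite (_ : 1 + 1 = 2)// mulrA; exact.
Qed.

HB.instance Definition _ :=
  GRing.isSubmodClosed.Build R[i] (I -> R[i]^o) sqsummable sqsummable_submod.

End Ell2.

Record ell2 (R : realType) (I : choiceType) :=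
  MkEll2 { ell2_fun :> I -> R[i]^o; ell2P : ell2_fun \in @sqsummable R I }.

Section Ell2Hilbert.
Context {R : realType} {I : choiceType}.
HB.instance Definition _ := [isSub for @ell2_fun R I].
HB.instance Definition _ := [Choice of ell2 R I by <:].
HB.instance Definition _ := [SubChoice_isSubLmodule of ell2 R I by <:].
Implicit Types f g h : ell2 R I.

Lemma ell2DE f g i : (f + g) i = f i + g i. Proof. by []. Qed.
Lemma ell2ZE (a : R[i]) f i : (a *: f) i = a * f i. Proof. by []. Qed.
Lemma ell2NE f i : (- f) i = - f i. Proof. by []. Qed.
Lemma ell2S f : psummable (fun i => nrm (f i) ^+ 2).
Proof. by case: f => f /= /sqsummableP. Qed.

Definition ell2_norm f : R := Num.sqrt (sqsum f).

Lemma sqsum_ge0 f : 0 <= sqsum f.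
Proof. by apply: psumr_ge0 => i; rewrite sqr_ge0. Qed.

Lemma sqr_ell2_norm f : ell2_norm f ^+ 2 = sqsum f.
Proof. by rewrite sqr_sqrtr// sqsum_ge0. Qed.

Lemma ell2_norm_ge0 f : 0 <= ell2_norm f. Proof. exact: sqrtr_ge0. Qed.

Lemma ell2_normZ (a : R[i]) f : ell2_norm (a *: f) = nrm a * ell2_norm f.
Proof.
rewrite /ell2_norm /sqsum.
under eq_fun do rewrite ell2ZE (nrmZ a (f _ : R[i]^o)) exprMn.
rewrite (psumrZ (sqr_ge0 _) (ell2S f)) sqrtrM ?sqr_ge0// sqrtr_sqr.
by rewrite ger0_norm ?nrm_ge0.
Qed.

Lemma ell2_norm_eq0 f : ell2_norm f = 0 -> f = 0.
Proof.
move=> /eqP; rewrite sqrtr_eq0 => f0; apply/val_inj/funext => i /=.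
apply: nrm0_eq0; apply/eqP; rewrite -sqrf_eq0 eq_le sqr_ge0 andbT.
by apply: le_trans f0; exact: (psumr_ge1 i (ell2S f)).
Qed.

Lemma ell2_normD f g : ell2_norm (f + g) <= ell2_norm f + ell2_norm g.
Proof.
have [/ell2_norm_eq0->|nf] := eqVneq (ell2_norm f) 0.
  by rewrite add0r lerDr ell2_norm_ge0.
have [/ell2_norm_eq0->|ng] := eqVneq (ell2_norm g) 0.
  by rewrite addr0 lerDl ell2_norm_ge0.
have f0 : 0 < ell2_norm f by rewrite lt_neqAle eq_sym nf ell2_norm_ge0.
have g0 : 0 < ell2_norm g by rewrite lt_neqAle eq_sym ng ell2_norm_ge0.
rewrite -(@ler_pXn2r _ 2)// ?nnegrE ?addr_ge0 ?ell2_norm_ge0//.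
set x := ell2_norm f in nf f0 *; set y := ell2_norm g in ng g0 *.
have t0 : 0 < y / x by rewrite divr_gt0.
have st : x / y * (y / x) = 1 by field; rewrite nf ng.
rewrite sqr_ell2_norm.
have u0 : 0 <= 1 + y / x by rewrite addr_ge0// ltW.
have v0 : 0 <= 1 + x / y by rewrite addr_ge0// ltW// divr_gt0.
have S1 := psummableD (psummableZ u0 (ell2S f)) (psummableZ v0 (ell2S g)).
apply: le_trans (psumr_le _ _ S1) _.
- by move=> i; rewrite sqr_ge0.
- by move=> i; rewrite ell2DE; exact: sqr_nrmD.
rewrite (psumrD (psummableZ u0 (ell2S f)) (psummableZ v0 (ell2S g))).
rewrite (psumrZ u0 (ell2S f)) (psumrZ v0 (ell2S g)).
rewrite -!/(sqsum _) -!sqr_ell2_norm -/x -/y le_eqVlt; apply/orP; left; apply/eqP.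
by field; rewrite nf ng.
Qed.

Let cnorm f : R[i] := (ell2_norm f)%:C%C.
Let cnormD f g : cnorm (f + g) <= cnorm f + cnorm g.
Proof. by rewrite -rmorphD lecR ell2_normD. Qed.
Let cnormZ (a : R[i]) f : cnorm (a *: f) = `|a| * cnorm f.
Proof. by rewrite nrmE -rmorphM /= -ell2_normZ. Qed.
Let cnorm_eq0 f : cnorm f = 0 -> f = 0.
Proof. by move=> /complexI; exact: ell2_norm_eq0. Qed.

HB.instance Definition _ :=
  @Lmodule_isNormed.Build R[i] (ell2 R I) cnorm cnormD cnormZ cnorm_eq0.

Lemma nrm_ell2 f : nrm f = ell2_norm f. Proof. by []. Qed.
Lemma norm_ell2 f : `|f| = (ell2_norm f)%:C%C. Proof. by []. Qed.

Definition ell2_dot f g : R[i] := csum (fun i => f i * (g i)^*).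

Lemma ell2_asumRe f g : asummable (fun i => complex.Re (f i * (g i)^*)).
Proof.
apply: (asummable_bound (psummableD (ell2S f) (ell2S g))) => i.
exact: Re_bound.
Qed.

Lemma ell2_asumIm f g : asummable (fun i => complex.Im (f i * (g i)^*)).
Proof.
apply: (asummable_bound (psummableD (ell2S f) (ell2S g))) => i.
exact: Im_bound.
Qed.

Lemma ell2_dotP (a : R[i]) f g h :
  ell2_dot (a *: f + g) h = a * ell2_dot f h + ell2_dot g h.
Proof.
case: a => a b.
apply/eqP; rewrite eq_complex /=; apply/andP; split; apply/eqP.
- have [s1 e1] := asum_summableZ a (ell2_asumRe f h).
  have [s2 e2] := asum_summableZ b (ell2_asumIm f h).
  have [s3 e3] := asum_summableN s2.
  rewrite -e1 -e2 -e3 -(asumD s1 s3).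
  rewrite -(asumD (asummableD s1 s3) (ell2_asumRe g h)).
  congr asum; apply/funext => i; 
  rewrite -[LHS]/(complex.Re (((a +i* b)%C * f i + g i) * (h i)^*)).
  by case: (f i) (g i) (h i) => [fr fi] [gr gi] [hr hi] /=; ring.
- have [s1 e1] := asum_summableZ a (ell2_asumIm f h).
  have [s2 e2] := asum_summableZ b (ell2_asumRe f h).
  rewrite -e1 -e2 -(asumD s1 s2).
  rewrite -(asumD (asummableD s1 s2) (ell2_asumIm g h)).
  congr asum; apply/funext => i; 
  rewrite -[LHS]/(complex.Im (((a +i* b)%C * f i + g i) * (h i)^*)).
  by case: (f i) (g i) (h i) => [fr fi] [gr gi] [hr hi] /=; ring.
Qed.

Lemma ell2_dotC f g : ell2_dot g f = (ell2_dot f g)^*.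
Proof.
apply/eqP; rewrite eq_complex /=; apply/andP; split; apply/eqP.
  congr asum; apply/funext => i.
  by case: (f i) (g i) => [fr fi] [gr gi] /=; ring.
have [_ <-] := asum_summableN (ell2_asumIm f g).
congr asum; apply/funext => i.
by case: (f i) (g i) => [fr fi] [gr gi] /=; ring.
Qed.

Lemma ell2_dotxx f : ell2_dot f f = `|f| ^+ 2.
Proof.
rewrite norm_ell2 -rmorphXn /= sqr_ell2_norm; apply/eqP.
rewrite eq_complex /=; apply/andP; split; apply/eqP.
  rewrite asum_psum => [|i].
    congr psumr; apply/funext => i; rewrite sqr_nrm.
    by case: (f i) => [fr fi] /=; ring.
  by rewrite ReMJ -!expr2 addr_ge0 ?sqr_ge0.
rewrite (_ : (fun i => _) = fun=> 0); last first.
  by apply/funext => i; case: (f i) => [fr fi] /=; ring.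
by rewrite asum_psum// psumr0.
Qed.

Lemma ell2_complete (F : set_system (ell2 R I)) :
  ProperFilter F -> cauchy F -> cvg F.
Proof.
move=> FF /cauchyP Fc.
have ex (e : R) : 0 < e -> exists x : ell2 R I, F [set y | ell2_norm (x - y) < e].
  move=> e0; have [|x Fx] := Fc (e%:C)%C; first by rewrite ltcE /= eqxx.
  exists x; apply: filterS Fx => y; rewrite -ball_normE /=.
  by rewrite norm_ell2 ltcR.
have coord f i : `|complex.Re (f i)| <= ell2_norm f /\ `|complex.Im (f i)| <= ell2_norm f.
  have := psumr_ge1 i (ell2S f); rewrite -/(sqsum f) -sqr_ell2_norm.
  rewrite sqr_nrm => h; split.
    rewrite -(@ler_pXn2r _ 2)// ?nnegrE ?ell2_norm_ge0// real_normK ?num_real//.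
    by apply: le_trans h; rewrite lerDl sqr_ge0.
  rewrite -(@ler_pXn2r _ 2)// ?nnegrE ?ell2_norm_ge0// real_normK ?num_real//.
  by apply: le_trans h; rewrite lerDr sqr_ge0.
have cv (c : R[i] -> R) : (forall u v, c (u - v) = c u - c v) ->
    (forall f i, `|c (f i)| <= ell2_norm f) ->
    forall i, cvg ((fun f : ell2 R I => c (f i)) @ F).
  move=> cB cb i; apply: R_complete; apply/cauchyP => e e0.
  have [x Fx] := ex e e0; exists (c (x i)).
  rewrite /= /nbhs /=; apply: (@filterS _ F _ _ _ _ Fx) => y xy; rewrite /= -ball_normE /=.
  by rewrite -(cB (x i) (y i)); exact: le_lt_trans (cb (x - y) i) xy.
have ReB (u v : R[i]) : complex.Re (u - v) = complex.Re u - complex.Re v.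
  by case: u v => [? ?] [? ?].
have ImB (u v : R[i]) : complex.Im (u - v) = complex.Im u - complex.Im v.
  by case: u v => [? ?] [? ?].
have cvRe := cv _ ReB (fun f i => (coord f i).1).
have cvIm := cv _ ImB (fun f i => (coord f i).2).
pose l i : R[i]^o := (lim ((fun f : ell2 R I => complex.Re (f i)) @ F) +i*
              lim ((fun f : ell2 R I => complex.Im (f i)) @ F))%C.
have key (e : R) (x : ell2 R I) : 0 < e -> F [set y | ell2_norm (x - y) < e] ->
    psummable (fun i => nrm (x i - l i) ^+ 2) /\
    psumr (fun i => nrm (x i - l i) ^+ 2) <= e ^+ 2.
  move=> e0 Fx; apply: psumr_ub => [i|J]; first by rewrite sqr_ge0.
  have cvJ : (\sum_(i <- J) nrm (x i - (y : ell2 R I) i) ^+ 2) @[y --> F] -->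
             \sum_(i <- J) nrm (x i - l i) ^+ 2.
    elim: (enum_fset J) => [|i s IH].
      by under eq_fun do rewrite big_nil; rewrite big_nil; exact: cvg_cst.
    under eq_fun do rewrite big_cons; rewrite big_cons.
    apply: cvgD IH; under eq_fun do rewrite sqr_nrm; rewrite sqr_nrm.
    rewrite ReB ImB; under eq_fun do rewrite ReB ImB.
    under eq_fun do rewrite !expr2; rewrite !expr2.
    have hr : (complex.Re (x i) - complex.Re ((y : ell2 R I) i)) @[y --> F] -->
        complex.Re (x i) - complex.Re (l i).
      by apply: cvgB; [exact: cvg_cst|exact: cvRe].
    have hi : (complex.Im (x i) - complex.Im ((y : ell2 R I) i)) @[y --> F] -->
        complex.Im (x i) - complex.Im (l i).
      by apply: cvgB; [exact: cvg_cst|exact: cvIm].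
    exact: cvgD (cvgM hr hr) (cvgM hi hi).
  apply: (cvgr_to_le cvJ); apply: filterS Fx => y xy.
  apply: le_trans (psumr_fset J (ell2S (x - y))) _.
  rewrite -/(sqsum (x - y)) -sqr_ell2_norm.
  by rewrite lerXn2r ?nnegrE ?ell2_norm_ge0// ltW.
have sl : l \in @sqsummable R I.
  have [x Fx] := ex 1 ltr01; have [s _] := key 1 x ltr01 Fx.
  have sx : ((x : I -> R[i]^o) - l) \in @sqsummable R I by apply/sqsummableP.
  by rewrite -[l](subKr (x : I -> R[i]^o)) rpredB// ell2P.
pose L := MkEll2 sl; apply/cvg_ex; exists L.
apply/cvgrPdist_le => e e0.
have eR : e = (complex.Re e)%:C%C by rewrite RRe_real// gtr0_real.
have e'0 : 0 < complex.Re e / 2 by move: e0; rewrite ltcE /= => /andP[_ ?]; rewrite divr_gt0.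
have [x Fx] := ex _ e'0; have [_ s] := key _ x e'0 Fx.
apply: filterS Fx => y xy.
rewrite norm_ell2 eR lecR.
rewrite (_ : L - y = (- (x - L)) + (x - y)); last by rewrite opprB addrA subrK.
rewrite (le_trans (ell2_normD _ _))//.
have h : ell2_norm (- (x - L)) <= complex.Re e / 2.
  rewrite -scaleN1r ell2_normZ nrmN [nrm _](nrmR 1) normr1 mul1r.
  rewrite -(@ler_pXn2r _ 2)// ?nnegrE ?ell2_norm_ge0//; last exact: ltW.
  by rewrite sqr_ell2_norm.
by rewrite [leRHS]splitr lerD// ltW.
Qed.

HB.instance Definition _ := Uniform_isComplete.Build (ell2 R I) ell2_complete.
HB.instance Definition _ :=
  isHilbert.Build R (ell2 R I) ell2_dotP ell2_dotC ell2_dotxx.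

End Ell2Hilbert.

(* The free group on countably many generators g_0, g_1, ...: a letter (k, b)
   stands for g_k if b and for its inverse otherwise; elements are reduced
   words, and multiplication is concatenation followed by cancellation. *)
Definition letter : Type := (nat * bool)%type.
HB.instance Definition _ := Choice.on letter.
Definition linv (l : letter) : letter := (l.1, ~~ l.2).
Definition reduced (w : seq letter) : bool :=
  sorted (fun l l' => l' != linv l) w.
Definition push (l : letter) (w : seq letter) : seq letter :=
  if w is l' :: w' then if l' == linv l then w' else l :: w else [:: l].
Definition wmul (v w : seq letter) : seq letter := foldr push w v.
Definition winv (w : seq letter) : seq letter := rev (map linv w).

Lemma linvK : involutive linv.
Proof. by case=> k b; rewrite /linv /= negbK. Qed.

Lemma reduced_behead l w : reduced (l :: w) -> reduced w.
Proof. by rewrite /reduced; case: w => //= l' w /andP[]. Qed.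

Lemma reduced_push l w : reduced w -> reduced (push l w).
Proof.
case: w => // l' w rw /=; case: ifPn => h; first exact: reduced_behead rw.
by rewrite /reduced /= h.
Qed.

Lemma pushK l w : reduced w -> push l (push (linv l) w) = w.
Proof.
case: w => [|l' w] rw /=; first by rewrite eqxx.
rewrite linvK; case: ifPn => [/eqP ll|h /=]; last by rewrite eqxx.
rewrite ll in rw *; case: w rw => //= l'' w; rewrite /reduced /= => /andP[h _].
by rewrite (negPf h).
Qed.

Lemma reduced_wmul v w : reduced w -> reduced (wmul v w).
Proof. by move=> rw; elim: v => //= l v; exact: reduced_push. Qed.

Lemma wmul_push l v w : reduced v -> reduced w ->
  wmul (push l v) w = push l (wmul v w).
Proof.
case: v => // l' v rv rw /=; case: ifPn => // /eqP ->.
by rewrite pushK// reduced_wmul// .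
Qed.

Lemma wmulA u v w : reduced u -> reduced v -> reduced w ->
  wmul u (wmul v w) = wmul (wmul u v) w.
Proof.
elim: u => //= l u IH ru rv rw.
by rewrite wmul_push ?reduced_wmul// IH//; exact: reduced_behead ru.
Qed.

Lemma wmulw1 w : reduced w -> wmul w [::] = w.
Proof.
elim: w => //= l w IH rw; rewrite IH; last exact: reduced_behead rw.
by case: w rw {IH} => //= l' w; rewrite /reduced /= => /andP[/negPf ->].
Qed.

Lemma winvK : involutive winv.
Proof. by move=> w; rewrite /winv map_rev revK mapK//; exact: linvK. Qed.

Lemma reduced_winv w : reduced w -> reduced (winv w).
Proof.
rewrite /winv /reduced rev_sorted sorted_map; apply: sub_sorted => l l' /=.
by apply: contraNneq => /(can_inj linvK) ->; rewrite linvK.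
Qed.

Lemma wmulVw w : reduced w -> wmul (winv w) w = [::].
Proof.
elim: w => // l w IH rw; rewrite /wmul /winv /= rev_cons foldr_rcons /=.
by rewrite linvK eqxx; apply: IH; exact: reduced_behead rw.
Qed.

Record freeGroup := FreeGroup { fg_word :> seq letter; fgP : reduced fg_word }.
HB.instance Definition _ := [isSub for fg_word].
HB.instance Definition _ := [Choice of freeGroup by <:].

Section FreeGroup.
Implicit Types s t v : freeGroup.

Definition fg_one : freeGroup := @FreeGroup [::] isT.
Definition fg_mul s t := FreeGroup (reduced_wmul s (fgP t)).
Definition fg_inv s := FreeGroup (reduced_winv (fgP s)).

Lemma fg_mulA : associative fg_mul.
Proof. by move=> s t v; apply/val_inj; rewrite /= wmulA// fgP. Qed.
Lemma fg_mul1g : left_id fg_one fg_mul.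
Proof. by move=> s; exact/val_inj. Qed.
Lemma fg_mulg1 : right_id fg_one fg_mul.
Proof. by move=> s; apply/val_inj; rewrite /= wmulw1// fgP. Qed.
Lemma fg_mulVg : left_inverse fg_one fg_inv fg_mul.
Proof. by move=> s; apply/val_inj; rewrite /= wmulVw// fgP. Qed.
Lemma fg_mulgV : right_inverse fg_one fg_inv fg_mul.
Proof.
move=> s; apply/val_inj; rewrite /= -[X in wmul X _](winvK s).
by rewrite wmulVw// reduced_winv// fgP.
Qed.

HB.instance Definition _ := isGroup.Build freeGroup
  fg_mulA fg_mul1g fg_mulg1 fg_mulVg fg_mulgV.

Definition fgen (k : nat) : freeGroup := @FreeGroup [:: (k, true)] isT.

End FreeGroup.

Section LeftRegular.
Context (R : realType) {G : groupType}.

Lemma psumr_transl (t : G) (a : G -> R) :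
  psum (fun s => a (t^-1 * s)%g) = psum a.
Proof.
rewrite /psum [RHS](reindex_esum setT setT (fun s => t^-1 * s)%g)//.
split=> //; first by move=> s s' _ _; exact: mulgI.
by move=> s _; exists (t * s)%g; rewrite // mulKg.
Qed.

Lemma lreg_subproof (t : G) (f : ell2 R G) :
  (fun s => f (t^-1 * s)%g) \in @sqsummable R G.
Proof.
apply/sqsummableP; split=> [s|]; first exact: sqr_ge0.
rewrite (psumr_transl t (fun s => nrm (f s) ^+ 2)); exact: (ell2S f).2.
Qed.

Definition lreg_fun (t : G) (f : ell2 R G) : ell2 R G :=
  MkEll2 (lreg_subproof t f).

Lemma lreg_bounded (t : G) : lreg_fun t \in @bounded_op R (ell2 R G) (ell2 R G).
Proof.
apply/asboolP; split=> [a f g|]; first exact/val_inj.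
exists 1 => f; rewrite mul1r !nrm_ell2 /ell2_norm /sqsum /psumr.
by rewrite (psumr_transl t (fun s => nrm (f s) ^+ 2)).
Qed.

Definition lreg (t : G) : BL (ell2 R G) (ell2 R G) := MkBL (lreg_bounded t).

End LeftRegular.

Section Operators.
Context {R : realType}.
Implicit Types H K : hilbertType R.

Lemma BL_comp_subproof H (S T : BL H H) : (S \o T) \in @bounded_op R H H.
Proof.
apply/asboolP; split=> [a x y|]; first by rewrite /= !linearP.
exists (opnorm S * opnorm T) => x /=.
rewrite (le_trans (nrm_opnorm S (T x)))// -mulrA ler_wpM2l ?opnorm_ge0//.
exact: nrm_opnorm.
Qed.
Definition BL_comp H (S T : BL H H) : BL H H := MkBL (BL_comp_subproof S T).

Definition is_adjoint H (T S : BL H H) : Prop :=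
  forall x y : H, hdot (T x) y = hdot x (S y).
Definition adjoint H (T : BL H H) : BL H H := xget 0 [set S | is_adjoint T S].
Lemma adjointP H (T S : BL H H) : is_adjoint T S -> is_adjoint T (adjoint T).
Proof. exact: (@xgetI _ 0 [set S | is_adjoint T S] S). Qed.

Definition compact_op H (T : BL H H) : Prop :=
  compact (closure [set T x | x in [set x : H | nrm x <= 1]]).

(* The norm of B(H^n) = M_n(B(H)), where H^n carries the l2 direct sum norm. *)
Definition l2sum H n (h : 'I_n -> H) : R := Num.sqrt (\sum_i nrm (h i) ^+ 2).
Definition mxnorm H n (x : 'M[BL H H]_n) : \bar R :=
  ereal_sup [set (l2sum (fun i => \sum_j x i j (h j)))%:E
            | h in [set h : 'I_n -> H | l2sum h <= 1]].

(* A list of pairs (k, h) stands for the sum of the elementary tensors k (x) h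
   in the algebraic tensor product of K and H, a dense subspace of the Hilbert
   space tensor product; a list of pairs of operators (a, b) stands likewise
   for the sum of the a (x) b, and [minnorm] is the norm of that sum as an
   operator on the Hilbert space tensor product. *)
Definition tensor_norm K H (z : seq (K * H)) : R :=
  Num.sqrt (complex.Re
    (\sum_(p <- z) \sum_(q <- z) hdot p.1 q.1 * hdot p.2 q.2)).
Definition tensor_app K H (s : seq (BL K K * BL H H)) (z : seq (K * H)) :
  seq (K * H) :=
  [seq ((ab.1 : BL K K) p.1, (ab.2 : BL H H) p.2) | ab <- s, p <- z].
Definition minnorm K H (s : seq (BL K K * BL H H)) : \bar R :=
  ereal_sup [set (tensor_norm (tensor_app s z))%:E
            | z in [set z : seq (K * H) | tensor_norm z <= 1]].

End Operators.

Record opSpace (R : realType) (H : hilbertType R) := OpSpace {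
  os_set : {pred BL H H};
  os_submod : submod_closed os_set;
  os_closed : closed [set x | x \in os_set]
}.

HB.instance Definition _ (R : realType) (H : hilbertType R) (E : opSpace H) :=
  GRing.isSubmodClosed.Build R[i] (BL H H) (os_set E) (os_submod E).

Record os_elt (R : realType) (H : hilbertType R) (E : opSpace H) :=
  OsElt { os_val :> BL H H; os_valP : os_val \in os_set E }.
Coercion os_elt : opSpace >-> Sortclass.

Section OpSpaceNormed.
Context {R : realType} {H : hilbertType R} (E : opSpace H).
HB.instance Definition _ := [isSub for @os_val R H E].
HB.instance Definition _ := [Choice of os_elt E by <:].
HB.instance Definition _ := [SubChoice_isSubLmodule of os_elt E by <:].

Let onorm (x : os_elt E) : R[i] := `|os_val x|.
Let onormD x y : onorm (x + y) <= onorm x + onorm y.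
Proof. exact: ler_normD. Qed.
Let onormZ (a : R[i]) x : onorm (a *: x) = `|a| * onorm x.
Proof. exact: normrZ. Qed.
Let onorm_eq0 x : onorm x = 0 -> x = 0.
Proof. by move=> /normr0_eq0 ?; exact: val_inj. Qed.
HB.instance Definition _ :=
  @Lmodule_isNormed.Build R[i] (os_elt E) onorm onormD onormZ onorm_eq0.

Lemma nrm_os (x : os_elt E) : nrm x = opnorm (os_val x).
Proof. by []. Qed.

End OpSpaceNormed.

Section OperatorSpaces.
Context {R : realType}.
Implicit Types H K : hilbertType R.

Definition os_mxnorm H (E : opSpace H) n (x : 'M[E]_n) : \bar R :=
  mxnorm (map_mx (@os_val R H E) x).

Definition cbnorm H K (E : opSpace H) (G : opSpace K) (v : E -> G) : \bar R :=
  ereal_sup [set r | exists n (x : 'M[E]_n),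
    (os_mxnorm x <= 1)%E /\ r = os_mxnorm (map_mx v x)].

Definition complete_isometry H K (E : opSpace H) (G : opSpace K)
    (v : E -> G) : Prop :=
  forall n (x : 'M[E]_n), os_mxnorm (map_mx v x) = os_mxnorm x.

(* +oo when there is no isomorphism, as the infimum of the empty set. *)
Definition dcb H K (E : opSpace H) (G : opSpace K) : \bar R :=
  ereal_inf [set c | exists (v : {linear E -> G}) (w : {linear G -> E}),
    [/\ cancel v w, cancel w v & c = (cbnorm v * cbnorm w)%E]].

Definition finite_dim H (E : opSpace H) : Prop :=
  exists n (e : 'I_n -> E), forall x : E,
    exists c : 'I_n -> R[i], x = \sum_i c i *: e i.

Definition dSK_fin H (E : opSpace H) : \bar R :=
  ereal_inf [set r | exists G : opSpace (ell2 R nat),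
    (forall T, T \in os_set G -> compact_op T) /\ r = dcb E G].

Definition dSK H (E : opSpace H) : \bar R :=
  if `[< finite_dim E >] then dSK_fin E
  else ereal_sup [set r | exists X : opSpace H,
    [/\ finite_dim X, {subset os_set X <= os_set E} & r = dSK_fin X]].

Definition exact_os H (E : opSpace H) : Prop := (dSK E < +oo)%E.

Definition os_dual H (E : opSpace H) := BL E R[i]^o.

Definition tb_form H K (E : opSpace H) (F : opSpace K) (u : E -> os_dual F)
    n (x : 'M[E]_n) (y : 'M[F]_n) : R[i] :=
  n%:R^-1 * \sum_i \sum_j u (x i j) (y i j).

Definition tbnorm H K (E : opSpace H) (F : opSpace K) (u : E -> os_dual F) :
    \bar R :=
  ereal_sup [set r | exists n (x : 'M[E]_n) (y : 'M[F]_n),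
    [/\ (0 < n)%N, (os_mxnorm x <= 1)%E, (os_mxnorm y <= 1)%E &
        r = (nrm (tb_form u x y))%:E]].

Definition tracially_bounded H K (E : opSpace H) (F : opSpace K)
    (u : E -> os_dual F) : Prop := (tbnorm u < +oo)%E.

Definition lnorm H K (E : opSpace H) (F : opSpace K) (u : E -> os_dual F) :
    \bar R :=
  ereal_sup [set (nrm (u x))%:E | x in [set x : E | nrm x <= 1]].

(* A C*-algebra is taken with a faithful representation on a Hilbert space,
   that is, as a norm-closed *-subalgebra of B(H); this fixes its operator space
   structure. *)
Definition Cstar_algebra H (A : opSpace H) : Prop :=
  (forall S T, S \in os_set A -> T \in os_set A -> BL_comp S T \in os_set A) /\
  (forall T, T \in os_set A -> exists2 S, S \in os_set A & is_adjoint T S).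

(* The norm of the sum of the lreg t (x) x, for (t, x) in s. *)
Definition lreg_norm H (E : opSpace H) (s : seq (freeGroup * E)) : \bar R :=
  minnorm [seq (lreg R p.1, os_val p.2) | p <- s].

Definition fsupp_seq H (E : opSpace H) (x : freeGroup -> E) :
    seq (freeGroup * E) :=
  [seq (t, x t) | t <- fset_set [set t | x t != 0]].

(* max of the norms of (sum_i a_i^* a_i)^(1/2) and (sum_i a_i a_i^* )^(1/2) *)
Definition row_col_max H n (a : 'I_n -> BL H H) : R :=
  Num.max
    (Num.sqrt (nrm (\sum_i BL_comp (adjoint (a i)) (a i))))
    (Num.sqrt (nrm (\sum_i BL_comp (a i) (adjoint (a i))))).

End OperatorSpaces.

(* Main.v *)
Require Import Defs.
From HB Require Import structures.
From mathcomp Require Import all_boot all_order all_algebra fingroup perm.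
From mathcomp Require Import all_classical all_reals all_analysis.
From mathcomp Require Import complex.
From mathcomp Require Import finmap ring lra.
Set Implicit Arguments.
Unset Strict Implicit.
Unset Printing Implicit Defensive.
Import Order.TTheory GRing.Theory Num.Theory.
Import numFieldNormedType.Exports.
Local Open Scope classical_set_scope.
Local Open Scope ring_scope.

(** Let X be the sum of the lambda(t) (x) x_t, and Y that of the
    lambda(t) (x) y_t. The free group is residually finite: it acts on finite
    sets {1, .., n} by permutation matrices pi(t) in such a way that a prescribed
    finite set of elements acts freely ([free_finite_action]). If it contains the
    supports of x and y, then tr_n(pi(s) pi(t)^T) is 1 when s = t and 0 otherwise,
    so that the tracial form u_n takes on the matrices

      X_n = sum of the pi(t) (x) x_t,   Y_n = sum of the pi(t) (x) y_t

    exactly the value sum_t <u(x_t), y_t>. The norm of X_n may however exceed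
    that of X by far. Exactness repairs this: there is a projection p in M_n, with
    tr_n(1 - p) as small as one wishes, such that X_n (p (x) 1) has a norm close to
    d_SK(E) |X| ([lift_os]); and such a p hardly changes the trace pairing
    ([almost_orthogonal]). This gives the first inequality
    ([exact_bilinear_bound]), of which the second one is a special case.

    To find p, replace E by a space of compact operators on ell2, then these by
    N x N matrices z_t. Let Z and Z_n be the operators with coefficients z_t on
    the group and on {1, .., n}. The action looks like the group near every point,
    so Z_n^* Z_n and its powers have the same diagonal entries as those of Z; hence
    the vectors on which Z_n is larger than (1 + e) |Z| span only a small part of
    the space. A vector w of C^n whose products w (x) e_b are all orthogonal to
    that part is harmless, and p projects onto these w ([cutoff_projection]). No
    spectral theory enters: the exceptional vectors are a maximal orthonormal
    system, whose size is bounded by Hilbert-Schmidt norms.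

    The operators on ell2(G) (x) H are only ever used through their finite
    sections, the matrices with entries x(s_i s_j^-1) ([sec_bound]). For the row and
    column norms these are bounded directly ([row_col_sec_bound]): a product
    g_k s either begins with g_k or cancels a first letter of s, and the two cases
    are estimated by a column and by a row norm, whence the factor 2 for each of the
    two families.

    For the extension, the inequality with rows and columns says that u is bounded on
    E (x) F for a certain norm on tensor products. That norm is injective: a
    representation in A (x) B of an element of E (x) F is turned into one in
    E (x) F by two orthogonal projections of finite rank, which do not increase
    row and column norms ([etens_restrict]). So the theorem of Hahn and Banach
    extends u to A (x) B ([bilinear_extension]), and the extension is tracially
    bounded because the entries of an n x n contraction form a family bounded by n
    both as a row and as a column ([rc_bd_matrix]). *)

(** * Semi-inner products *)

Section Scalars.
Context {R : realType}.
Implicit Types (z w : R[i]) (r : R).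

Lemma nrmC_sq z : z * z^* = ((nrm z ^+ 2)%:C)%C.
Proof. by rewrite -normCK nrmE -rmorphXn. Qed.

Lemma nrmM z w : nrm (z * w) = nrm z * nrm w.
Proof. exact: (nrmZ z (w : R[i]^o)). Qed.

Lemma nrm_conj z : nrm z^* = nrm z.
Proof. by rewrite /nrm norm_conjC. Qed.

Lemma nrm1 : nrm (1 : R[i]) = 1.
Proof. by rewrite /nrm normr1. Qed.

Lemma Re_le_nrm z : complex.Re z <= nrm z.
Proof.
rewrite (le_trans (ler_norm _))// -(@ler_pXn2r _ 2) ?nnegrE ?nrm_ge0//.
by rewrite sqr_nrm real_normK ?num_real// lerDl sqr_ge0.
Qed.

Lemma ReRr r z : complex.Re ((r%:C)%C * z) = r * complex.Re z.
Proof. by case: z => a b /=; rewrite mul0r subr0. Qed.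

Lemma ReDr z w : complex.Re (z + w) = complex.Re z + complex.Re w.
Proof. by case: z w => [? ?] [? ?]. Qed.

Lemma Re_sum (I : Type) (s : seq I) (P : pred I) (f : I -> R[i]) :
  complex.Re (\sum_(i <- s | P i) f i) = \sum_(i <- s | P i) complex.Re (f i).
Proof. exact: (big_morph _ ReDr (erefl _)). Qed.

Lemma nrm_sum (V : normedZmodType R[i]) (I : Type) (s : seq I) (P : pred I)
  (f : I -> V) : nrm (\sum_(i <- s | P i) f i) <= \sum_(i <- s | P i) nrm (f i).
Proof.
elim/big_ind2 : _ => //; first by rewrite nrm0.
by move=> x1 x2 y1 y2 h1 h2; rewrite (le_trans (nrmD _ _))// lerD.
Qed.

End Scalars.

(** One notion serves for Hilbert spaces, for C^I and for the Hilbert sums H^I. *)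
Record is_ip (R : realType) (V : lmodType R[i]) (f : V -> V -> R[i]) : Prop :=
  IsIp {
    ipP : forall a x y z, f (a *: x + y) z = a * f x z + f y z;
    ipC : forall x y, f y x = (f x y)^*;
    ip_ge0 : forall x, 0 <= f x x }.

Section Ip.
Context {R : realType} {V : lmodType R[i]} {f : V -> V -> R[i]}.
Hypothesis ipf : is_ip f.
Implicit Types (x y z : V) (a : R[i]) (b l : seq V).

Definition ipsq (g : V -> V -> R[i]) x : R := complex.Re (g x x).

Lemma ipxx x : f x x = ((ipsq f x)%:C)%C.
Proof. by rewrite /ipsq RRe_real// ger0_real// (ip_ge0 ipf). Qed.

Lemma ipsq_ge0 x : 0 <= ipsq f x.
Proof. by have := ip_ge0 ipf x; rewrite ipxx ler0c. Qed.

Lemma ipDl x y z : f (x + y) z = f x z + f y z.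
Proof. by have := ipP ipf 1 x y z; rewrite scale1r mul1r. Qed.

Lemma ip0l z : f 0 z = 0.
Proof. by apply: (addIr (f 0 z)); rewrite -ipDl !add0r. Qed.

Lemma ipZl a x z : f (a *: x) z = a * f x z.
Proof. by have := ipP ipf a x 0 z; rewrite addr0 ip0l addr0. Qed.

Lemma ipNl x z : f (- x) z = - f x z.
Proof. by rewrite -scaleN1r ipZl mulN1r. Qed.

Lemma ipBl x y z : f (x - y) z = f x z - f y z.
Proof. by rewrite ipDl ipNl. Qed.

Lemma ipDr x y z : f z (x + y) = f z x + f z y.
Proof. by rewrite (ipC ipf) ipDl rmorphD /= -!(ipC ipf). Qed.

Lemma ip0r z : f z 0 = 0.
Proof. by rewrite (ipC ipf) ip0l rmorph0. Qed.

Lemma ipZr a x z : f z (a *: x) = a^* * f z x.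
Proof. by rewrite (ipC ipf) ipZl rmorphM /= -!(ipC ipf). Qed.

Lemma ipNr x z : f z (- x) = - f z x.
Proof. by rewrite (ipC ipf) ipNl rmorphN /= -!(ipC ipf). Qed.

Lemma ipBr x y z : f z (x - y) = f z x - f z y.
Proof. by rewrite ipDr ipNr. Qed.

Lemma ip_suml (I : Type) (s : seq I) (P : pred I) (g : I -> V) z :
  f (\sum_(i <- s | P i) g i) z = \sum_(i <- s | P i) f (g i) z.
Proof. by apply: (big_morph (f^~ z)); [move=> x y; exact: ipDl|exact: ip0l]. Qed.

Lemma ip_sumr (I : Type) (s : seq I) (P : pred I) (g : I -> V) z :
  f z (\sum_(i <- s | P i) g i) = \sum_(i <- s | P i) f z (g i).
Proof. by apply: (big_morph (f z)); [move=> x y; exact: ipDr|exact: ip0r]. Qed.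

Lemma ipsqZ a x : ipsq f (a *: x) = nrm a ^+ 2 * ipsq f x.
Proof. by rewrite /ipsq ipZl ipZr mulrA nrmC_sq ReRr. Qed.

Lemma ipsq_pyth x y : f x y = 0 -> ipsq f (x + y) = ipsq f x + ipsq f y.
Proof.
by move=> xy; rewrite /ipsq ipDl !ipDr (ipC ipf x y) xy rmorph0 addr0 add0r ReDr.
Qed.

(** The square of x - t <x, y> y is nonnegative for all real t. Take t = 1 / |y|^2,
    or t large if |y| = 0, which can happen for y <> 0. *)
Lemma ip_cs_sq x y : nrm (f x y) ^+ 2 <= ipsq f x * ipsq f y.
Proof.
have key t : 0 <= ipsq f x - 2 * t * nrm (f x y) ^+ 2
    + t ^+ 2 * nrm (f x y) ^+ 2 * ipsq f y.
  have := ipsq_ge0 (x - ((t%:C)%C * f x y) *: y).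
  rewrite /ipsq ipBl !ipBr !ipZl !ipZr (ipC ipf x y) (ipxx y) (ipxx x).
  set c := f x y; case: c => a b; rewrite -/(ipsq f x) !sqr_nrm /=.
  move=> h; apply: le_trans h _; rewrite le_eqVlt; apply/orP; left; apply/eqP.
  by rewrite /ipsq; ring.
set c := nrm _ ^+ 2 in key *.
have c0 : 0 <= c by exact: sqr_ge0.
have [y0|y0] := eqVneq (ipsq f y) 0.
  rewrite y0 mulr0 leNgt; apply/negP => cp.
  have := key ((ipsq f x + 1) / (2 * c)); rewrite y0 mulr0 addr0.
  rewrite (_ : 2 * _ * c = ipsq f x + 1); last by field; rewrite gt_eqF.
  by have := ipsq_ge0 x; lra.
have yp : 0 < ipsq f y by rewrite lt_neqAle eq_sym y0 ipsq_ge0.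
have := key (ipsq f y)^-1.
rewrite (_ : _ + _ = ipsq f x - c / ipsq f y); last by field; rewrite gt_eqF.
by rewrite subr_ge0 ler_pdivrMr.
Qed.

Definition ipn (g : V -> V -> R[i]) x : R := Num.sqrt (ipsq g x).

Lemma ipn_ge0 x : 0 <= ipn f x. Proof. exact: sqrtr_ge0. Qed.

Lemma ipn_sq x : ipn f x ^+ 2 = ipsq f x.
Proof. by rewrite sqr_sqrtr// ipsq_ge0. Qed.

Lemma ip_cs x y : nrm (f x y) <= ipn f x * ipn f y.
Proof.
rewrite -(@ler_pXn2r _ 2) ?nnegrE ?nrm_ge0 ?mulr_ge0 ?ipn_ge0//.
by rewrite exprMn !ipn_sq ip_cs_sq.
Qed.

Lemma ipnD x y : ipn f (x + y) <= ipn f x + ipn f y.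
Proof.
rewrite -(@ler_pXn2r _ 2) ?nnegrE ?addr_ge0 ?ipn_ge0//.
rewrite sqrrD !ipn_sq /ipsq ipDl !ipDr (ipC ipf x y) !ReDr -!/(ipsq f _).
have := le_trans (Re_le_nrm (f x y)) (ip_cs x y).
have -> : complex.Re (f x y)^* = complex.Re (f x y) by case: (f x y).
lra.
Qed.

Lemma ipn_sum (I : Type) (s : seq I) (P : pred I) (g : I -> V) :
  ipn f (\sum_(i <- s | P i) g i) <= \sum_(i <- s | P i) ipn f (g i).
Proof.
elim/big_ind2 : _ => //; first by rewrite /ipn /ipsq ip0l sqrtr0.
by move=> x1 x2 y1 y2 h1 h2; rewrite (le_trans (ipnD _ _))// lerD.
Qed.

Fixpoint onsys b : Prop :=
  if b is v :: b' then
    [/\ ipsq f v = 1, forall w, w \in b' -> f w v = 0 & onsys b']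
  else True.

Lemma bessel b x : onsys b -> \sum_(v <- b) nrm (f x v) ^+ 2 <= ipsq f x.
Proof.
elim: b x => [|v b IH] x; first by rewrite big_nil ipsq_ge0.
move=> /= [v1 vb ob]; rewrite big_cons.
pose x' := x - f x v *: v.
have xE : x = f x v *: v + x' by rewrite addrC subrK.
have x'v : f x' v = 0 by rewrite ipBl ipZl ipxx v1 mulr1 subrr.
rewrite [in X in _ <= X]xE ipsq_pyth; last first.
  by rewrite (ipC ipf) ipZr x'v mulr0 rmorph0.
rewrite ipsqZ v1 mulr1 lerD2l; apply: le_trans (IH x' ob).
rewrite big_seq [leRHS]big_seq le_eqVlt; apply/orP; left; apply/eqP.
apply: eq_bigr => w wb; congr (nrm _ ^+ 2).
by rewrite ipBl ipZl (ipC ipf w v) (vb _ wb) rmorph0 mulr0 subr0.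
Qed.

Definition ipproj b x := \sum_(v <- b) f x v *: v.

Lemma onsys_ipproj b x w : onsys b -> w \in b ->
  f (x - ipproj b x) w = 0.
Proof.
move=> ob wb; rewrite ipBl /ipproj ip_suml.
suff -> : \sum_(v <- b) f (f x v *: v) w = f x w by rewrite subrr.
elim: b ob wb => //= v b IH [v1 vb ob].
rewrite inE big_cons ipZl => /predU1P[->|wb].
  rewrite ipxx v1 mulr1 big_seq big1 ?addr0// => v' v'b.
  by rewrite ipZl vb// mulr0.
by rewrite IH// (ipC ipf w v) (vb w wb) rmorph0 mulr0 add0r.
Qed.

Hypothesis ip_def : forall x, ipsq f x = 0 -> x = 0.

Lemma onsys_extend b x : onsys b -> x != ipproj b x ->
  exists a, onsys (a *: (x - ipproj b x) :: b).
Proof.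
move=> ob xb; set y := x - ipproj b x.
have y0 : 0 < ipsq f y.
  rewrite lt_neqAle ipsq_ge0 andbT eq_sym; apply: contra xb => /eqP /ip_def y0.
  by rewrite -subr_eq0 -/y y0.
exists (((ipn f y)^-1)%:C)%C; split=> //.
  rewrite ipsqZ nrmR ger0_norm ?invr_ge0 ?ipn_ge0// exprVn ipn_sq.
  by rewrite mulVf ?gt_eqF.
move=> w wb; rewrite ipZr (ipC ipf) onsys_ipproj//.
by rewrite rmorph0 mulr0.
Qed.

(** The last clause says that the new vectors are combinations of the old ones,
    without naming the coefficients. *)
Lemma gram_schmidt l : exists b, [/\ onsys b, (size b <= size l)%N,
  forall x, x \in l -> x = ipproj b x &
  forall S : set V, (forall a x y, S x -> S y -> S (a *: x + y)) -> S 0 ->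
    (forall x, x \in l -> S x) -> forall x, x \in b -> S x].
Proof.
elim: l => [|x l [b [ob sb lb bS]]]; first by exists [::].
have [xb|xb] := eqVneq x (ipproj b x).
  exists b; split=> //; first by rewrite (leq_trans sb)//=.
    by move=> y; rewrite inE => /predU1P[->//|]; exact: lb.
  move=> S S1 S0 Sl; apply: bS => // y yl; apply: Sl; rewrite inE yl orbT//.
have [a ob'] := onsys_extend ob xb.
set v := a *: _ in ob'.
have [v1 vb _] := ob'.
have keep y : y = ipproj b y -> y = ipproj (v :: b) y.
  move=> yb; rewrite /ipproj big_cons -/(ipproj b y) -yb.
  rewrite [f y v]( _ : _ = 0) ?scale0r ?add0r//.
  rewrite yb /ipproj ip_suml big_seq big1// => w wb.
  by rewrite ipZl (vb _ wb) mulr0.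
exists (v :: b); split=> //.
- move=> y; rewrite inE => /predU1P[->|yl]; last exact/keep/lb.
  rewrite /ipproj big_cons -/(ipproj b x).
  have E : x = (x - ipproj b x) + ipproj b x by rewrite subrK.
  have pv : f (ipproj b x) v = 0.
    rewrite /ipproj ip_suml big_seq big1// => w wb.
    by rewrite ipZl (vb _ wb) mulr0.
  rewrite {2}E ipDl pv addr0.
  have xv : f (x - ipproj b x) v = a^-1.
    have : f v v = 1 by rewrite ipxx v1.
    rewrite {1}/v ipZl => h; apply: (mulfI (x := a)).
      by apply/eqP => a0; move: h; rewrite a0 mul0r => /eqP; rewrite eq_sym oner_eq0.
    rewrite h divff//; apply/eqP => a0.
    by move: h; rewrite a0 mul0r => /eqP; rewrite eq_sym oner_eq0.
  rewrite xv /v scalerA mulVf ?scale1r ?subrK//.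
  apply/eqP => a0; have := v1; rewrite /v a0 scale0r /ipsq ip0l /= => /eqP.
  by rewrite eq_sym oner_eq0.
- move=> S S1 S0 Sl y.
  have Sb z : z \in b -> S z.
    by apply: bS => // w wl; apply: Sl; rewrite inE wl orbT.
  rewrite inE => /predU1P[->|]; last exact: Sb.
  have SZ c w : S w -> S (c *: w) by move=> Sw; rewrite -[_ *: _]addr0; exact: S1.
  apply: (SZ); rewrite addrC -scaleN1r; apply: (S1); last by apply: Sl; rewrite mem_head.
  rewrite /ipproj big_seq; apply: (big_ind S) => //.
    by move=> p q Sp Sq; rewrite -[p]scale1r; exact: S1.
  by move=> w wb; apply/SZ/Sb.
Qed.

End Ip.

Section IpInstances.
Context {R : realType}.

Lemma hdot_ip (H : hilbertType R) : is_ip (@hdot R H).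
Proof.
split; [exact: hdotP|exact: hdotC|move=> x].
by rewrite hdotxx exprn_ge0.
Qed.

Lemma ipsq_hdot (H : hilbertType R) (x : H) : ipsq hdot x = nrm x ^+ 2.
Proof. by rewrite /ipsq hdotxx nrmE -rmorphXn. Qed.

Lemma ipn_hdot (H : hilbertType R) (x : H) : ipn hdot x = nrm x.
Proof. by rewrite /ipn ipsq_hdot sqrtr_sqr ger0_norm ?nrm_ge0. Qed.

Definition fdot (I : finType) (x y : I -> R[i]^o) : R[i] :=
  \sum_i x i * (y i)^*.

Lemma fdot_ip (I : finType) : is_ip (@fdot I).
Proof.
split=> [a x y z|x y|x].
- rewrite /fdot mulr_sumr -big_split; apply: eq_bigr => i _.
  by rewrite -[(a *: x + y) i]/(a * x i + y i) mulrDl mulrA.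
- rewrite /fdot rmorph_sum; apply: eq_bigr => i _.
  by rewrite rmorphM /= conjCK mulrC.
- by apply: sumr_ge0 => i _; exact: mul_conjC_ge0.
Qed.

Lemma ipsq_fdot (I : finType) (x : I -> R[i]^o) :
  ipsq (@fdot I) x = \sum_i nrm (x i) ^+ 2.
Proof.
rewrite /ipsq /fdot Re_sum; apply: eq_bigr => i _.
by rewrite nrmC_sq.
Qed.

Lemma fdot_def (I : finType) (x : I -> R[i]^o) : ipsq (@fdot I) x = 0 -> x = 0.
Proof.
rewrite ipsq_fdot => /eqP; rewrite psumr_eq0; last by move=> i _; exact: sqr_ge0.
move=> /allP x0; apply/funext => i; have := x0 i (mem_index_enum _).
by rewrite sqrf_eq0 => /eqP /nrm0_eq0.
Qed.

Definition hsdot (H : hilbertType R) (I : finType) (x y : I -> H) : R[i] :=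
  \sum_i hdot (x i) (y i).

Lemma hsdot_ip (H : hilbertType R) (I : finType) : is_ip (@hsdot H I).
Proof.
split=> [a x y z|x y|x].
- rewrite /hsdot mulr_sumr -big_split; apply: eq_bigr => i _.
  by rewrite /= -[(a *: x + y) i]/(a *: x i + y i) hdotP.
- by rewrite /hsdot rmorph_sum; apply: eq_bigr => i _; rewrite hdotC.
- by apply: sumr_ge0 => i _; exact: (ip_ge0 (hdot_ip H)).
Qed.

Lemma ipsq_hsdot (H : hilbertType R) (I : finType) (x : I -> H) :
  ipsq (@hsdot H I) x = \sum_i nrm (x i) ^+ 2.
Proof.
by rewrite /ipsq /hsdot Re_sum; apply: eq_bigr => i _; rewrite -ipsq_hdot.
Qed.

End IpInstances.

(** * Matrices on finite index sets, projections, compression *)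

Section Parseval.
Context {R : realType} {V : lmodType R[i]} {f : V -> V -> R[i]}.
Hypothesis ipf : is_ip f.

Lemma parseval (b : seq V) x : onsys (f := f) b ->
  ipsq f (ipproj (f := f) b x) = \sum_(v <- b) nrm (f x v) ^+ 2.
Proof.
rewrite /ipproj; elim: b => [|v b IH] /=.
  by rewrite !big_nil /ipsq (ip0l ipf).
move=> [v1 vb ob]; rewrite !big_cons (ipsq_pyth ipf) ?ipsqZ// ?v1 ?mulr1 ?IH//.
rewrite (ipZl ipf) (ip_sumr ipf) big_seq big1 ?mulr0// => w wb.
by rewrite (ipZr ipf) (ipC ipf w v) (vb w wb) rmorph0 mulr0.
Qed.

Lemma ipsq_sub_ipproj (b : seq V) x : onsys (f := f) b ->
  ipsq f (x - ipproj (f := f) b x) <= ipsq f x.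
Proof.
move=> ob; have xE := subrK (ipproj (f := f) b x) x.
rewrite -[in leRHS]xE [leRHS](ipsq_pyth ipf); first by rewrite lerDl ipsq_ge0.
rewrite [X in f _ X]/ipproj (ip_sumr ipf) big_seq big1// => w wb.
by rewrite (ipZr ipf) (onsys_ipproj ipf)// mulr0.
Qed.

End Parseval.

Section MatrixOperators.
Context {R : realType} {I : finType}.
Implicit Types (M : I -> I -> R[i]) (x y : I -> R[i]^o).
Local Notation sq := (ipsq (@fdot R I)).
Local Notation dot := (@fdot R I).

Definition mop M x : I -> R[i]^o := fun i => \sum_j M i j * x j.
Definition cadj M : I -> I -> R[i] := fun i j => (M j i)^*.
Definition mgram M x : I -> R[i]^o := mop (cadj M) (mop M x).
Definition delta (i : I) : I -> R[i]^o := fun j => (j == i)%:R.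

Lemma dot_delta x i : dot x (delta i) = x i.
Proof.
rewrite /fdot (bigD1 i)//= /delta eqxx big1 ?addr0 => [|j ji].
  by rewrite rmorph1 mulr1.
by rewrite (negPf ji) rmorph0 mulr0.
Qed.

Lemma mopZ M (a : R[i]) x : mop M (a *: x) = a *: mop M x.
Proof.
apply/funext => i; rewrite /mop -[RHS]/(a * _) mulr_sumr; apply: eq_bigr => j _.
by rewrite -[(a *: x) j]/(a * x j) mulrCA.
Qed.

Lemma mop_adj M x y : dot (mop M x) y = dot x (mop (cadj M) y).
Proof.
rewrite /fdot /mop; under eq_bigr do rewrite mulr_suml.
rewrite exchange_big /=; apply: eq_bigr => j _.
rewrite rmorph_sum mulr_sumr; apply: eq_bigr => i _.
by rewrite rmorphM /= /cadj conjCK mulrCA mulrA.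
Qed.

Lemma cadjK M : cadj (cadj M) = M.
Proof. by apply/funext => i; apply/funext => j; rewrite /cadj conjCK. Qed.

(** |M^* x|^2 = <x, M M^* x>, and Cauchy-Schwarz. *)
Lemma cadj_bound M (c : R) : (forall x, sq (mop M x) <= c * sq x) ->
  forall x, sq (mop (cadj M) x) <= c * sq x.
Proof.
move=> Mc x; set y := mop (cadj M) x.
have ipf := @fdot_ip R I.
have y0 := ipsq_ge0 ipf y.
have [->|yn0] := eqVneq (sq y) 0.
  have := le_trans (ipsq_ge0 ipf _) (Mc (delta _)) => h.
  have [i _|I0] := pickP (@predT I).
    have d1 : sq (delta i) = 1.
      by rewrite /ipsq dot_delta /delta eqxx.
    apply: mulr_ge0; last exact: ipsq_ge0.
    by have := h i; rewrite d1 mulr1.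
  rewrite ipsq_fdot big1 ?mulr0// => i _.
  by have := I0 i.
have yp : 0 < sq y by rewrite lt_neqAle eq_sym yn0.
have : sq y ^+ 2 <= c * sq x * sq y.
  have -> : sq y ^+ 2 = nrm (dot x (mop M y)) ^+ 2.
    by rewrite -(cadjK M) -mop_adj -/y (ipxx ipf) nrmR ger0_norm.
  apply: le_trans (ip_cs_sq ipf _ _) _.
  by rewrite [c * _]mulrC -mulrA ler_wpM2l// ipsq_ge0.
by rewrite expr2 ler_pM2r.
Qed.

Lemma mgram_adj M x y : dot (mgram M x) y = dot x (mgram M y).
Proof. by rewrite /mgram mop_adj cadjK mop_adj. Qed.

Lemma iter_mgram_adj M k x y :
  dot (iter k (mgram M) x) y = dot x (iter k (mgram M) y).
Proof.
by elim: k x y => //= k IH x y; rewrite mgram_adj IH -iterS -iterSr.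
Qed.

Lemma iter_mgram_bound M (c : R) k x : 0 <= c ->
  (forall x, sq (mop M x) <= c * sq x) ->
  sq (iter k (mgram M) x) <= c ^+ (2 * k) * sq x.
Proof.
move=> c0 Mc; elim: k => [|k IH]; first by rewrite muln0 expr0 mul1r.
rewrite iterS /mgram mulnS exprD -mulrA.
apply: le_trans (cadj_bound Mc _) _.
rewrite expr2 -mulrA ler_wpM2l//.
apply: le_trans (Mc _) _; rewrite ler_wpM2l//.
Qed.

(** Cauchy-Schwarz turns a lower bound of <A v, v>, for A = M^* M, into lower
    bounds of the norms of all A^k v with k a power of 2. *)
Lemma iter_mgram_growth M (c : R) v i : 0 <= c -> sq v = 1 ->
  c <= sq (mop M v) -> c ^+ (2 * 2 ^ i) <= sq (iter (2 ^ i) (mgram M) v).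
Proof.
move=> c0 v1 cv; have ipf := @fdot_ip R I.
have step j : sq (iter j (mgram M) v) ^+ 2 <= sq (iter (j + j) (mgram M) v).
  have -> : sq (iter j (mgram M) v) ^+ 2 =
      nrm (dot (iter (j + j) (mgram M) v) v) ^+ 2.
    rewrite iterD iter_mgram_adj (ipxx ipf) nrmR ger0_norm//.
    exact: ipsq_ge0.
  by apply: le_trans (ip_cs_sq ipf _ _) _; rewrite v1 mulr1.
elim: i => [|i IH].
  rewrite expn0 muln1 /=.
  apply: (@le_trans _ _ (sq (mop M v) ^+ 2)).
    by rewrite lerXn2r ?nnegrE ?ipsq_ge0.
  have -> : sq (mop M v) ^+ 2 = nrm (dot (mgram M v) v) ^+ 2.
    rewrite /mgram mop_adj cadjK (ipxx ipf) nrmR ger0_norm//.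
    exact: ipsq_ge0.
  by apply: le_trans (ip_cs_sq ipf _ _) _; rewrite v1 mulr1.
have -> : (2 ^ i.+1 = 2 ^ i + 2 ^ i)%N by rewrite expnS mul2n addnn.
apply: le_trans (step _).
by rewrite addnn -muln2 mulnA exprM lerXn2r ?nnegrE ?ipsq_ge0// exprn_ge0.
Qed.

(** Bessel's inequality for the rows: the sum over an orthonormal system is at
    most the square of the Hilbert-Schmidt norm. *)
Lemma hs_bound M k b : onsys (f := dot) b ->
  \sum_(v <- b) sq (iter k (mgram M) v) <= \sum_i sq (iter k (mgram M) (delta i)).
Proof.
move=> ob; under eq_bigr do rewrite ipsq_fdot.
rewrite exchange_big /=; apply: ler_sum => i _.
apply: le_trans (bessel (@fdot_ip R I) _ ob).
rewrite le_eqVlt; apply/orP; left; apply/eqP; apply: eq_bigr => v _.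
by rewrite -[in LHS](dot_delta _ i) iter_mgram_adj (ipC (@fdot_ip R I)) nrm_conj.
Qed.

(** By self-adjointness, bounding a coordinate of all images is the same as bounding
    the image of a basis vector. *)
Lemma delta_bound M k i (c : R) : 0 <= c ->
  (forall x, nrm (iter k (mgram M) x i) ^+ 2 <= c * sq x) ->
  sq (iter k (mgram M) (delta i)) <= c.
Proof.
move=> c0 h; have ipf := @fdot_ip R I.
set y := iter _ _ _.
have [->//|y0] := eqVneq (sq y) 0.
have yp : 0 < sq y by rewrite lt_neqAle eq_sym y0 ipsq_ge0.
have := h y; rewrite -(dot_delta (iter _ _ _)) iter_mgram_adj -/y (ipxx ipf) nrmR.
by rewrite ger0_norm ?ipsq_ge0// expr2 ler_pM2r.
Qed.

End MatrixOperators.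

Section Projections.
Context {R : realType} {I : finType}.
Local Notation dot := (@fdot R I).

Definition is_proj (p : I -> I -> R[i]) : Prop :=
  (forall i j, p i j = (p j i)^* ) /\
  (forall i j, \sum_k p i k * p k j = p i j).

(** For a projection p, |p x|^2 = <p x, x>; this remains true when p acts on
    families of vectors of a Hilbert space. *)
Lemma proj_contraction (H : hilbertType R) p (x : I -> H) : is_proj p ->
  \sum_i nrm (\sum_j p i j *: x j) ^+ 2 <= \sum_j nrm (x j) ^+ 2.
Proof.
move=> [pC pp]; have ipf := @hsdot_ip R H I.
pose y i := \sum_j p i j *: x j.
rewrite -!ipsq_hsdot -/y.
have yy : hsdot y y = hsdot y x.
  rewrite /hsdot {2}/y; under eq_bigr do rewrite (ip_sumr (hdot_ip H)).
  rewrite exchange_big /=; apply: eq_bigr => j _.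
  under eq_bigr do rewrite (ipZr (hdot_ip H)) -pC -(ipZl (hdot_ip H)).
  rewrite -(ip_suml (hdot_ip H)); congr hdot.
  rewrite /y; under eq_bigr do rewrite scaler_sumr.
  rewrite exchange_big /=; apply: eq_bigr => k _.
  by under eq_bigr do rewrite scalerA; rewrite -scaler_suml pp.
have [->|y0] := eqVneq (ipsq (@hsdot R H I) y) 0; first exact: ipsq_ge0.
have yp : 0 < ipsq (@hsdot R H I) y by rewrite lt_neqAle eq_sym y0 ipsq_ge0.
rewrite -(ler_pM2l yp) -expr2.
have -> : ipsq (@hsdot R H I) y ^+ 2 = nrm (hsdot y x) ^+ 2.
  by rewrite -yy (ipxx ipf) nrmR ger0_norm// ltW.
exact: ip_cs_sq.
Qed.

Variables (B : seq (I -> R[i]^o)).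
Hypothesis oB : onsys (f := dot) B.

Definition projmx i j : R[i] := \sum_(w <- B) w i * (w j)^*.

Lemma projmxE (x : I -> R[i]^o) i :
  \sum_j projmx i j * x j = ipproj (f := dot) B x i.
Proof.
rewrite /ipproj /projmx; under eq_bigr do rewrite mulr_suml.
rewrite exchange_big /=.
have -> : (\sum_(v <- B) dot x v *: v) i = \sum_(v <- B) dot x v * v i.
  by elim/big_rec2 : _ => // v y z _ <-.
apply: eq_bigr => w _; rewrite /fdot mulr_suml; apply: eq_bigr => j _.
by rewrite mulrC -!mulrA [w i * _]mulrC.
Qed.

Lemma projmx_proj : is_proj projmx.
Proof.
split=> i j.
  rewrite /projmx rmorph_sum; apply: eq_bigr => w _.
  by rewrite rmorphM /= conjCK mulrC.
have ipi := @fdot_ip R I.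
rewrite (projmxE (fun k => projmx k j)).
have E : (fun k => projmx k j) = ipproj (f := dot) B (delta j).
  apply/funext => k; rewrite -projmxE (bigD1 j)//= /delta eqxx mulr1 big1 ?addr0//.
  by move=> l /negPf ->; rewrite mulr0.
transitivity (ipproj (f := dot) B (delta j) i); last by rewrite -E.
rewrite E; suff -> : ipproj (f := dot) B (ipproj (f := dot) B (delta j)) =
  ipproj (f := dot) B (delta j) by [].
rewrite {1}/ipproj [RHS]/ipproj big_seq [RHS]big_seq; apply: eq_bigr => w wB.
congr (_ *: _); apply/eqP; rewrite eq_sym -subr_eq0 -(ipBl ipi).
by rewrite (onsys_ipproj ipi).
Qed.

Lemma projmx_compl_proj : is_proj (fun i j => (i == j)%:R - projmx i j).
Proof.
have [qC qq] := projmx_proj; split=> i j.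
  by rewrite rmorphB /= -qC rmorph_nat eq_sym.
under eq_bigr do rewrite mulrBl !mulrBr opprB.
have d1 (F : I -> R[i]) : \sum_k (i == k)%:R * F k = F i.
  rewrite (bigD1 i)//= eqxx mul1r big1 ?addr0// => k ik.
  by rewrite eq_sym (negPf ik) mul0r.
have d2 (F : I -> R[i]) : \sum_k F k * (k == j)%:R = F j.
  rewrite (bigD1 j)//= eqxx mulr1 big1 ?addr0// => k ik.
  by rewrite (negPf ik) mulr0.
by rewrite big_split sumrB /= sumrB !d1 d2 qq; ring.
Qed.

End Projections.

Section Compression.
Context {R : realType} {I J : finType}.
Local Notation sq := (ipsq (@fdot R (I * J)%type)).
Local Notation dot := (@fdot R (I * J)%type).
Local Notation doti := (@fdot R I).
Local Notation sqi := (ipsq (@fdot R I)).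
Variables (M : I * J -> I * J -> R[i]) (c : R) (m : nat).

Definition slice (x : I * J -> R[i]^o) (j : J) : I -> R[i]^o := fun i => x (i, j).
Definition tens1 (p : I -> I -> R[i]) (x : I * J -> R[i]^o) : I * J -> R[i]^o :=
  fun ij => \sum_k p ij.1 k * x (k, ij.2).

Lemma dot_slice x y : dot x y = \sum_j doti (slice x j) (slice y j).
Proof. by rewrite /fdot exchange_big /= pair_big /=; apply: eq_bigr => -[]. Qed.

Lemma sq_slice x : sq x = \sum_j sqi (slice x j).
Proof. by rewrite /ipsq dot_slice Re_sum. Qed.

(** Take a maximal orthonormal system of vectors on which M is large, and let W be the
    orthogonal of all their slices. A vector of W (x) C^J is orthogonal to the
    system, so M is not large on it, by maximality; and the codimension of W is at most
    the number of slices. *)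
Lemma compression : 0 <= c ->
  (forall b, onsys (f := dot) b -> (forall v, v \in b -> c < sq (mop M v)) ->
    (size b <= m)%N) ->
  exists p : I -> I -> R[i],
    [/\ is_proj p,
        \sum_i \sum_j nrm ((i == j)%:R - p i j) ^+ 2 <= (m * #|J|)%:R &
        forall x, sq (mop M (tens1 p x)) <= c * sq x].
Proof.
move=> c0 bm; have ipf := @fdot_ip R (I * J)%type; have ipi := @fdot_ip R I.
pose Q k := `[< exists b, [/\ onsys (f := dot) b,
  forall v, v \in b -> c < sq (mop M v) & size b = k] >].
have Q0 : exists k, Q k by exists 0%N; apply/asboolP; exists [::].
have Qm k : Q k -> (k <= m)%N by move=> /asboolP[b [ob hb <-]]; exact: bm.
case: (ex_maxnP Q0 Qm) => k /asboolP[b [ob hb bk]] kmax.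
pose L := [seq slice v j | v <- b, j <- enum J].
have [B [oB sB LB _]] := gram_schmidt ipi (@fdot_def R I) L.
pose q := projmx B.
pose p i j : R[i] := (i == j)%:R - q i j.
have qE := projmxE B.
have pE (x : I * J -> R[i]^o) j : slice (tens1 p x) j = slice x j - ipproj (f := doti) B (slice x j).
  apply/funext => i; rewrite /slice /tens1 /= /p.
  under eq_bigr do rewrite mulrBl.
  rewrite sumrB (qE (slice x j)); congr (_ - _).
  rewrite (bigD1 i)//= eqxx mul1r big1 ?addr0// => i' ii'.
  by rewrite eq_sym (negPf ii') mul0r.
exists p; split; first exact: projmx_compl_proj.
  have -> : \sum_i \sum_j nrm ((i == j)%:R - p i j) ^+ 2 = (size B)%:R.
    have -> : \sum_i \sum_j nrm ((i == j)%:R - p i j) ^+ 2 =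
        \sum_j sqi (ipproj (f := doti) B (delta j)).
      rewrite exchange_big /=; apply: eq_bigr => j _; rewrite ipsq_fdot.
      apply: eq_bigr => i _; congr (nrm _ ^+ 2).
      rewrite -qE /p opprB addrC subrK (bigD1 j)//= /delta eqxx mulr1 big1 ?addr0//.
      by move=> k' /negPf ->; rewrite mulr0.
    under eq_bigr do rewrite (parseval ipi _ oB).
    rewrite exchange_big /= big_seq.
    rewrite (eq_bigr (fun=> 1)) => [|w wB].
      by rewrite -big_seq big_const_seq count_predT iter_addr_0.
    have -> : 1 = sqi w.
      elim: B oB wB {sB LB q p qE pE} => //= w' B IH [w1 _ oB].
      by rewrite inE => /predU1P[->//|]; exact: IH.
    rewrite ipsq_fdot; apply: eq_bigr => i _.
    by rewrite (ipC ipi) dot_delta nrm_conj.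
  rewrite ler_nat (leq_trans sB)// size_allpairs bk -cardE leq_mul2r.
  by rewrite Qm ?orbT//; apply/asboolP; exists b.
move=> x; set y := tens1 p x.
have yx : sq y <= sq x.
  rewrite !sq_slice; apply: ler_sum => j _; rewrite pE.
  exact: (ipsq_sub_ipproj ipi).
apply: (@le_trans _ _ (c * sq y)); last by rewrite ler_wpM2l.
rewrite leNgt; apply/negP => yc.
have y0 : 0 < sq y.
  rewrite lt_neqAle (ipsq_ge0 ipf) andbT eq_sym; apply/negP => /eqP y0.
  move: yc; rewrite y0 mulr0 (fdot_def y0) /mop ipsq_fdot big1 ?ltxx// => i _.
  by rewrite big1 ?nrm0 ?expr0n// => j _; rewrite mulr0.
have yb w : w \in b -> dot w y = 0.
  move=> wb; rewrite dot_slice big1// => j _; rewrite pE.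
  rewrite (LB (slice w j)); last first.
    by apply/allpairsP; exists (w, j); rewrite mem_enum.
  rewrite {1}/ipproj (ip_suml ipi) big_seq big1// => v vB.
  by rewrite (ipZl ipi) (ipC ipi (_ - _)) (onsys_ipproj ipi)// rmorph0 mulr0.
pose a := (((ipn dot y)^-1)%:C)%C.
have a2 : nrm a ^+ 2 = (sq y)^-1.
  by rewrite nrmR ger0_norm ?invr_ge0 ?ipn_ge0// exprVn (ipn_sq ipf).
have : Q k.+1.
  apply/asboolP; exists ((a *: y) :: b); split=> [||/=]; last by rewrite bk.
    split=> //; first by rewrite (ipsqZ ipf) a2 mulVf// gt_eqF.
    by move=> w wb; rewrite (ipZr ipf) (yb w wb) mulr0.
  move=> v; rewrite inE => /predU1P[->|]; last exact: hb.
  by rewrite mopZ (ipsqZ ipf) a2 mulrC ltr_pdivlMr.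
by move/kmax; rewrite ltnn.
Qed.

End Compression.

(** * Convolution operators on the free group and on finite quotients *)

Section FreeSections.
Implicit Types (g h t : freeGroup) (T U : seq freeGroup).

Lemma sum_uniq_sub (V : nmodType) (K : eqType) (S U : seq K) (F : K -> V) :
  uniq S -> uniq U -> {subset S <= U} -> (forall x, x \notin S -> F x = 0) ->
  \sum_(x <- U) F x = \sum_(x <- S) F x.
Proof.
move=> uS uU SU F0; rewrite (bigID (mem S)) /= [X in _ + X]big1 ?addr0 => [|x]; last exact: F0.
rewrite -big_filter; apply: perm_big; apply: uniq_perm => //; first exact: filter_uniq.
move=> x; rewrite mem_filter /=; case: (boolP (x \in S)) => //= xS.
by rewrite SU.
Qed.

Lemma sum_inj_le (R : numDomainType) (I K : finType) (f : I -> K) (F : K -> R) :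
  injective f -> (forall k, 0 <= F k) -> \sum_i F (f i) <= \sum_k F k.
Proof.
move=> finj F0; rewrite [leRHS](bigID (mem (f @: [set: I]))) /=.
rewrite big_imset /=; last by move=> i j _ _; exact: finj.
rewrite [X in _ <= X + _](eq_bigl predT) ; last by move=> i; exact: in_setT.
by rewrite lerDl sumr_ge0.
Qed.

Lemma sum_pair (V : nmodType) (I K : finType) (F : I * K -> V) :
  \sum_p F p = \sum_i \sum_k F (i, k).
Proof. by rewrite pair_bigA; apply: eq_bigr => -[]. Qed.

Lemma sum_section (V : nmodType) T U g m (s : 'I_m -> freeGroup) (F : freeGroup -> V) :
  uniq T -> uniq U -> m = size U -> (forall i, s i = nth 1%g U i) ->
  (forall t, t \notin T -> F t = 0) -> (forall t, t \in T -> (t * g)%g \in U) ->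
  \sum_i F (s i * g^-1)%g = \sum_(t <- T) F t.
Proof.
move=> uT uU mU sE F0 TU.
have -> : \sum_i F (s i * g^-1)%g = \sum_(h <- U) F (h * g^-1)%g.
  rewrite (big_nth 1%g) -mU big_mkord; apply: eq_bigr => i _; by rewrite sE.
rewrite (@sum_uniq_sub _ _ [seq (t * g)%g | t <- T] U (fun h => F (h * g^-1)%g))//.
- by rewrite big_map; apply: eq_bigr => t _; rewrite mulgK.
- by rewrite map_inj_uniq//; exact: mulIg.
- by move=> h /mapP[t tT ->]; exact: TU.
- move=> h hT; apply: F0; apply: contra hT => hT.
  by apply/mapP; exists (h * g^-1)%g => //; rewrite mulgVK.
Qed.

(** What one application of Z^* Z can reach, when Z has its support in T. *)
Definition nbhd T U : seq freeGroup :=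
  undup (U ++ [seq (t * g)%g | t <- T, g <- U]
           ++ [seq (t^-1 * h)%g | t <- T, h <- [seq (t' * g)%g | t' <- T, g <- U]]).

Lemma nbhd_sub T U g : g \in U -> g \in nbhd T U.
Proof. by move=> gU; rewrite mem_undup mem_cat gU. Qed.

Lemma nbhd1 T U t g : t \in T -> g \in U -> (t * g)%g \in nbhd T U.
Proof.
move=> tT gU; rewrite mem_undup !mem_cat; apply/orP; right; apply/orP; left.
by apply/allpairsP; exists (t, g).
Qed.

Lemma nbhd2 T U t t' g : t \in T -> t' \in T -> g \in U ->
  (t'^-1 * (t * g))%g \in nbhd T U.
Proof.
move=> tT t'T gU; rewrite mem_undup !mem_cat; apply/orP; right; apply/orP; right.
apply/allpairsP; exists (t', t * g)%g; split=> //=.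
by apply/allpairsP; exists (t, g).
Qed.

Definition nball T k : seq freeGroup := iter k (nbhd T) [:: 1%g].

Lemma nball_uniq T k : uniq (nball T k).
Proof. by case: k => //= k; exact: undup_uniq. Qed.

Lemma nball_sub T k i g : (i <= k)%N -> g \in nball T i -> g \in nball T k.
Proof.
move=> /subnK <-; elim: (k - i)%N => // j IH gi.
by apply: nbhd_sub; exact: IH.
Qed.

Lemma one_nball T k : 1%g \in nball T k.
Proof. by apply: (@nball_sub _ _ 0) => //=; rewrite mem_head. Qed.

End FreeSections.

Definition is_action (n : nat) (a : freeGroup -> 'I_n -> 'I_n) : Prop :=
  (forall i, a 1%g i = i) /\ (forall g h i, a (g * h)%g i = a g (a h i)).

Section Action.
Variables (n : nat) (a : freeGroup -> 'I_n -> 'I_n).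
Hypothesis aP : is_action a.

Lemma actVK g i : a g^-1%g (a g i) = i.
Proof. by rewrite -aP.2 mulVg aP.1. Qed.
Lemma actKV g i : a g (a g^-1%g i) = i.
Proof. by rewrite -aP.2 mulgV aP.1. Qed.

Lemma act_eqV g i j : (a g j == i) = (j == a g^-1%g i).
Proof. by apply/eqP/eqP => [<-|->]; rewrite ?actVK ?actKV. Qed.
End Action.

Section FiniteModel.
Context {R : realType} {J : finType}.
Variables (T : seq freeGroup) (z : freeGroup -> J -> J -> R[i]).
Hypothesis uT : uniq T.
Hypothesis z0 : forall t b c, t \notin T -> z t b c = 0.

(** The convolution operator with coefficients z on a finite set of group elements,
    and (below) its analogue for an action on a finite set. *)
Definition secmx m (s : 'I_m -> freeGroup) (p q : 'I_m * J) : R[i] :=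
  z (s p.1 * (s q.1)^-1)%g p.2 q.2.

Definition actmx n (a : freeGroup -> 'I_n -> 'I_n) (p q : 'I_n * J) : R[i] :=
  \sum_(t <- T) (a t q.1 == p.1)%:R * z t p.2 q.2.

Section Act.
Variables (n : nat) (a : freeGroup -> 'I_n -> 'I_n).
Hypothesis aP : is_action a.

Lemma mop_actmx x i b : mop (actmx a) x (i, b) =
  \sum_(t <- T) \sum_c z t b c * x (a t^-1%g i, c).
Proof.
rewrite /mop /actmx; under eq_bigr do rewrite mulr_suml.
rewrite exchange_big /=; apply: eq_bigr => t _.
rewrite sum_pair /=.
rewrite exchange_big /=; apply: eq_bigr => c _.
rewrite (bigD1 (a t^-1%g i))//= actKV// eqxx mul1r big1 ?addr0// => j.
by rewrite -act_eqV// => /negPf ->; rewrite !mul0r.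
Qed.

Lemma mop_actmx_adj x j c : mop (cadj (actmx a)) x (j, c) =
  \sum_(t <- T) \sum_b (z t b c)^* * x (a t j, b).
Proof.
rewrite /mop /cadj /actmx.
under eq_bigr do rewrite rmorph_sum mulr_suml.
rewrite exchange_big /=; apply: eq_bigr => t _.
rewrite sum_pair /=.
rewrite exchange_big /=; apply: eq_bigr => b _.
rewrite (bigD1 (a t j))//= eqxx mul1r big1 ?addr0// => i.
by rewrite eq_sym => /negPf ->; rewrite mul0r rmorph0 mul0r.
Qed.

Lemma mop_secmx m (s : 'I_m -> freeGroup) x i b : mop (secmx s) x (i, b) =
  \sum_j \sum_c z (s i * (s j)^-1)%g b c * x (j, c).
Proof. by rewrite /mop /secmx sum_pair. Qed.

Lemma mop_secmx_adj m (s : 'I_m -> freeGroup) x j c :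
  mop (cadj (secmx s)) x (j, c) =
  \sum_i \sum_b (z (s i * (s j)^-1)%g b c)^* * x (i, b).
Proof. by rewrite /mop /cadj /secmx sum_pair. Qed.

Variables (k : nat) (m : nat) (s : 'I_m -> freeGroup).
Hypothesis mU : m = size (nball T k).
Hypothesis sE : forall i, s i = nth 1%g (nball T k) i.

(** Around each point, the action looks like the translation of the group. *)
Lemma local_mgram x w l i c : (l <= k)%N -> s i \in nball T (k - l)%N ->
  iter l (mgram (secmx s)) (fun p => x (a (s p.1) w, p.2)) (i, c) =
  iter l (mgram (actmx a)) x (a (s i) w, c).
Proof.
elim: l i c => //= l IH i c lk si.
rewrite /mgram mop_secmx_adj mop_actmx_adj.
have kl : (k - l = (k - l.+1).+1)%N by rewrite subnSK.
rewrite -(@sum_section _ T (nball T k) (s i) m s (fun t =>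
  \sum_b (z t b c)^* * mop (actmx a) (iter l (mgram (actmx a)) x)
    (a t (a (s i) w), b))) //; first last.
- move=> t tT; apply: (@nball_sub _ _ (k - l)%N); first by rewrite leq_subr.
  by rewrite kl /=; exact: nbhd1.
- by move=> t tT; rewrite big1// => b _; rewrite z0// rmorph0 mul0r.
- exact: nball_uniq.
apply: eq_bigr => i' _; apply: eq_bigr => b _.
have [tT|tT] := boolP ((s i' * (s i)^-1)%g \in T); last by rewrite z0// rmorph0 !mul0r.
congr (_ * _).
rewrite -aP.2 mulgVK mop_secmx mop_actmx.
pose G t := \sum_c z t b c * iter l (mgram (actmx a)) x (a t^-1%g (a (s i') w), c).
transitivity (\sum_(t <- [seq t^-1 | t <- T]%g) G t^-1%g); last first.
  by rewrite big_map; apply: eq_bigr => t _; rewrite invgK.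
rewrite -(@sum_section _ [seq t^-1 | t <- T]%g (nball T k) (s i') m s (fun t => G t^-1%g)) //;
  first last.
- move=> _ /mapP[t tT' ->].
  apply: (@nball_sub _ _ (k - l)%N); first by rewrite leq_subr.
  have -> : s i' = (s i' * (s i)^-1 * s i)%g by rewrite mulgVK.
  by rewrite kl /=; exact: nbhd2.
- move=> t tT'; rewrite /G big1// => d _; rewrite z0 ?mul0r//.
  by apply: contra tT' => tT'; apply/mapP; exists t^-1%g; rewrite ?invgK.
- exact: nball_uniq.
- by rewrite map_inj_uniq//; exact: invg_inj.
apply: eq_bigr => j _; rewrite /G; apply: eq_bigr => d _.
rewrite invgM !invgK.
have [tT'|tT'] := boolP ((s i' * (s j)^-1)%g \in T); last by rewrite z0// !mul0r.
congr (_ * _); rewrite IH ?(ltnW lk)//.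
  by rewrite -aP.2 invgM invgK mulgVK.
have -> : s j = ((s i' * (s j)^-1)^-1 * (s i' * (s i)^-1 * s i))%g.
  by rewrite mulgVK invgM invgK mulgVK.
by rewrite kl /=; exact: nbhd2.
Qed.

Hypothesis afree : forall w, {in nball T k &, injective (a^~ w)}.

(** By [local_mgram] the values of the iterates at a point are those of a finite
    section of the group, for which the bound c is known. Freeness makes the pull-back of
    a vector to the section no larger than the vector. *)
Lemma actmx_delta_bound (c : R) p : 0 <= c ->
  (forall x, ipsq (@fdot R _) (mop (secmx s) x) <= c * ipsq (@fdot R _) x) ->
  ipsq (@fdot R _) (iter k (mgram (actmx a)) (delta p)) <= c ^+ (2 * k).
Proof.
move=> c0 hc; apply: delta_bound => [|x]; first exact: exprn_ge0.
case: p => w b.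
have sU i : s i \in nball T k by rewrite sE mem_nth// -mU.
have [i0 si0] : exists i0, s i0 = 1%g.
  have := one_nball T k; rewrite -index_mem -mU => h.
  by exists (Ordinal h); rewrite sE /= nth_index// one_nball.
have sinj : injective s.
  move=> i j; rewrite !sE => /eqP; rewrite nth_uniq ?nball_uniq -?mU//.
  by move=> /eqP /val_inj.
have := @local_mgram x w k i0 b (leqnn k).
rewrite subnn si0 /= inE eqxx aP.1 => /(_ isT) <-.
set y := (fun p => x (a (s p.1) w, p.2)).
apply: (@le_trans _ _ (ipsq (@fdot R _) (iter k (mgram (secmx s)) y))).
  rewrite ipsq_fdot (bigD1 (i0, b))//= lerDl sumr_ge0// => ? _.
  exact: sqr_ge0.
apply: le_trans (iter_mgram_bound _ _ c0 hc) _.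
rewrite ler_wpM2l ?exprn_ge0// !ipsq_fdot.
apply: (@sum_inj_le _ _ _ (fun p : 'I_m * J => (a (s p.1) w, p.2)) (fun q => nrm (x q) ^+ 2)).
  move=> [i d] [j e] [/afree]; rewrite !sU => /(_ isT isT) /sinj -> ->//.
by move=> q; exact: sqr_ge0.
Qed.

End Act.

Lemma exp_lt_small (r eta : R) : 0 <= r -> r < 1 -> 0 < eta ->
  exists i : nat, r ^+ (2 ^ i) <= eta.
Proof.
move=> r0 r1 eta0.
have : (fun n => r ^+ n) @ \oo --> 0 by apply: cvg_expr; rewrite ger0_norm.
move=> /cvgrPdist_le /(_ _ eta0)[n _ hn]; exists n.
have := hn (2 ^ n)%N (ltnW (ltn_expl n (ltnSn 1))).
by rewrite sub0r normrN ger0_norm// exprn_ge0.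
Qed.

(** If r orthonormal vectors have images larger than c1, then the growth of
    the powers of the Gram operator gives r c1^(2k) <= n |J| c^(2k), since the right
    side bounds the squared Hilbert-Schmidt norm. For k large, r is a small fraction of n,
    and [compression] applies. *)
Lemma cutoff_projection (c c1 eta : R) : 0 <= c -> c < c1 -> 0 < eta ->
  (forall m (s : 'I_m -> freeGroup), injective s -> forall x,
    ipsq (@fdot R _) (mop (secmx s) x) <= c * ipsq (@fdot R _) x) ->
  exists U : seq freeGroup, forall n (a : freeGroup -> 'I_n -> 'I_n),
    is_action a -> (forall w, {in U &, injective (a^~ w)}) ->
    exists p : 'I_n -> 'I_n -> R[i],
      [/\ is_proj p,
          \sum_i \sum_j nrm ((i == j)%:R - p i j) ^+ 2 <= eta * n%:R &
          forall x, ipsq (@fdot R _) (mop (actmx a) (tens1 p x))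
            <= c1 * ipsq (@fdot R _) x].
Proof.
move=> c0 cc1 eta0 hs.
have c10 : 0 < c1 by exact: le_lt_trans cc1.
(* one factor |J| counts the basis vectors of C^J, the other one the slices *)
pose N : R := #|J|%:R ^+ 2 + 1.
have N0 : 0 < N by rewrite ltr_wpDl// sqr_ge0.
have r1 : c / c1 < 1 by rewrite ltr_pdivrMr// mul1r.
have [i hi] := exp_lt_small (divr_ge0 c0 (ltW c10)) r1 (divr_gt0 eta0 N0).
pose k := (2 ^ i)%N; exists (nball T k) => n a aP afree.
pose s (j : 'I_(size (nball T k))) := nth 1%g (nball T k) j.
have sinj : injective s.
  by move=> j l /eqP; rewrite nth_uniq ?nball_uniq// => /eqP /val_inj.
pose D : R := (n * #|J|)%:R * (eta / N).
have D0 : 0 <= D by rewrite mulr_ge0// divr_ge0 ?ltW.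
have [b ob hb|p [p0 p1 p2]] := @compression R _ _ (actmx a) c1 (Num.truncn D) (ltW c10).
  have c1k : 0 < c1 ^+ (2 * k) by exact: exprn_gt0.
  rewrite truncn_ge_nat// -(ler_pM2r c1k).
  apply: (@le_trans _ _ (\sum_(v <- b) ipsq (@fdot R _) (iter k (mgram (actmx a)) v))).
    rewrite -sum1_size natr_sum mulr_suml big_seq [leRHS]big_seq.
    apply: ler_sum => v vb; rewrite mul1r; apply: iter_mgram_growth.
    - exact: ltW.
    - elim: b ob vb {hb} => //= w b IH [w1 _ ob].
      by rewrite inE => /predU1P[->//|]; exact: IH.
    - by rewrite ltW// hb.
  apply: le_trans (hs_bound _ _ ob) _.
  apply: (@le_trans _ _ (\sum_(q : 'I_n * J) c ^+ (2 * k))).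
    apply: ler_sum => q _; apply: (@actmx_delta_bound _ _ aP k _ s) => //.
    exact: hs.
  rewrite sumr_const card_prod card_ord -[leLHS]mulr_natl /D -mulrA.
  rewrite ler_wpM2l// [(2 * k)%N]mulnC !exprM.
  rewrite [leRHS](_ : _ = eta / N * (c1 ^+ k) ^+ 2)//.
  have h : c ^+ k <= eta / N * c1 ^+ k.
    by rewrite -ler_pdivrMr ?exprn_gt0// -expr_div_n.
  have h1 : c ^+ k <= c1 ^+ k by apply: lerXn2r; rewrite ?nnegrE// ltW.
  rewrite (expr2 (c ^+ k)) (expr2 (c1 ^+ k)) mulrA.
  by apply: ler_pM => //; rewrite exprn_ge0.
exists p; split=> //; apply: le_trans p1 _.
rewrite natrM; apply: (@le_trans _ _ (D * #|J|%:R)).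
  by rewrite ler_wpM2r// truncn_le.
have -> : D * #|J|%:R = eta * n%:R * (#|J|%:R ^+ 2 / N).
  by rewrite /D natrM; field; exact: lt0r_neq0.
by apply: ler_piMr; [rewrite mulr_ge0// ltW|rewrite ler_pdivrMr// mul1r lerDl].
Qed.
End FiniteModel.

(** * Residual finiteness of the free group *)

Section ResidualFiniteness.

(** The complements of the domain and of the image have the same size; match them
    along their enumerations. *)
Lemma perm_of_partial_inj (T : finType) (A : {set T}) (f : T -> T) :
  {in A &, injective f} -> exists s : {perm T}, {in A, s =1 f}.
Proof.
move=> finj; pose B := f @: A.
have cAB : size (enum (~: A)) = size (enum (~: B)).
  by rewrite -!cardE (cardsCs (~: A)) (cardsCs (~: B)) !finset.setCK card_in_imset.
pose g x := if x \in A then f x else nth x (enum (~: B)) (index x (enum (~: A))).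
have gA x : x \notin A -> g x \notin B.
  move=> xA; rewrite /g (negPf xA) -finset.in_setC -mem_enum mem_nth// -cAB index_mem.
  by rewrite mem_enum finset.in_setC.
have gB x : x \in A -> g x \in B by move=> xA; rewrite /g xA imset_f.
have ginj : injective g.
  move=> x y gxy; have [xA|xA] := boolP (x \in A); have [yA|yA] := boolP (y \in A).
  - by move: gxy; rewrite /g xA yA; exact: finj.
  - by have := gA _ yA; rewrite -gxy gB.
  - by have := gA _ xA; rewrite gxy gB.
  have xi : (index x (enum (~: A)) < size (enum (~: B)))%N.
    by rewrite -cAB index_mem mem_enum finset.in_setC.
  have yi : (index y (enum (~: A)) < size (enum (~: B)))%N.
    by rewrite -cAB index_mem mem_enum finset.in_setC.
  move: gxy; rewrite /g (negPf xA) (negPf yA) (set_nth_default x y yi).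
  move=> /eqP; rewrite nth_uniq ?enum_uniq// => /eqP ixy.
  have := nth_index x (s := enum (~: A)) (x := x).
  rewrite mem_enum finset.in_setC => /(_ xA) <-; rewrite ixy nth_index//.
  by rewrite mem_enum finset.in_setC.
by exists (perm ginj) => x xA; rewrite permE /g xA.
Qed.

Section LetterAction.
Variables (T : Type) (b : letter -> T -> T).
Hypothesis bK : forall l x, b l (b (linv l) x) = x.

Definition word_act (w : seq letter) (x : T) : T := foldr b x w.

Lemma word_act_push l w x : word_act (push l w) x = b l (word_act w x).
Proof.
case: w => //= l' w; case: ifPn => [/eqP ->|//].
by rewrite /= bK.
Qed.

Lemma word_act_wmul v w x : word_act (wmul v w) x = word_act v (word_act w x).
Proof. by elim: v => //= l v <-; rewrite word_act_push. Qed.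

End LetterAction.

Lemma push_inj l v w : reduced v -> reduced w -> push l v = push l w -> v = w.
Proof.
move=> rv rw vw; rewrite -[v](pushK (linv l))// -[w](pushK (linv l))//.
by rewrite linvK vw.
Qed.

(** Residual finiteness. Left translation by a generator is a partial injection of the
    finite set of all suffixes of words of U; complete it to a permutation. In this
    action the elements of U, as words, are the images of the empty word, so distinct
    elements act by distinct permutations; hence translation by these permutations is free
    on the group of all permutations. *)
Lemma free_finite_action (U : seq freeGroup) :
  exists n (a : freeGroup -> 'I_n -> 'I_n),
    [/\ (0 < n)%N, is_action a & forall w, {in U &, injective (a^~ w)}].
Proof.
pose P : seq (seq letter) :=
  [::] :: [seq drop i (fg_word g) | g <- U, i <- iota 0 (size (fg_word g)).+1].
have redP w : w \in P -> reduced w.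
  rewrite inE => /predU1P[->//|/allpairsPdep[g [i [gU _ ->]]]].
  exact: drop_sorted (fgP g).
pose X := seq_sub P.
pose A k : {set X} := [set x : X | push (k, true) (val x) \in P]%SET.
pose f k (x : X) : X := insubd x (push (k, true) (val x)).
have fE k x : x \in A k -> val (f k x) = push (k, true) (val x).
  by rewrite inE => h; rewrite val_insubd h.
have finj k : {in A k &, injective (f k)}.
  move=> x y xA yA /(congr1 val); rewrite !fE// => /push_inj h.
  by apply/val_inj/h; apply: redP; exact: valP.
have /choice[s sP] : forall k, exists s : {perm X}, {in A k, s =1 f k}.
  by move=> k; exact: perm_of_partial_inj (finj k).
pose b (l : letter) (p : {perm X}) : {perm X} :=
  (p * (if l.2 then s l.1 else (s l.1)^-1))%g.
have bK l p : b l (b (linv l) p) = p.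
  by rewrite /b /linv /=; case: l.2 => /=; rewrite ?mulgVK ?mulgK.
(* the empty word, where the elements of U are told apart *)
pose o : X := SeqSub (mem_head [::] _ : [::] \in P).
have bpush l (p : {perm X}) x w : w \in P -> push l w \in P -> val (p x) = w ->
    val (b l p x) = push l w.
  case: l => k [] wP lwP px; rewrite /b /= permM.
    by rewrite sP ?fE ?px// inE px.
  pose y : X := SeqSub lwP.
  have yA : y \in A k.
    by rewrite inE /= (_ : (k, true) = linv (k, false))// -{1}(linvK (k, false)) pushK// redP.
  suff -> : (s k)^-1%g (p x) = y by [].
  rewrite -[y](permK (s k)); congr (_ _); apply: val_inj; rewrite sP// fE//= px.
  by rewrite (_ : (k, true) = linv (k, false))// -{1}(linvK (k, false)) pushK// redP.
have reach (g : freeGroup) : g \in U -> forall (p : {perm X}) x, p x = o ->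
    val (word_act b g p x) = fg_word g.
  move=> gU p x px.
  have suf i : drop i (fg_word g) \in P.
    rewrite inE; apply/orP; right.
    have [ig|ig] := leqP i (size (fg_word g)).
      by apply/allpairsPdep; exists g, i; rewrite mem_iota.
    rewrite drop_oversize ?(ltnW ig)//; apply/allpairsPdep.
    exists g, (size (fg_word g)); rewrite drop_size; split=> //.
    by rewrite mem_iota /= add0n.
  elim: (fg_word g) (fgP g) suf => [|l w IH] rw suf; first by rewrite /= px.
  rewrite -[word_act _ _ _]/(b l (word_act b w p)).
  have lw : push l w = l :: w.
    by case: w rw {IH suf} => //= l' w; rewrite /reduced /= => /andP[/negPf ->].
  rewrite (@bpush l _ x w) ?lw//.
  - by have := suf 1%N; rewrite /= drop0.
  - by have := suf 0%N.
  by apply: IH => [|i]; [exact: reduced_behead rw|exact: (suf i.+1)].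
pose a (g : freeGroup) (i : 'I_#|{perm X}|) := enum_rank (word_act b g (enum_val i)).
exists #|{perm X}|, a; split.
- by apply/card_gt0P; exists 1%g.
- split=> [i|g h i]; first by rewrite /a /= enum_valK.
  by rewrite /a enum_rankK word_act_wmul.
- move=> i g h gU hU /enum_rank_inj gh; apply: val_inj.
  pose x := (enum_val i)^-1%g o.
  have ix : enum_val i x = o by rewrite permKV.
  by rewrite -[LHS](reach g gU _ _ ix) gh (reach h hU _ _ ix).
Qed.

End ResidualFiniteness.

(** * Compact operators on ell2 and their truncations *)

Section HilbertFacts.
Context {R : realType} {H : hilbertType R}.
Implicit Types (x y z : H) (a : R[i]).

Lemma hdotDl x y z : hdot (x + y) z = hdot x z + hdot y z.
Proof. exact: (ipDl (hdot_ip H)). Qed.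
Lemma hdotZl a x z : hdot (a *: x) z = a * hdot x z.
Proof. exact: (ipZl (hdot_ip H)). Qed.
Lemma hdotZr a x z : hdot z (a *: x) = a^* * hdot z x.
Proof. exact: (ipZr (hdot_ip H)). Qed.
Lemma hdotBl x y z : hdot (x - y) z = hdot x z - hdot y z.
Proof. exact: (ipBl (hdot_ip H)). Qed.
Lemma hdotBr x y z : hdot z (x - y) = hdot z x - hdot z y.
Proof. exact: (ipBr (hdot_ip H)). Qed.
Lemma hdot_suml (I : Type) (s : seq I) (P : pred I) (g : I -> H) z :
  hdot (\sum_(i <- s | P i) g i) z = \sum_(i <- s | P i) hdot (g i) z.
Proof. exact: (ip_suml (hdot_ip H)). Qed.
Lemma hdot_sumr (I : Type) (s : seq I) (P : pred I) (g : I -> H) z :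
  hdot z (\sum_(i <- s | P i) g i) = \sum_(i <- s | P i) hdot z (g i).
Proof. exact: (ip_sumr (hdot_ip H)). Qed.

Lemma hdot_cs x y : nrm (hdot x y) <= nrm x * nrm y.
Proof. by have := ip_cs (hdot_ip H) x y; rewrite !ipn_hdot. Qed.

Lemma nrm_sq_hdot x : (nrm x ^+ 2)%:C%C = hdot x x.
Proof. by rewrite -ipsq_hdot -(ipxx (hdot_ip H)). Qed.

Lemma nrm_sq_Re x : nrm x ^+ 2 = complex.Re (hdot x x).
Proof. by rewrite -ipsq_hdot. Qed.

End HilbertFacts.

Section Ell2Basis.
Context {R : realType} {I : choiceType}.
Implicit Types (f g : ell2 R I) (i j : I).

Lemma psum_single i (c : R) : 0 <= c ->
  psum (fun j => if j == i then c else 0) = c%:E.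
Proof.
move=> c0; rewrite /psum -(@esum_set1 R I i (fun=> c%:E)) ?lee_fin//.
rewrite [RHS]esum_mkcond; apply: eq_esum => j _ /=.
case: (eqVneq j i) => [->|ji]; first by rewrite mem_set.
by rewrite memNset// => /eqP; rewrite (negPf ji).
Qed.

Lemma asum_single i (c : R) : asum (fun j => if j == i then c else 0) = c.
Proof.
rewrite /asum /psumr.
have E (d : R) : (fun j => Num.max (if j == i then d else 0) 0) =
    (fun j => if j == i then Num.max d 0 else 0).
  by apply/funext => j; case: ifP => // _; rewrite maxxx.
have -> : (fun j => Num.max (- (if j == i then c else 0)) 0) =
    (fun j => if j == i then Num.max (- c) 0 else 0).
  by apply/funext => j; case: ifP => // _; rewrite oppr0 maxxx.
rewrite E !psum_single ?le_max ?lexx ?orbT//=.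
have [c0|c0] := leP c 0; first by rewrite max_l ?oppr_ge0// sub0r opprK.
by rewrite max_r ?subr0// oppr_le0 ltW.
Qed.

Lemma ell2_delta_subproof i :
  (fun j => (j == i)%:R : R[i]^o) \in @sqsummable R I.
Proof.
apply/asboolP; rewrite -/(psum _) (_ : (fun _ => _) = fun j => if j == i then 1 else 0).
  by rewrite psum_single ?ltry.
by apply/funext => j; case: ifP => _; rewrite ?nrm1 ?nrm0 ?expr1n ?expr0n.
Qed.

Definition ell2_delta i : ell2 R I := MkEll2 (ell2_delta_subproof i).

Lemma ell2_deltaE i j : ell2_delta i j = (j == i)%:R. Proof. by []. Qed.

Lemma hdot_ell2_delta f i : hdot f (ell2_delta i) = f i.
Proof.
rewrite -[LHS]/(ell2_dot _ _) /ell2_dot /csum.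
have E (F : R[i] -> R) : F 0 = 0 -> asum (fun j => F (f j * (ell2_delta i j)^*)) = F (f i).
  move=> F0; rewrite -[RHS](asum_single i); congr asum; apply/funext => j.
  rewrite ell2_deltaE; case: eqP => [->|_]; first by rewrite rmorph1 mulr1.
  by rewrite rmorph0 mulr0.
by rewrite !E//; case: (f i).
Qed.

Lemma nrm_ell2_delta i : nrm (ell2_delta i) = 1.
Proof.
apply/eqP; rewrite -(@eqrXn2 _ 2) ?nrm_ge0// nrm_sq_Re hdot_ell2_delta.
by rewrite ell2_deltaE eqxx expr1n.
Qed.

Lemma ell2_sum_coord (J : Type) (s : seq J) (g : J -> ell2 R I) i :
  (\sum_(j <- s) g j) i = \sum_(j <- s) g j i.
Proof. by elim/big_rec2 : _ => // j y z _ <-. Qed.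

Lemma sum_delta_coord (J : Type) (r : seq J) (s : J -> I) (c : J -> R[i]) i :
  (\sum_(j <- r) c j *: ell2_delta (s j)) i = \sum_(j <- r) c j * (i == s j)%:R.
Proof. by rewrite ell2_sum_coord. Qed.

Lemma sqsum_nrm f : nrm f ^+ 2 = psumr (fun i => nrm (f i) ^+ 2).
Proof. by rewrite nrm_ell2 sqr_ell2_norm. Qed.

Lemma nrm_sum_delta (J : finType) (s : J -> I) (c : J -> R[i]) : injective s ->
  nrm (\sum_j c j *: ell2_delta (s j)) ^+ 2 = \sum_j nrm (c j) ^+ 2.
Proof.
move=> sinj; rewrite nrm_sq_Re hdot_sumr Re_sum; apply: eq_bigr => j _.
rewrite hdotZr hdot_ell2_delta sum_delta_coord (bigD1 j)//= big1 ?addr0 => [|k kj].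
  rewrite eqxx mulr1 mulrC -[RHS]/(complex.Re (nrm (c j) ^+ 2)%:C%C).
  by rewrite -nrmC_sq.
by rewrite (inj_eq sinj) eq_sym (negPf kj) mulr0.
Qed.

Lemma sum_coord_le (J : finType) (s : J -> I) f : injective s ->
  \sum_j nrm (f (s j)) ^+ 2 <= nrm f ^+ 2.
Proof.
move=> sinj; rewrite sqsum_nrm; apply: le_trans (psumr_fset [fset s j | j in J]%fset (ell2S f)).
rewrite big_imfset /=; last by move=> x y _ _; exact: sinj.
by rewrite le_eqVlt; apply/orP; left; rewrite big_enum.
Qed.

End Ell2Basis.

Lemma sum_fset_prefix (R : realType) (J : {fset nat}) (F : nat -> R) :
  (forall i, 0 <= F i) ->
  \sum_(i <- J) F i <= \sum_(k < (\max_(i <- J) i).+1) F k.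
Proof.
move=> F0; rewrite -(big_mkord predT F) [leRHS](bigID (fun i => i \in J)) /=.
have -> : \sum_(0 <= i < (\max_(i <- J) i).+1 | i \in J) F i = \sum_(i <- J) F i.
  rewrite -[LHS]big_filter; apply: perm_big; apply: uniq_perm.
  - by rewrite filter_uniq// iota_uniq.
  - exact: fset_uniq.
  move=> i; rewrite mem_filter mem_index_iota /= ltnS.
  case: (boolP (i \in J)) => //= iJ.
  by rewrite (@leq_bigmax_seq _ (enum_fset J) predT id i).
by rewrite lerDl sumr_ge0.
Qed.

Section Truncation.
Context {R : realType}.
Local Notation l2 := (ell2 R nat).
Implicit Types (f g h : l2) (N : nat) (T : BL l2 l2).

Fact trunc_key : unit. Proof. exact: tt. Qed.
Definition trunc : nat -> l2 -> l2 :=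
  locked_with trunc_key (fun N f => \sum_(k < N) f k *: ell2_delta (k : nat)).

Lemma truncE N f : trunc N f = \sum_(k < N) f k *: ell2_delta (k : nat).
Proof. by rewrite /trunc unlock. Qed.

Lemma trunc_coord N f i : trunc N f i = if (i < N)%N then f i else 0.
Proof.
rewrite truncE sum_delta_coord; case: ifPn => iN.
  rewrite (bigD1 (Ordinal iN))//= eqxx mulr1 big1 ?addr0// => k kN.
  rewrite (_ : i == k = false) ?mulr0//; apply: contraNF kN => /eqP ki.
  exact/eqP/val_inj.
rewrite big1// => k _.
by case: eqP => [ik|_]; [move: iN; rewrite ik ltn_ord|rewrite mulr0].
Qed.

Lemma trunc_nrm N f : nrm (trunc N f) ^+ 2 = \sum_(k < N) nrm (f k) ^+ 2.
Proof. by rewrite truncE nrm_sum_delta//; exact: ord_inj. Qed.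

Lemma trunc_nrm_le N f : nrm (trunc N f) <= nrm f.
Proof.
rewrite -(@ler_pXn2r _ 2) ?nnegrE ?nrm_ge0// trunc_nrm.
by apply: (@sum_coord_le _ _ _ (fun k : 'I_N => k : nat)); exact: ord_inj.
Qed.

Lemma hdot_trunc N f g : hdot (trunc N f) g = hdot f (trunc N g).
Proof.
rewrite !truncE hdot_suml hdot_sumr; apply: eq_bigr => k _.
by rewrite hdotZl hdotZr (hdotC g) !hdot_ell2_delta mulrC.
Qed.

Lemma truncZ N a f : trunc N (a *: f) = a *: trunc N f.
Proof. by rewrite !truncE scaler_sumr; apply: eq_bigr => k _; rewrite ell2ZE scalerA. Qed.

Lemma truncD N f g : trunc N (f + g) = trunc N f + trunc N g.
Proof. by rewrite !truncE -big_split; apply: eq_bigr => k _; rewrite ell2DE scalerDl. Qed.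

Lemma trunc0 N : trunc N 0 = 0.
Proof. by have := truncZ N 0 0; rewrite !scale0r. Qed.

Lemma truncB N f g : trunc N (f - g) = trunc N f - trunc N g.
Proof. by rewrite truncD -scaleN1r truncZ scaleN1r. Qed.

Lemma trunc_sum N (J : Type) (s : seq J) (g : J -> l2) :
  trunc N (\sum_(j <- s) g j) = \sum_(j <- s) trunc N (g j).
Proof.
exact: (big_morph (trunc N) (@truncD N) (trunc0 N)).
Qed.

Lemma trunc_idem N f : trunc N (trunc N f) = trunc N f.
Proof.
have E i : trunc N (trunc N f) i = trunc N f i.
  rewrite trunc_coord; case: ifP => // iN.
  by rewrite trunc_coord iN.
by apply/val_inj/funext => i; exact: E.
Qed.

Lemma trunc_pyth N f : nrm (f - trunc N f) ^+ 2 = nrm f ^+ 2 - nrm (trunc N f) ^+ 2.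
Proof.
apply/complexI; rewrite rmorphB /= !nrm_sq_hdot hdotBl !hdotBr.
by rewrite -!hdot_trunc trunc_idem subrr subr0.
Qed.

Lemma nrm_sub_trunc_le N f : nrm (f - trunc N f) <= nrm f.
Proof.
rewrite -(@ler_pXn2r _ 2) ?nnegrE ?nrm_ge0// trunc_pyth.
by rewrite gerBl sqr_ge0.
Qed.

Lemma trunc_mono N M f : (N <= M)%N ->
  nrm (f - trunc M f) <= nrm (f - trunc N f).
Proof.
move=> NM; have mono : nrm (trunc N f) ^+ 2 <= nrm (trunc M f) ^+ 2.
  rewrite (trunc_nrm N f) (trunc_nrm M f).
  have E K : \sum_(k < K) nrm (f k) ^+ 2 = \sum_(0 <= k < K) nrm (f k) ^+ 2.
    by rewrite big_mkord.
  rewrite (E N) (E M) [leRHS](big_cat_nat (leq0n N) NM) /= lerDl sumr_ge0// => k _; exact: sqr_ge0.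
have hM := trunc_pyth M f; have hN := trunc_pyth N f.
rewrite -(@ler_pXn2r _ 2) ?nnegrE ?nrm_ge0 => [|//|//|//].
by lra.
Qed.

Lemma trunc_cvg f (e : R) : 0 < e -> exists N, forall M, (N <= M)%N -> nrm (f - trunc M f) <= e.
Proof.
move=> e0; suff [N hN] : exists N, nrm (f - trunc N f) <= e.
  by exists N => M /(trunc_mono f) h; exact: le_trans h hN.
apply: contrapT => /forallNP h.
have h' N : \sum_(k < N) nrm (f k) ^+ 2 <= nrm f ^+ 2 - e ^+ 2.
  have /negP := h N; rewrite -ltNge => eN; rewrite -trunc_nrm.
  have : e ^+ 2 < nrm (f - trunc N f) ^+ 2 by rewrite ltr_pXn2r ?nnegrE ?nrm_ge0// ltW.
  by rewrite trunc_pyth; lra.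
have [] := @psumr_ub _ _ (fun i => nrm (f i) ^+ 2) (nrm f ^+ 2 - e ^+ 2).
- by move=> i; exact: sqr_ge0.
- move=> J; apply: le_trans (h' (\max_(i <- J) i).+1).
  exact: (sum_fset_prefix J (fun k => sqr_ge0 (nrm (f k)))).
move=> _; rewrite -sqsum_nrm; have := exprn_gt0 2 e0; lra.
Qed.

Lemma coord_le f i : nrm (f i) <= nrm f.
Proof. by rewrite -hdot_ell2_delta (le_trans (hdot_cs _ _))// nrm_ell2_delta mulr1. Qed.

(** Boundedness, tested on the conjugate of the row, shows that the row is square summable;
    finitely supported vectors are dense, so the row represents the coordinate. *)
Lemma row_vector T i : exists b : l2, forall h, T h i = hdot h b.
Proof.
pose b k := (T (ell2_delta k) i)^*.
have bN N : \sum_(k < N) nrm (b k) ^+ 2 <= opnorm T ^+ 2.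
  pose v : l2 := \sum_(k < N) b k *: ell2_delta (k : nat).
  have v2 : nrm v ^+ 2 = \sum_(k < N) nrm (b k) ^+ 2.
    by rewrite nrm_sum_delta//; exact: ord_inj.
  have Tv : T v i = (nrm v ^+ 2)%:C%C.
    rewrite v2 linear_sum ell2_sum_coord rmorph_sum; apply: eq_bigr => k _.
    by rewrite linearZ ell2ZE /= -nrmC_sq /b conjCK.
  have := coord_le (T v) i; rewrite Tv nrmR ger0_norm ?sqr_ge0//.
  move=> /le_trans/(_ (nrm_opnorm T v)).
  rewrite -v2; have [->|v0] := eqVneq (nrm v) 0; first by rewrite expr0n sqr_ge0.
  have vp : 0 < nrm v by rewrite lt_neqAle eq_sym v0 nrm_ge0.
  rewrite expr2 ler_pM2r// => h.
  by rewrite -expr2 lerXn2r ?nnegrE ?opnorm_ge0 ?nrm_ge0.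
have sb : b \in @sqsummable R nat.
  apply/sqsummableP.
  apply: (@psumr_ub _ _ (fun k => nrm (b k) ^+ 2) (opnorm T ^+ 2) _ _).1.
    by move=> k; exact: sqr_ge0.
  move=> J; apply: le_trans (bN (\max_(i <- J) i).+1).
  exact: (sum_fset_prefix J (fun k => sqr_ge0 (nrm (b k)))).
pose B := MkEll2 sb; exists B => h.
have eN N : T (trunc N h) i = hdot (trunc N h) B.
  rewrite truncE linear_sum ell2_sum_coord hdot_suml; apply: eq_bigr => k _.
  by rewrite linearZ ell2ZE hdotZl hdotC hdot_ell2_delta conjCK.
apply/eqP; rewrite -subr_eq0; apply/eqP/nrm0_eq0/le_anti.
rewrite nrm_ge0 andbT; apply/ler_addgt0Pr => e e0; rewrite add0r.
pose M := opnorm T + nrm B + 1.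
have M0 : 0 < M by rewrite ltr_wpDl// addr_ge0 ?opnorm_ge0 ?nrm_ge0.
have [N hN] := trunc_cvg h (divr_gt0 e0 M0).
have {}hN := hN N (leqnn N).
have -> : T h i - hdot h B = T (h - trunc N h) i - hdot (h - trunc N h) B.
  by rewrite linearB ell2DE ell2NE hdotBl eN opprB addrA subrK.
apply: le_trans (nrmD _ _) _; rewrite nrmN.
apply: (@le_trans _ _ (M * nrm (h - trunc N h))); last first.
  by rewrite mulrC -ler_pdivlMr.
apply: (@le_trans _ _ (opnorm T * nrm (h - trunc N h) + nrm B * nrm (h - trunc N h))).
  apply: lerD; first by rewrite (le_trans (coord_le _ _))// nrm_opnorm.
  by rewrite mulrC hdot_cs.
by rewrite -mulrDl ler_wpM2r ?nrm_ge0// /M lerDl.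
Qed.

Lemma compact_net (V : normedModType R[i]) (A : set V) (e : R) :
  compact (closure A) -> 0 < e ->
  exists l : seq V, forall y, A y -> exists2 c, c \in l & nrm (y - c) < e.
Proof.
rewrite compact_cover => cA e0.
have [|y Ay|D _ hD] := @cA V setT (fun c => ball c (e%:C)%C) _ _.
- by move=> c _; apply: ball_open; rewrite ltcR.
- exists y => //; apply: ballxx; by rewrite ltcR.
exists D => y Ay; have [c /= cD] := hD y (subset_closure Ay).
rewrite -ball_normE /= nrmE ltcR => yc; exists c => //.
by rewrite -nrmN opprB.
Qed.

(** Truncations converge pointwise, hence uniformly on a finite net of the image of the ball. *)
Lemma compact_trunc_left T (e : R) : compact_op T -> 0 < e ->
  exists N, forall M, (N <= M)%N -> forall h, nrm (T h - trunc M (T h)) <= e * nrm h.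
Proof.
move=> cT e0; have e2 : 0 < e / 2 by rewrite divr_gt0.
have [l hl] := compact_net cT e2.
have [N hN] : exists N, forall M, (N <= M)%N -> forall c, c \in l -> nrm (c - trunc M c) <= e / 2.
  elim: l {hl} => [|c l [N hN]]; first by exists 0%N.
  have [N' hN'] := trunc_cvg c e2; exists (maxn N N') => M; rewrite geq_max => /andP[h1 h2] d.
  by rewrite inE => /predU1P[->|]; [exact: hN'|exact: hN].
exists N => M NM h.
have [->|h0] := eqVneq h 0.
  by rewrite linear0 trunc0 subr0 nrm0 mulr0.
have hp : 0 < nrm h.
  by rewrite lt_neqAle nrm_ge0 andbT eq_sym; apply: contra_neq h0 => /nrm0_eq0.
pose a := ((nrm h)^-1)%:C%C.
have na : nrm a = (nrm h)^-1 by rewrite nrmR ger0_norm// invr_ge0 nrm_ge0.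
suff : nrm (a *: (T h - trunc M (T h))) <= e.
  by rewrite nrmZ na mulrC ler_pdivrMr.
rewrite scalerBr -truncZ -linearZ.
have [|c cl hc] := hl (T (a *: h)).
  by exists (a *: h) => //=; rewrite nrmZ na mulVf ?gt_eqF.
set y := T _ in hc *.
have -> : y - trunc M y = (y - c - trunc M (y - c)) + (c - trunc M c).
  by rewrite truncB opprB addrAC !addrA !subrK.
apply: le_trans (nrmD _ _) _; rewrite [leRHS]splitr; apply: lerD; last exact: hN.
by apply: le_trans (nrm_sub_trunc_le M (y - c)) _; exact: ltW.
Qed.

(** Finitely many rows, each of them square summable. *)
Lemma row_trunc_right T (L : nat) (e : R) : 0 < e ->
  exists N, forall M, (N <= M)%N -> forall h,
    nrm (trunc L (T (h - trunc M h))) <= e * nrm h.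
Proof.
move=> e0.
pose e' := e / L.+1%:R; have e'0 : 0 < e' by rewrite divr_gt0.
have /choice[b hb] := row_vector T.
have [N hN] : exists N, forall M, (N <= M)%N -> forall i, (i < L)%N -> nrm (b i - trunc M (b i)) <= e'.
  elim: L {e' e'0} (e') (e'0) => [|L IH] e' e'0; first by exists 0%N.
  have [N hN] := IH _ e'0.
  have [N' hN'] := trunc_cvg (b L) e'0; exists (maxn N N') => M; rewrite geq_max => /andP[h1 h2] i.
  by rewrite ltnS leq_eqVlt => /predU1P[->|]; [exact: hN'|exact: hN].
exists N => M NM h.
apply: (@le_trans _ _ (\sum_(k < L) e' * nrm h)); last first.
  have -> : \sum_(k < L) e' * nrm h = e * nrm h * (L%:R / L.+1%:R).
    rewrite sumr_const card_ord -[LHS]mulr_natr /e' -!mulrA; congr (_ * _).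
    by rewrite mulrC -mulrA.
  apply: ler_piMr; first by rewrite mulr_ge0 ?nrm_ge0// ltW.
  by rewrite ler_pdivrMr// mul1r ler_nat.
rewrite truncE; apply: le_trans (nrm_sum _ _ _) _; apply: ler_sum => k _.
rewrite nrmZ hb.
rewrite nrm_ell2_delta mulr1 hdotBl hdot_trunc -hdotBr (le_trans (hdot_cs _ _))// mulrC.
by rewrite ler_wpM2r ?nrm_ge0// hN.
Qed.

Lemma compact_trunc T (e : R) : compact_op T -> 0 < e ->
  exists N, forall M, (N <= M)%N -> forall h,
    nrm (T h - trunc M (T (trunc M h))) <= e * nrm h.
Proof.
move=> cT e0; have e3 : 0 < e / 3 by rewrite divr_gt0.
have [L hL] := compact_trunc_left cT e3.
have [N hN] := row_trunc_right T L e3.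
exists (maxn L N) => M; rewrite geq_max => /andP[LM NM] h.
pose d := h - trunc M h.
have dh : nrm d <= nrm h by exact: nrm_sub_trunc_le.
have -> : T h - trunc M (T (trunc M h)) = (T h - trunc M (T h)) + trunc M (T d).
  by rewrite linearB truncB addrA subrK.
have -> : e * nrm h = e / 3 * nrm h + (e / 3 * nrm h + e / 3 * nrm h) by field.
apply: le_trans (nrmD _ _) _; apply: lerD; first exact: hL.
apply: le_trans (trunc_nrm_le _ _) _.
rewrite -[T d](subrK (trunc L (T d))).
apply: le_trans (nrmD _ _) _; apply: lerD; last exact: hN.
by apply: le_trans (hL L (leqnn L) d) _; rewrite ler_wpM2l// ltW.
Qed.

End Truncation.

(** * Matrix norms, completely bounded norms and tracial forms *)

Section MatrixNorms.
Context {R : realType}.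
Implicit Types (H K : hilbertType R).

Definition mxbd H n (x : 'M[BL H H]_n) (c : R) : Prop :=
  forall h : 'I_n -> H,
    \sum_i nrm (\sum_j x i j (h j)) ^+ 2 <= c * \sum_j nrm (h j) ^+ 2.

Lemma sum_sq_ge0 H n (h : 'I_n -> H) : 0 <= \sum_i nrm (h i) ^+ 2.
Proof. by apply: sumr_ge0 => i _; exact: sqr_ge0. Qed.

Lemma sum_sq_eq0 H n (h : 'I_n -> H) : \sum_i nrm (h i) ^+ 2 = 0 -> forall i, h i = 0.
Proof.
move=> /eqP; rewrite psumr_eq0; last by move=> i _; exact: sqr_ge0.
move=> /allP h0 i; have := h0 i (mem_index_enum _).
by rewrite sqrf_eq0 => /eqP /nrm0_eq0.
Qed.

Lemma mxnormP H n (x : 'M[BL H H]_n) (r : R) : 0 <= r ->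
  (mxnorm x <= r%:E)%E <-> mxbd x (r ^+ 2).
Proof.
move=> r0; split=> [xr h|xr]; last first.
  apply: ge_ereal_sup => _ [h /= h1 <-]; rewrite lee_fin.
  rewrite -(@ler_pXn2r _ 2) ?nnegrE ?sqrtr_ge0// sqr_sqrtr ?sum_sq_ge0//.
  apply: le_trans (xr h) _; rewrite ler_piMr ?sqr_ge0//.
  rewrite -(sqr_sqrtr (sum_sq_ge0 h)) -(expr1n _ 2).
  by rewrite lerXn2r ?nnegrE ?sqrtr_ge0.
have S0 := sum_sq_ge0 h; set S := \sum_j _ in S0 *.
have [Sz|Sn] := eqVneq S 0.
  rewrite Sz mulr0 big1// => i _; rewrite big1 ?nrm0 ?expr0n// => j _.
  by rewrite (sum_sq_eq0 Sz) linear0.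
have Sp : 0 < S by rewrite lt_neqAle eq_sym Sn.
pose a := ((Num.sqrt S)^-1)%:C%C.
have a2 : nrm a ^+ 2 = S^-1.
  by rewrite nrmR ger0_norm ?invr_ge0 ?sqrtr_ge0// exprVn sqr_sqrtr.
have le1 : l2sum (fun i => a *: h i) <= 1.
  rewrite -[leRHS]sqrtr1 ler_sqrt ?ltr01//.
  under eq_bigr do rewrite nrmZ exprMn a2.
  by rewrite -mulr_sumr mulVf.
have : ((l2sum (fun i => \sum_j x i j (a *: h j)))%:E <= r%:E)%E.
  apply: le_trans xr; apply: ereal_sup_ubound.
  by exists (fun i => a *: h i).
rewrite lee_fin -(@ler_pXn2r _ 2) ?nnegrE ?sqrtr_ge0// sqr_sqrtr ?sum_sq_ge0//.
have E i : \sum_j x i j (a *: h j) = a *: \sum_j x i j (h j).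
  by rewrite scaler_sumr; apply: eq_bigr => j _; rewrite linearZ.
under eq_bigr do rewrite E nrmZ exprMn a2.
by rewrite -mulr_sumr mulrC ler_pdivrMr.
Qed.

Lemma os_mxnormP H (E : opSpace H) n (x : 'M[E]_n) (r : R) : 0 <= r ->
  (os_mxnorm x <= r%:E)%E <->
  forall h : 'I_n -> H, \sum_i nrm (\sum_j os_val (x i j) (h j)) ^+ 2
    <= r ^+ 2 * \sum_j nrm (h j) ^+ 2.
Proof.
move=> r0; rewrite /os_mxnorm; split=> [/(mxnormP _ r0) h k|h].
  by have := h k; under eq_bigr do under eq_bigr do rewrite mxE.
apply/(mxnormP _ r0) => k; under eq_bigr do under eq_bigr do rewrite mxE.
exact: h.
Qed.

Lemma os_valD H (E : opSpace H) (x y : E) : os_val (x + y) = os_val x + os_val y.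
Proof. by []. Qed.
Lemma os_valZ H (E : opSpace H) (a : R[i]) (x : E) : os_val (a *: x) = a *: os_val x.
Proof. by []. Qed.
Lemma BLZE H (a : R[i]) (S : BL H H) h : (a *: S) h = a *: S h.
Proof. by []. Qed.
Lemma BLDE H (S T : BL H H) h : (S + T) h = S h + T h.
Proof. by []. Qed.
Lemma BL0E H h : (0 : BL H H) h = 0.
Proof. by []. Qed.

Lemma os_val_sum H (E : opSpace H) (J : Type) (s : seq J) (P : pred J) (f : J -> E) h :
  os_val (\sum_(j <- s | P j) f j) h = \sum_(j <- s | P j) os_val (f j) h.
Proof.
by elim/big_rec2 : _ => // j y1 y2 _ <-.
Qed.

Lemma os_mxnorm_scale H (E : opSpace H) n (x : 'M[E]_n) (a r : R) :
  0 <= a -> 0 <= r -> (os_mxnorm x <= r%:E)%E ->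
  (os_mxnorm (\matrix_(i, j) (a%:C%C *: x i j)) <= (a * r)%:E)%E.
Proof.
move=> a0 r0 /(os_mxnormP _ r0) xr; apply/os_mxnormP => [|h]; first exact: mulr_ge0.
have E' i : \sum_j os_val ((\matrix_(i, j) (a%:C%C *: x i j)) i j) (h j) =
    a%:C%C *: \sum_j os_val (x i j) (h j).
  by rewrite scaler_sumr; apply: eq_bigr => j _; rewrite mxE os_valZ.
under eq_bigr do rewrite E' nrmZ nrmR ger0_norm// exprMn.
by rewrite -mulr_sumr exprMn -[leRHS]mulrA ler_wpM2l ?sqr_ge0.
Qed.

Lemma cbnorm_bound H K (E : opSpace H) (G : opSpace K) (v : {linear E -> G})
    n (x : 'M[E]_n) (c r : R) : 0 <= c -> 0 < r -> (cbnorm v <= c%:E)%E ->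
  (os_mxnorm x <= r%:E)%E -> (os_mxnorm (map_mx v x) <= (c * r)%:E)%E.
Proof.
move=> c0 r0 vc xr; pose x' : 'M[E]_n := \matrix_(i, j) ((r^-1)%:C%C *: x i j).
have x'1 : (os_mxnorm x' <= 1)%E.
  have r'0 : 0 <= r^-1 by rewrite invr_ge0 ltW.
  by have := os_mxnorm_scale r'0 (ltW r0) xr; rewrite mulVf ?gt_eqF.
have : (os_mxnorm (map_mx v x') <= c%:E)%E.
  by apply: le_trans vc; apply: ereal_sup_ubound; exists n, x'.
move=> /(os_mxnorm_scale (ltW r0) c0); rewrite mulrC.
congr (os_mxnorm _ <= _)%E; apply/matrixP => i j; rewrite !mxE linearZ scalerA.
by rewrite -rmorphM mulfV ?gt_eqF// rmorph1 scale1r.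
Qed.

Lemma cbnorm_ge0 H K (E : opSpace H) (G : opSpace K) (v : E -> G) :
  (0 <= cbnorm v)%E.
Proof.
apply: ereal_sup_ge; exists (0%:E) => //.
exists 0%N, (\matrix_(i, j) 0); split.
  apply: ge_ereal_sup => _ [h _ <-].
  by rewrite lee_fin /l2sum big_ord0 sqrtr0.
apply/le_anti/andP; split.
  apply: ereal_sup_ubound; exists (fun=> 0); last by rewrite /l2sum big_ord0 sqrtr0.
  by rewrite /= /l2sum big_ord0 sqrtr0.
apply: ge_ereal_sup => _ [h _ <-].
by rewrite lee_fin /l2sum big_ord0 sqrtr0.
Qed.

Lemma mx11_bound H (E : opSpace H) (x : E) (r : R) : 0 <= r ->
  (os_mxnorm (\matrix_(i < 1, j < 1) x) <= r%:E)%E <-> nrm x <= r.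
Proof.
move=> r0; split=> [/(os_mxnormP _ r0) h|xr].
  rewrite nrm_os; apply: opnorm_le => y y1.
  have := h (fun=> y); rewrite !big_ord1 mxE => hy.
  rewrite -(@ler_pXn2r _ 2) ?nnegrE ?nrm_ge0//; apply: le_trans hy _.
  by rewrite ler_piMr ?sqr_ge0// -(expr1n _ 2) lerXn2r ?nnegrE ?nrm_ge0.
apply/(os_mxnormP _ r0) => h; rewrite !big_ord1 mxE -exprMn.
rewrite lerXn2r ?nnegrE ?mulr_ge0 ?nrm_ge0//.
by rewrite (le_trans (nrm_opnorm _ _))// ler_wpM2r ?nrm_ge0.
Qed.

(** Proved with a margin d, because [cbnorm_bound] rescales by a positive bound. *)
Lemma cbnorm_nrm H K (E : opSpace H) (G : opSpace K) (v : {linear E -> G}) (x : E) (c : R) :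
  0 <= c -> (cbnorm v <= c%:E)%E -> nrm (v x) <= c * nrm x.
Proof.
move=> c0 vc; apply/ler_addgt0Pr => e e0.
pose d := e / (c + 1).
have c1 : 0 < c + 1 by rewrite ltr_wpDl.
have d0 : 0 < d by rewrite divr_gt0.
have r0 : 0 < nrm x + d by rewrite ltr_wpDl// nrm_ge0.
have := cbnorm_bound c0 r0 vc ((mx11_bound x (ltW r0)).2 _).
rewrite lerDl (ltW d0) => /(_ isT).
have -> : map_mx v (\matrix_(i < 1, j < 1) x) = \matrix_(i < 1, j < 1) v x.
  by apply/matrixP => i j; rewrite !mxE.
rewrite mx11_bound ?mulr_ge0 ?(ltW r0)// => /le_trans; apply.
rewrite mulrDr lerD2l /d mulrCA ler_piMr ?(ltW e0)//.
by rewrite ler_pdivrMr// mul1r lerDl.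
Qed.

Lemma dualZl H K (E : opSpace H) (F : opSpace K) (u : {linear E -> os_dual F}) a x y :
  u (a *: x) y = a * u x y.
Proof. by rewrite linearZ. Qed.

Lemma dualZr H K (E : opSpace H) (F : opSpace K) (u : {linear E -> os_dual F}) a x y :
  u x (a *: y) = a * u x y.
Proof. exact: linearZ. Qed.

Lemma dual_suml H K (E : opSpace H) (F : opSpace K) (u : {linear E -> os_dual F})
  (J : Type) (s : seq J) (P : pred J) (f : J -> E) y :
  u (\sum_(j <- s | P j) f j) y = \sum_(j <- s | P j) u (f j) y.
Proof.
rewrite linear_sum; by elim/big_rec2 : _ => // j y1 y2 _ <-.
Qed.

Lemma dual_sumr H K (E : opSpace H) (F : opSpace K) (u : {linear E -> os_dual F})
  (J : Type) (s : seq J) (P : pred J) x (f : J -> F) :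
  u x (\sum_(j <- s | P j) f j) = \sum_(j <- s | P j) u x (f j).
Proof. exact: linear_sum. Qed.

Lemma tbnorm_bound H K (E : opSpace H) (F : opSpace K) (u : {linear E -> os_dual F})
    n (x : 'M[E]_n) (y : 'M[F]_n) (b r s : R) :
  (0 < n)%N -> 0 < r -> 0 < s -> (tbnorm u <= b%:E)%E ->
  (os_mxnorm x <= r%:E)%E -> (os_mxnorm y <= s%:E)%E ->
  nrm (tb_form u x y) <= b * r * s.
Proof.
move=> n0 r0 s0 ub xr ys.
pose x' : 'M[E]_n := \matrix_(i, j) ((r^-1)%:C%C *: x i j).
pose y' : 'M[F]_n := \matrix_(i, j) ((s^-1)%:C%C *: y i j).
have x'1 : (os_mxnorm x' <= 1)%E.
  have r'0 : 0 <= r^-1 by rewrite invr_ge0 ltW.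
  by have := os_mxnorm_scale r'0 (ltW r0) xr; rewrite mulVf ?gt_eqF.
have y'1 : (os_mxnorm y' <= 1)%E.
  have s'0 : 0 <= s^-1 by rewrite invr_ge0 ltW.
  by have := os_mxnorm_scale s'0 (ltW s0) ys; rewrite mulVf ?gt_eqF.
have : ((nrm (tb_form u x' y'))%:E <= b%:E)%E.
  by apply: le_trans ub; apply: ereal_sup_ubound; exists n, x', y'.
have -> : tb_form u x' y' = (r^-1 * s^-1)%:C%C * tb_form u x y.
  rewrite /tb_form mulrCA; congr (_ * _); rewrite mulr_sumr; apply: eq_bigr => i _.
  rewrite mulr_sumr; apply: eq_bigr => j _; rewrite !mxE dualZl dualZr.
  by rewrite rmorphM mulrA.
rewrite lee_fin nrmM nrmR ger0_norm ?mulr_ge0 ?invr_ge0 ?(ltW r0) ?(ltW s0)//.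
rewrite -invfM mulrC ler_pdivrMr ?mulr_gt0//; congr (_ <= _).
by rewrite mulrA.
Qed.

(** The first alternative is the null space, where the product of the two cb norms might
    be 0 times infinity. *)
Lemma dSK_fin_lt H (E : opSpace H) (c : R) : (dSK_fin E < c%:E)%E ->
  (forall x : E, x = 0) \/
  exists (G : opSpace (ell2 R nat)) (v : {linear E -> G}) (w : {linear G -> E}) (a b : R),
    [/\ forall T, T \in os_set G -> compact_op T, cancel v w,
      [/\ 0 < a, 0 < b & a * b < c], (cbnorm v <= a%:E)%E & (cbnorm w <= b%:E)%E].
Proof.
move=> /ereal_inf_lt[_ [G [cG ->]]].
move=> /ereal_inf_lt[_ [v [w [vw wv ->]]]] lt.
have zero : cbnorm v = 0%E \/ cbnorm w = 0%E -> forall x : E, x = 0.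
  case=> [v0|w0] x; rewrite -(vw x).
    suff -> : v x = 0 by rewrite linear0.
    apply: nrm0_eq0; apply/le_anti; rewrite nrm_ge0 andbT.
    by have := @cbnorm_nrm _ _ _ _ v x 0 (lexx _); rewrite v0 mul0r; exact.
  apply: nrm0_eq0; apply/le_anti; rewrite nrm_ge0 andbT.
  by have := @cbnorm_nrm _ _ _ _ w (v x) 0 (lexx _); rewrite w0 mul0r; exact.
have [v0|v0] := eqVneq (cbnorm v) 0%E; first by left; apply: zero; left.
have [w0|w0] := eqVneq (cbnorm w) 0%E; first by left; apply: zero; right.
right; exists G, v, w.
have vp : (0 < cbnorm v)%E by rewrite lt_neqAle eq_sym v0 cbnorm_ge0.
have wp : (0 < cbnorm w)%E by rewrite lt_neqAle eq_sym w0 cbnorm_ge0.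
case: (cbnorm v) (cbnorm w) lt vp wp => [a| |] [b| |]//=.
- by rewrite -EFinM !lte_fin => ab a0 b0; exists a, b; split.
- by rewrite lte_fin => ab a0; rewrite gt0_muley// in ab.
- by move=> ab _; rewrite lte_fin => b0; rewrite gt0_mulye// in ab.
Qed.

End MatrixNorms.

(** * Lifting a convolution operator to finite matrices *)

Section Lift.
Context {R : realType}.

(** The norm of the convolution operator by x, measured on finite sections. *)
Definition sec_bound (H : hilbertType R) (E : opSpace H) (x : freeGroup -> E) (k : R) :=
  forall m (s : 'I_m -> freeGroup), injective s ->
    (os_mxnorm (\matrix_(i, j) x (s i * (s j)^-1)%g) <= k%:E)%E.

(** The matrix of the sum of the pi(t) p (x) x_t. *)
Definition liftmx (H : hilbertType R) (E : opSpace H) (T : seq freeGroup)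
    (x : freeGroup -> E) n (a : freeGroup -> 'I_n -> 'I_n) (p : 'I_n -> 'I_n -> R[i]) :
    'M[E]_n :=
  \matrix_(i, j) \sum_(t <- T) p (a t^-1%g i) j *: x t.

Lemma eventually_all_in (T : eqType) (l : seq T) (A : T -> nat -> Prop) :
  (forall t, exists N, forall M, (N <= M)%N -> A t M) ->
  exists N, forall M, (N <= M)%N -> forall t, t \in l -> A t M.
Proof.
move=> h; elim: l => [|t l [N hN]]; first by exists 0%N.
have [N' hN'] := h t; exists (maxn N N') => M; rewrite geq_max => /andP[h1 h2] s.
by rewrite inE => /predU1P[->|]; [exact: hN'|exact: hN].
Qed.

Lemma act_bij n (a : freeGroup -> 'I_n -> 'I_n) g : is_action a -> bijective (a g).
Proof.
by move=> aP; exists (a g^-1%g) => i; [exact: actVK|exact: actKV].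
Qed.

Section Compress.
Variables (G : opSpace (ell2 R nat)) (T : seq freeGroup) (g : freeGroup -> G).
Variables (N : nat).
Local Notation l2 := (ell2 R nat).

Definition trmx_coef t (b c : 'I_N) : R[i] := os_val (g t) (ell2_delta (c : nat)) (b : nat).

Lemma trunc_op_coord t h (b : 'I_N) :
  os_val (g t) (trunc N h) (b : nat) = \sum_c trmx_coef t b c * h (c : nat).
Proof.
rewrite truncE linear_sum ell2_sum_coord; apply: eq_bigr => c _.
by rewrite linearZ ell2ZE mulrC.
Qed.

Lemma secmx_trunc_bound (k : R) m (s : 'I_m -> freeGroup) x : 0 <= k ->
  sec_bound g k -> injective s ->
  ipsq (@fdot R _) (mop (secmx trmx_coef s) x) <= k ^+ 2 * ipsq (@fdot R _) x.
Proof.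
move=> k0 gk sinj; have /(os_mxnormP _ k0) hk := gk m s sinj.
pose h (j : 'I_m) : l2 := \sum_(c < N) x (j, c) *: ell2_delta (c : nat).
have h2 j : nrm (h j) ^+ 2 = \sum_c nrm (x (j, c)) ^+ 2.
  by rewrite nrm_sum_delta//; exact: ord_inj.
have := hk h; under [in leRHS]eq_bigr do rewrite h2.
rewrite !ipsq_fdot !sum_pair; apply: le_trans; apply: ler_sum => i _.
set y : l2 := \sum_j _.
have -> : \sum_b nrm (mop (secmx trmx_coef s) x (i, b)) ^+ 2 =
    \sum_(b < N) nrm (y (b : nat)) ^+ 2.
  apply: eq_bigr => b _; congr (nrm _ ^+ 2).
  rewrite mop_secmx /y ell2_sum_coord; apply: eq_bigr => j _.
  rewrite mxE /h linear_sum ell2_sum_coord; apply: eq_bigr => c _.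
  by rewrite linearZ ell2ZE mulrC.
by apply: (@sum_coord_le _ _ _ (fun b : 'I_N => b : nat)); exact: ord_inj.
Qed.

Lemma liftmx_trunc_bound n (a : freeGroup -> 'I_n -> 'I_n) p (k1 : R)
  (h : 'I_n -> l2) : is_action a -> 0 <= k1 ->
  (forall x, ipsq (@fdot R _) (mop (actmx T trmx_coef a) (tens1 p x)) <=
     k1 * ipsq (@fdot R _) x) ->
  \sum_i nrm (\sum_j \sum_(t <- T) p (a t^-1%g i) j *:
     trunc N (os_val (g t) (trunc N (h j)))) ^+ 2 <= k1 * \sum_j nrm (h j) ^+ 2.
Proof.
move=> aP k10 hp.
pose x (q : 'I_n * 'I_N) : R[i]^o := h q.1 (q.2 : nat).
apply: (@le_trans _ _ (k1 * ipsq (@fdot R _) x)); last first.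
  rewrite ler_wpM2l// ipsq_fdot sum_pair; apply: ler_sum => j _.
  by apply: (@sum_coord_le _ _ _ (fun b : 'I_N => b : nat) (h j)); exact: ord_inj.
apply: le_trans (hp x); rewrite ipsq_fdot sum_pair; apply: ler_sum => i _.
set y : l2 := \sum_j _.
have -> : y = trunc N (\sum_j \sum_(t <- T) p (a t^-1%g i) j *:
     os_val (g t) (trunc N (h j))).
  rewrite trunc_sum; apply: eq_bigr => j _; rewrite trunc_sum; apply: eq_bigr => t _.
  by rewrite truncZ.
rewrite trunc_nrm le_eqVlt; apply/orP; left; apply/eqP; apply: eq_bigr => b _.
congr (nrm _ ^+ 2); rewrite mop_actmx// ell2_sum_coord.
under eq_bigr do rewrite ell2_sum_coord.
rewrite exchange_big; apply: eq_bigr => t _.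
under eq_bigr do rewrite ell2ZE trunc_op_coord mulr_sumr.
rewrite exchange_big /=; apply: eq_bigr => c _.
rewrite /tens1 mulr_sumr; apply: eq_bigr => j _ /=.
by rewrite mulrCA.
Qed.

End Compress.

(** Compactness allows one to pass to N x N matrices, where [cutoff_projection]
    applies. The matrices pi(t) p are contractions, so the error of the truncation is
    uniform in n. *)
Lemma lift_compact (G : opSpace (ell2 R nat)) (T : seq freeGroup)
    (g : freeGroup -> G) (k k1 eta : R) :
  uniq T -> (forall t, t \notin T -> g t = 0) ->
  (forall S, S \in os_set G -> compact_op S) ->
  0 <= k -> k < k1 -> 0 < eta -> sec_bound g k ->
  exists U : seq freeGroup, forall n (a : freeGroup -> 'I_n -> 'I_n),
    is_action a -> (forall w, {in U &, injective (a^~ w)}) ->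
    exists p : 'I_n -> 'I_n -> R[i],
      \sum_i \sum_j nrm ((i == j)%:R - p i j) ^+ 2 <= eta * n%:R /\
      (os_mxnorm (liftmx T g a p) <= k1%:E)%E.
Proof.
move=> uT g0 cG k0 kk1 eta0 gk.
have [d d0 dE] : exists2 d, 0 < d & k1 = k + d + d.
  by exists ((k1 - k) / 2); [rewrite divr_gt0// subr_gt0|field].
(* half of the margin is left to the cut-off, half to the truncation errors *)
have [e e0 eE] : exists2 e, 0 < e & e * (size T)%:R <= d.
  exists (d / (size T).+1%:R); first by rewrite divr_gt0.
  by rewrite mulrAC ler_pdivrMr// ler_pM2l// ler_nat.
have [N hN] := eventually_all_in T (fun t => compact_trunc (cG _ (os_valP (g t))) e0).
have {hN} hN t : forall h, nrm (os_val (g t) h - trunc N (os_val (g t) (trunc N h))) <= e * nrm h.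
  have [tT|tT] := boolP (t \in T); first exact: (hN N (leqnn N)).
  by move=> h; rewrite (g0 t tT) !BL0E trunc0 subr0 nrm0 mulr_ge0 ?nrm_ge0 ?(ltW e0).
pose z := trmx_coef g (N := N).
have z0 t b c : t \notin T -> z t b c = 0 by move=> tT; rewrite /z /trmx_coef g0.
have kd0 : 0 <= k + d by rewrite addr_ge0// ltW.
have kd2 : k ^+ 2 < (k + d) ^+ 2.
  by rewrite ltr_pXn2r ?nnegrE ?ltrDl.
have [U hU] := cutoff_projection uT z0 (sqr_ge0 k) kd2 eta0
  (fun m s sinj x => secmx_trunc_bound x k0 gk sinj).
exists U => n a aP afree; have [p [pP p1 p2]] := hU n a aP afree.
exists p; split=> //.
have k10 : 0 <= k1 by rewrite ltW// (le_lt_trans k0).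
apply/(os_mxnormP _ k10) => h.
have ipf := @hsdot_ip R (ell2 R nat) 'I_n.
pose f0 i := \sum_j \sum_(t <- T) p (a t^-1%g i) j *:
     trunc N (os_val (g t) (trunc N (h j))).
pose f1 t i := \sum_j p (a t^-1%g i) j *:
     (os_val (g t) (h j) - trunc N (os_val (g t) (trunc N (h j)))).
have fE : (fun i => \sum_j os_val (liftmx T g a p i j) (h j)) = f0 + \sum_(t <- T) f1 t.
  apply/funext => i; rewrite -[RHS]/(f0 i + (\sum_(t <- T) f1 t) i).
  have -> : (\sum_(t <- T) f1 t) i = \sum_(t <- T) f1 t i by elim/big_rec2 : _ => // t y1 y2 _ <-.
  rewrite /f0 /f1 [X in _ + X]exchange_big -big_split; apply: eq_bigr => j _ /=.
  rewrite mxE os_val_sum -big_split; apply: eq_bigr => t _.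
  by rewrite os_valZ BLZE /= -scalerDr addrC subrK.
pose nn := ipn (@hsdot R (ell2 R nat) 'I_n).
have nnE f : nn f = Num.sqrt (\sum_i nrm (f i) ^+ 2) by rewrite /nn /ipn ipsq_hsdot.
set S := \sum_j nrm (h j) ^+ 2; have S0 : 0 <= S by exact: sum_sq_ge0.
suff : nn (fun i => \sum_j os_val (liftmx T g a p i j) (h j)) <= k1 * Num.sqrt S.
  rewrite nnE -(@ler_pXn2r _ 2) ?nnegrE ?sqrtr_ge0 ?mulr_ge0 ?sqrtr_ge0//.
  by rewrite exprMn !sqr_sqrtr// sum_sq_ge0.
rewrite fE; apply: le_trans (ipnD ipf _ _) _.
have -> : k1 * Num.sqrt S = (k + d) * Num.sqrt S + d * Num.sqrt S by rewrite dE; ring.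
apply: lerD.
  rewrite -/(nn _) nnE -(@ler_pXn2r _ 2) ?nnegrE ?sqrtr_ge0 ?mulr_ge0 ?sqrtr_ge0//.
  rewrite exprMn !sqr_sqrtr ?sum_sq_ge0//.
  exact: (liftmx_trunc_bound h aP (sqr_ge0 (k + d)) p2).
apply: le_trans (ipn_sum ipf _ _ _) _.
apply: (@le_trans _ _ (\sum_(t <- T) e * Num.sqrt S)); last first.
  rewrite big_const_seq count_predT iter_addr_0 -mulr_natr mulrAC.
  by rewrite ler_wpM2r ?sqrtr_ge0.
apply: ler_sum => t _; rewrite -/(nn _) nnE.
rewrite -(@ler_pXn2r _ 2) ?nnegrE ?sqrtr_ge0 ?mulr_ge0 ?sqrtr_ge0 ?(ltW e0)//.
rewrite exprMn !sqr_sqrtr ?sum_sq_ge0//.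
pose f2 i := \sum_j p i j *: (os_val (g t) (h j) - trunc N (os_val (g t) (trunc N (h j)))).
have -> : \sum_i nrm (f1 t i) ^+ 2 = \sum_i nrm (f2 i) ^+ 2.
  by rewrite [RHS](reindex (a t^-1%g))//; apply: onW_bij; exact: act_bij.
apply: le_trans (proj_contraction _ pP) _.
rewrite mulr_sumr; apply: ler_sum => j _; rewrite -exprMn.
have le1 := hN t (h j).
by rewrite !expr2; apply: ler_pM => //; exact: nrm_ge0.
Qed.

(** An isomorphism v onto a space of compact operators is applied to the finite sections,
    its inverse w to the lifted matrix. *)
Lemma lift_fin (H : hilbertType R) (X : opSpace H) (T : seq freeGroup)
    (x : freeGroup -> X) (k c eta : R) :
  uniq T -> (forall t, t \notin T -> x t = 0) ->
  0 < k -> 0 < c -> (dSK_fin X < c%:E)%E -> 0 < eta -> sec_bound x k ->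
  exists U : seq freeGroup, forall n (a : freeGroup -> 'I_n -> 'I_n),
    is_action a -> (forall w, {in U &, injective (a^~ w)}) ->
    exists p : 'I_n -> 'I_n -> R[i],
      \sum_i \sum_j nrm ((i == j)%:R - p i j) ^+ 2 <= eta * n%:R /\
      (os_mxnorm (liftmx T x a p) <= (c * k)%:E)%E.
Proof.
move=> uT x0 k0 c0 /dSK_fin_lt[X0|[G [v [w [b [d [cG vw [b0 d0 bdc] vb wd]]]]]]] eta0 xk.
  exists [::] => n a _ _; exists (fun i j => (i == j)%:R); split.
    rewrite big1 ?mulr_ge0 ?ler0n ?(ltW eta0)// => i _; rewrite big1// => j _.
    by rewrite subrr nrm0 expr0n.
  apply/os_mxnormP => [|h]; first by rewrite mulr_ge0 ?ltW.
  apply: (@le_trans _ _ 0); last by apply: mulr_ge0; [exact: sqr_ge0|exact: sum_sq_ge0].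
  rewrite big1// => i _; rewrite big1 ?nrm0 ?expr0n// => j _.
  by rewrite (X0 (_ i j)) BL0E.
pose g t := v (x t).
have gk : sec_bound g (b * k).
  move=> m s sinj; have := cbnorm_bound (ltW b0) k0 vb (xk m s sinj).
  rewrite (_ : map_mx v _ = \matrix_(i, j) g (s i * (s j)^-1)%g)//.
  by apply/matrixP => i j; rewrite !mxE.
have k1 : b * k < c * k / d.
  by rewrite ltr_pdivlMr// mulrAC ltr_pM2r.
have [|U hU] := lift_compact uT _ cG (mulr_ge0 (ltW b0) (ltW k0)) k1 eta0 gk.
  by move=> t tT; rewrite /g x0// linear0.
exists U => n a aP afree; have [p [p1 p2]] := hU n a aP afree.
exists p; split=> //.
have ck0 : 0 < c * k / d by rewrite divr_gt0// mulr_gt0.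
have := cbnorm_bound (ltW d0) ck0 wd p2.
rewrite [d * _]mulrC divfK ?gt_eqF// (_ : map_mx w _ = liftmx T x a p)//.
apply/matrixP => i j; rewrite !mxE linear_sum; apply: eq_bigr => t _.
by rewrite linearZ /g vw.
Qed.

End Lift.

(** * Finite dimensional subspaces *)

Section FiniteDimClosed.
Context {R : realType}.

Lemma nbhs_nrm (V : normedModType R[i]) (z : V) (e : R) : 0 < e ->
  nbhs z [set w | nrm (z - w) < e].
Proof.
move=> e0; apply/nbhs_ballP; exists (e%:C)%C; first by rewrite /= ltcR.
by move=> w; rewrite -ball_normE /= nrmE ltcR.
Qed.

Lemma nbhs_nrm_ex (V : normedModType R[i]) (z : V) (A : set V) :
  nbhs z A -> exists2 e : R, 0 < e & forall w, nrm (z - w) < e -> A w.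
Proof.
move=> /nbhs_ballP[e /= e0 zA]; exists (complex.Re e).
  by move: e0; rewrite ltcE /= => /andP[_].
move=> w zw; apply: zA; rewrite -ball_normE /= nrmE.
have -> : e = (complex.Re e)%:C%C by rewrite RRe_real// gtr0_real.
by rewrite ltcR.
Qed.

Definition lin_closed (V : lmodType R[i]) (M : set V) : Prop :=
  M 0 /\ forall a x y, M x -> M y -> M (a *: x + y).

Lemma lin_closedZ (V : lmodType R[i]) (M : set V) a x : lin_closed M -> M x -> M (a *: x).
Proof. by move=> [M0 M1] Mx; rewrite -[_ *: _]addr0; exact: M1. Qed.

Lemma lin_closedB (V : lmodType R[i]) (M : set V) x y : lin_closed M -> M x -> M y -> M (x - y).
Proof. by move=> [M0 M1] Mx My; rewrite addrC -scaleN1r; exact: M1. Qed.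

Definition add_line (V : lmodType R[i]) (M : set V) (v : V) : set V :=
  [set w | exists c : R[i], M (w - c *: v)].

Lemma add_line_lin (V : lmodType R[i]) (M : set V) v : lin_closed M -> lin_closed (add_line M v).
Proof.
move=> MM; split; first by exists 0; rewrite scale0r subr0; exact: MM.1.
move=> a x y [c Mx] [d My]; exists (a * c + d).
rewrite scalerDl -scalerA opprD addrACA -scalerBr.
exact: MM.2.
Qed.

(** d is the radius of a ball around v which does not meet M. *)
Lemma lin_dist (V : normedModType R[i]) (M : set V) v : lin_closed M -> closed M -> ~ M v ->
  exists2 d : R, 0 < d & forall c w, M (w - c *: v) -> nrm c * d <= nrm w.
Proof.
move=> MM cM vM.
have [|d d0 hd] := @nbhs_nrm_ex _ v (~` M); first exact: open_nbhs_nbhs (conj (closed_openC cM) vM).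
exists d => // c w Mw.
have [->|c0] := eqVneq c 0; first by rewrite nrm0 mul0r nrm_ge0.
pose m := - (c^-1 *: (w - c *: v)).
have Mm : M m by rewrite /m -scaleN1r; do 2 apply: lin_closedZ => //.
have : ~ nrm (v - m) < d by move=> /hd; exact.
move=> /negP; rewrite -leNgt => dm.
have -> : w = c *: (v - m).
  by rewrite /m opprK scalerDr scalerA mulfV// scale1r addrC subrK.
by rewrite nrmZ ler_wpM2l ?nrm_ge0.
Qed.

Lemma sub_lineB (V : lmodType R[i]) (a b : R[i]) (x y v : V) :
  x - y - (a - b) *: v = (x - a *: v) - (y - b *: v).
Proof. by rewrite scalerBl !opprB addrACA [RHS]addrACA; congr (_ + _); exact: addrC. Qed.

(** The coefficient of v is a Lipschitz function on M + C v, so it has a limit along the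
    trace of the neighbourhoods of a limit point. *)
Lemma add_line_closed (V : normedModType R[i]) (M : set V) v : lin_closed M -> closed M ->
  closed (add_line M v).
Proof.
move=> MM cM; have [Mv|Mv] := pselect (M v).
  suff -> : add_line M v = M by [].
  apply/seteqP; split=> w; last by move=> Mw; exists 0; rewrite scale0r subr0.
  move=> [c Mw]; rewrite -[w](subrK (c *: v)) addrC.
  exact: MM.2.
have [d d0 hd] := lin_dist MM cM Mv.
move=> z /= zS; pose S := add_line M v.
have /choice[c cP] : forall w, exists c, S w -> M (w - c *: v).
  by move=> w; have [[c Mw]|nS] := pselect (S w); [exists c|exists 0].
pose F := within S (nbhs z).
have FF : ProperFilter F by exact: within_nbhs_proper.
have Fz e : 0 < e -> F [set w | S w /\ nrm (z - w) < e].
  move=> e0; rewrite /F /within /=; have := nbhs_nrm z e0; apply: filterS.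
  by move=> w zw Sw.
have dist w w' : S w -> S w' -> nrm (c w - c w') * d <= nrm (w - w').
  move=> Sw Sw'; apply: hd; rewrite sub_lineB.
  by apply: lin_closedB => //; exact: cP.
have cv (f : R[i] -> R) : (forall a b, f (a - b) = f a - f b) ->
    (forall a, `|f a| <= nrm a) -> cvg ((f \o c) @ F).
  move=> fB fn; apply: R_complete; apply/cauchyP => e e0.
  have ed0 : 0 < e * d / 2 by rewrite divr_gt0// mulr_gt0.
  have [w0 [Sw0 zw0]] := filter_ex (Fz _ ed0).
  exists (f (c w0)); rewrite /nbhs /=; apply: filterS (Fz _ ed0) => w [Sw zw].
  rewrite /= -ball_normE /= -fB; apply: le_lt_trans (fn _) _.
  rewrite -(ltr_pM2r d0); apply: le_lt_trans (dist _ _ Sw0 Sw) _.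
  have -> : w0 - w = (z - w) - (z - w0) by rewrite opprB [RHS]addrC addrA subrK.
  apply: le_lt_trans (nrmD _ _) _; rewrite nrmN [e * d]splitr.
  exact: ltrD.
have ReB (a b : R[i]) : complex.Re (a - b) = complex.Re a - complex.Re b.
  by case: a b => [? ?] [? ?].
have ImB (a b : R[i]) : complex.Im (a - b) = complex.Im a - complex.Im b.
  by case: a b => [? ?] [? ?].
have Ren (a : R[i]) : `|complex.Re a| <= nrm a.
  rewrite -(@ler_pXn2r _ 2) ?nnegrE ?nrm_ge0// real_normK ?num_real// sqr_nrm.
  by rewrite lerDl sqr_ge0.
have Imn (a : R[i]) : `|complex.Im a| <= nrm a.
  rewrite -(@ler_pXn2r _ 2) ?nnegrE ?nrm_ge0// real_normK ?num_real// sqr_nrm.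
  by rewrite lerDr sqr_ge0.
have cR := cv _ ReB Ren; have cI := cv _ ImB Imn.
pose c0 : R[i] := (lim ((@complex.Re R \o c) @ F) +i* lim ((@complex.Im R \o c) @ F))%C.
exists c0; apply: cM => A /nbhs_nrm_ex[e e0 eA].
pose N := nrm v + 1; have N0 : 0 < N by rewrite ltr_wpDl ?nrm_ge0.
have [e' e'0 E] : exists2 e' : R, 0 < e' & 2 * e' * N = e / 2.
  by exists (e / 4 / N); [rewrite !divr_gt0|field; rewrite gt_eqF].
have e'2 : 0 <= 2 * e' by rewrite mulr_ge0// ltW.
have e4 : 0 < e / 4 by rewrite divr_gt0.
have hR := @cvgr_dist_lt _ _ _ F _ _ _ cR e' e'0.
have hI := @cvgr_dist_lt _ _ _ F _ _ _ cI e' e'0.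
have [w [[[Sw zw] /= wR] /= wI]] := filter_ex (filterI (filterI (Fz _ e4) (hR _)) (hI _)).
exists (w - c w *: v); split; first exact: cP.
apply: eA.
rewrite -sub_lineB.
apply: le_lt_trans (nrmD _ _) _; rewrite nrmN nrmZ.
have nc : nrm (c0 - c w) <= 2 * e'.
  rewrite -(@ler_pXn2r _ 2) ?nnegrE ?nrm_ge0//.
  rewrite sqr_nrm ReB ImB exprMn.
  have h1 : (complex.Re c0 - complex.Re (c w)) ^+ 2 <= e' ^+ 2.
    by rewrite -real_normK ?num_real// lerXn2r ?nnegrE ?(ltW e'0)// ltW.
  have h2 : (complex.Im c0 - complex.Im (c w)) ^+ 2 <= e' ^+ 2.
    by rewrite -real_normK ?num_real// lerXn2r ?nnegrE ?(ltW e'0)// ltW.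
  have := sqr_ge0 e'; lra.
have nv : nrm (c0 - c w) * nrm v <= 2 * e' * N.
  by apply: ler_pM; [exact: nrm_ge0|exact: nrm_ge0|exact: nc|rewrite lerDl].
move: nv zw; rewrite E; move: e0; set p := _ * nrm v; set q := nrm (z - w); lra.
Qed.

(** One line is added at a time, so that closedness follows by induction. *)
Fixpoint lspan (V : lmodType R[i]) (l : seq V) : set V :=
  if l is v :: l' then add_line (lspan l') v else [set 0].

Lemma lspan_lin (V : lmodType R[i]) (l : seq V) : lin_closed (lspan l).
Proof.
elim: l => [|v l IH]; last exact: add_line_lin.
by split=> // a x y -> ->; rewrite scaler0 addr0.
Qed.

Lemma lspan_closed (V : normedModType R[i]) (l : seq V) : closed (lspan l).
Proof.
elim: l => [|v l IH]; first exact/accessible_closed_set1/hausdorff_accessible/norm_hausdorff.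
by apply: add_line_closed IH; exact: lspan_lin.
Qed.

Lemma lspan_mem (V : lmodType R[i]) (l : seq V) v : v \in l -> lspan l v.
Proof.
elim: l => //= w l IH; rewrite inE => /predU1P[->|/IH vl].
  by exists 1; rewrite scale1r subrr; exact: (lspan_lin l).1.
by exists 0; rewrite scale0r subr0.
Qed.

Lemma lspan_comb (V : lmodType R[i]) (l : seq V) w : lspan l w ->
  exists c : 'I_(size l) -> R[i], w = \sum_i c i *: tnth (in_tuple l) i.
Proof.
elim: l w => [|v l IH] w /=.
  by move=> ->; exists (fun=> 0); rewrite big_ord0.
move=> [a /IH[c wE]].
exists (fun i => if unlift ord0 i is Some j then c j else a).
rewrite big_ord_recl unlift_none -[w](subrK (a *: v)) wE addrC.
congr (_ + _); apply: eq_bigr => i _; rewrite liftK.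
by rewrite !(tnth_nth 0).
Qed.

Lemma lspan_sub (V : lmodType R[i]) (l : seq V) (M : set V) : lin_closed M ->
  (forall v, v \in l -> M v) -> lspan l `<=` M.
Proof.
move=> MM; elim: l => [|v l IH] lM w /=; first by move=> ->; exact: MM.1.
move=> [c wc]; rewrite -[w](subrK (c *: v)) addrC.
apply: MM.2; first by apply: lM; rewrite mem_head.
by apply: (IH _ _ wc) => u ul; apply: lM; rewrite inE ul orbT.
Qed.

(** A finite dimensional subspace is closed, hence an operator space. If E is itself
    finite dimensional, d_SK(E) is not defined as a supremum over subspaces, and X = E is
    taken. *)
Lemma fin_subspace (H : hilbertType R) (E : opSpace H) (l : seq E) :
  exists X : opSpace H, [/\ {subset os_set X <= os_set E},
    forall x, x \in l -> os_val x \in os_set X & (dSK_fin X <= dSK E)%E].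
Proof.
have [fE|nfE] := pselect (finite_dim E).
  exists E; split=> //; first by move=> x _; exact: os_valP.
  by rewrite /dSK asboolT.
pose L := [seq os_val x | x <- l].
pose P : {pred BL H H} := [pred T | `[< lspan L T >]].
have Psub : submod_closed P.
  split=> [|a x y /asboolP Px /asboolP Py]; apply/asboolP; first exact: (lspan_lin L).1.
  exact: (lspan_lin L).2.
have Pcl : closed [set x | x \in P].
  rewrite (_ : [set x | x \in P] = lspan L); first exact: lspan_closed.
  by apply/seteqP; split=> x /asboolP.
pose X := OpSpace Psub Pcl.
have XE : {subset os_set X <= os_set E}.
  move=> T /asboolP; apply: (@lspan_sub _ _ [set T | T \in os_set E]).
    by split=> [|a x y /= xE yE]; [exact: (os_submod E).1|exact: (os_submod E).2].
  by move=> v /mapP[x _ ->]; exact: os_valP.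
have LX x : x \in l -> os_val x \in os_set X.
  by move=> xl; apply/asboolP; apply: lspan_mem; exact: map_f.
exists X; split=> //.
have fX : finite_dim X.
  have LP (i : 'I_(size L)) : tnth (in_tuple L) i \in os_set X.
    by apply/asboolP; apply: lspan_mem; exact: mem_tnth.
  exists (size L), (fun i => OsElt (LP i)) => x.
  have /asboolP/lspan_comb[c xc] := os_valP x.
  exists c; apply: val_inj => /=; rewrite xc.
  by rewrite (big_morph (@os_val _ _ X) (id1 := 0) (op1 := +%R)).
rewrite /dSK asboolF//; apply: ereal_sup_ubound.
by exists X.
Qed.

Lemma lift_os (H : hilbertType R) (E : opSpace H) (T : seq freeGroup)
    (x : freeGroup -> E) (k c eta : R) :
  uniq T -> (forall t, t \notin T -> x t = 0) ->
  0 < k -> 0 < c -> (dSK E < c%:E)%E -> 0 < eta -> sec_bound x k ->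
  exists U : seq freeGroup, forall n (a : freeGroup -> 'I_n -> 'I_n),
    is_action a -> (forall w, {in U &, injective (a^~ w)}) ->
    exists p : 'I_n -> 'I_n -> R[i],
      \sum_i \sum_j nrm ((i == j)%:R - p i j) ^+ 2 <= eta * n%:R /\
      (os_mxnorm (liftmx T x a p) <= (c * k)%:E)%E.
Proof.
move=> uT x0 k0 c0 Ec eta0 xk.
have [X [XE lX dX]] := fin_subspace [seq x t | t <- T].
have xX t : os_val (x t) \in os_set X.
  have [tT|tT] := boolP (t \in T); first by apply: lX; exact: map_f.
  by rewrite x0//; exact: (os_submod X).1.
pose x' t : X := OsElt (xX t).
have mxE' n (A : 'M[X]_n) (B : 'M[E]_n) : (forall i j, os_val (A i j) = os_val (B i j)) ->
    os_mxnorm A = os_mxnorm B.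
  by move=> AB; congr mxnorm; apply/matrixP => i j; rewrite !mxE.
have [|m s sinj|U hU] := @lift_fin R H X T x' k c eta uT _ k0 c0 (le_lt_trans dX Ec) eta0 _.
- by move=> t tT; apply: val_inj; rewrite /= x0.
- rewrite (mxE' _ _ (\matrix_(i, j) x (s i * (s j)^-1)%g)); first exact: xk.
  by move=> i j; rewrite !mxE.
exists U => n a aP afree; have [p [p1 p2]] := hU n a aP afree.
exists p; split=> //; rewrite -(mxE' _ (liftmx T x' a p))// => i j.
rewrite !mxE; apply/val_inj/funext => h.
by rewrite -[LHS]/(os_val _ h) -[RHS]/(os_val _ h) !os_val_sum.
Qed.

End FiniteDimClosed.

(** * The inequality for bounded finite sections *)

Section Core.
Context {R : realType}.
Local Notation pdot n := (@fdot R ('I_n * 'I_n)%type).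

(** If p and q are close to 1 in the normalized Hilbert-Schmidt norm, then pi(s) p
    and pi(t) q have almost the same trace pairing as pi(s) and pi(t), which is 1 or 0. *)
Lemma almost_orthogonal n (a : freeGroup -> 'I_n -> 'I_n) (p q : 'I_n -> 'I_n -> R[i])
    (s t : freeGroup) (th : R) :
  is_action a -> (0 < n)%N -> 0 < th -> th <= 1 ->
  (forall w, a s^-1%g w = a t^-1%g w -> s = t) ->
  \sum_i \sum_j nrm ((i == j)%:R - p i j) ^+ 2 <= th ^+ 2 * n%:R ->
  \sum_i \sum_j nrm ((i == j)%:R - q i j) ^+ 2 <= th ^+ 2 * n%:R ->
  nrm (n%:R^-1 * \sum_i \sum_j p (a s^-1%g i) j * q (a t^-1%g i) j - (s == t)%:R)
    <= 3 * th.
Proof.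
move=> aP n0 th0 th1 afree hp hq.
have nR : 0 < n%:R :> R by rewrite ltr0n.
have ipf := @fdot_ip R ('I_n * 'I_n)%type.
pose A g : 'I_n * 'I_n -> R[i]^o := fun ij => (a g^-1%g ij.1 == ij.2)%:R.
pose P : 'I_n * 'I_n -> R[i]^o :=
  fun ij => (a s^-1%g ij.1 == ij.2)%:R - p (a s^-1%g ij.1) ij.2.
pose Q : 'I_n * 'I_n -> R[i]^o :=
  fun ij => ((a t^-1%g ij.1 == ij.2)%:R - q (a t^-1%g ij.1) ij.2)^*.
have A2 g : ipn (pdot n) (A g) = Num.sqrt n%:R.
  rewrite /ipn ipsq_fdot sum_pair; congr Num.sqrt.
  rewrite -[in RHS](card_ord n) -sumr_const; apply: eq_bigr => i _.
  rewrite (bigD1 (a g^-1%g i))//= big1 ?addr0 => [|j ji].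
    by rewrite /A /= eqxx nrm1 expr1n.
  by rewrite /A /= eq_sym (negPf ji) nrm0 expr0n.
have reidx g (F : 'I_n -> R) : \sum_i F (a g i) = \sum_i F i.
  by rewrite [RHS](reindex (a g))//; apply: onW_bij; exact: act_bij.
have P2 : ipn (pdot n) P <= th * Num.sqrt n%:R.
  rewrite -(@ler_pXn2r _ 2) ?nnegrE ?ipn_ge0 ?mulr_ge0 ?sqrtr_ge0 ?(ltW th0)//.
  rewrite (ipn_sq ipf) exprMn sqr_sqrtr ?ler0n// ipsq_fdot sum_pair.
  by rewrite (reidx s^-1%g (fun i => \sum_j nrm ((i == j)%:R - p i j) ^+ 2)).
have Q2 : ipn (pdot n) Q <= th * Num.sqrt n%:R.
  rewrite -(@ler_pXn2r _ 2) ?nnegrE ?ipn_ge0 ?mulr_ge0 ?sqrtr_ge0 ?(ltW th0)//.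
  rewrite (ipn_sq ipf) exprMn sqr_sqrtr ?ler0n// ipsq_fdot sum_pair.
  under eq_bigr do under eq_bigr do rewrite nrm_conj.
  by rewrite (reidx t^-1%g (fun i => \sum_j nrm ((i == j)%:R - q i j) ^+ 2)).
have AA : (pdot n) (A s) (A t) = (s == t)%:R * n%:R.
  rewrite /fdot sum_pair.
  have -> : (s == t)%:R * n%:R = \sum_(i < n) (s == t)%:R :> R[i].
    by rewrite sumr_const card_ord mulr_natr.
  apply: eq_bigr => i _; rewrite (bigD1 (a s^-1%g i))//= big1 ?addr0 => [|j ji].
    rewrite /A /= eqxx mul1r rmorph_nat; congr (nat_of_bool _)%:R.
    by apply/eqP/eqP => [/esym/afree|->].
  by rewrite /A /= eq_sym (negPf ji) mul0r.
have E : \sum_i \sum_j p (a s^-1%g i) j * q (a t^-1%g i) j = (pdot n) (A s - P) (A t - Q).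
  rewrite /fdot sum_pair; apply: eq_bigr => i _; apply: eq_bigr => j _.
  rewrite -[(A s - P) _]/(A s (i, j) - P (i, j)) -[(A t - Q) _]/(A t (i, j) - Q (i, j)).
  by rewrite /A /P /Q /= rmorphB /= conjCK rmorph_nat !subKr.
have -> : n%:R^-1 * \sum_i \sum_j p (a s^-1%g i) j * q (a t^-1%g i) j - (s == t)%:R =
    n%:R^-1 * ((pdot n) P Q - (pdot n) (A s) Q - (pdot n) P (A t)).
  rewrite E (ipBl ipf) !(ipBr ipf) AA.
  have n0' : n%:R != 0 :> R[i] by rewrite pnatr_eq0 -lt0n.
  by field.
have -> : 3 * th = n%:R^-1 * (3 * th * n%:R) by rewrite mulrCA mulVf ?mulr1// gt_eqF.
rewrite nrmM; have -> : nrm (n%:R^-1 : R[i]) = n%:R^-1.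
  have -> : n%:R^-1 = (n%:R^-1)%:C%C :> R[i] by rewrite fmorphV rmorph_nat.
  by rewrite nrmR ger0_norm// invr_ge0 ler0n.
rewrite ler_wpM2l ?invr_ge0 ?ler0n//.
set r := Num.sqrt n%:R in A2 P2 Q2.
have rr : r * r = n%:R by rewrite -expr2 sqr_sqrtr ?ler0n.
have r0 : 0 <= r by exact: sqrtr_ge0.
have h1 : nrm ((pdot n) P Q) <= th * n%:R.
  apply: le_trans (ip_cs ipf _ _) _; rewrite -rr.
  apply: le_trans (ler_pM (ipn_ge0 _) (ipn_ge0 _) P2 Q2) _.
  rewrite mulrACA [leRHS](_ : _ = th * 1 * (r * r)); last by rewrite mulr1.
  by rewrite ler_wpM2r ?mulr_ge0// ler_wpM2l// ltW.
have h2 : nrm ((pdot n) (A s) Q) <= th * n%:R.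
  apply: le_trans (ip_cs ipf _ _) _; rewrite A2 -rr mulrCA.
  by rewrite ler_wpM2l.
have h3 : nrm ((pdot n) P (A t)) <= th * n%:R.
  apply: le_trans (ip_cs ipf _ _) _; rewrite A2 -rr mulrA.
  by rewrite ler_wpM2r.
apply: le_trans (nrmD _ _) _; rewrite nrmN.
apply: le_trans (lerD (nrmD _ _) (lexx _)) _; rewrite nrmN.
lra.
Qed.

Lemma sum_delta_seq (V : nmodType) (T : eqType) (l : seq T) (F : T -> V) s :
  uniq l -> s \in l -> \sum_(t <- l) F t *+ (s == t) = F s.
Proof.
move=> ul sl; rewrite (bigD1_seq s)//= eqxx mulr1n big1 ?addr0// => t ts.
by rewrite eq_sym (negPf ts) mulr0n.
Qed.

(** The tracial form at the two lifted matrices is the sum of the u(x_s)(y_t), with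
    the coefficients of [almost_orthogonal]; so it is close to the diagonal sum. *)
Lemma exact_bilinear_bound (H K : hilbertType R) (E : opSpace H) (F : opSpace K)
    (u : {linear E -> os_dual F}) (T : seq freeGroup) (x : freeGroup -> E)
    (y : freeGroup -> F) (kx ky cE cF b : R) :
  uniq T -> (forall t, t \notin T -> x t = 0) -> (forall t, t \notin T -> y t = 0) ->
  0 < kx -> 0 < ky -> 0 < cE -> 0 < cF -> (dSK E < cE%:E)%E -> (dSK F < cF%:E)%E ->
  (tbnorm u <= b%:E)%E -> sec_bound x kx -> sec_bound y ky ->
  nrm (\sum_(t <- T) u (x t) (y t)) <= b * (cE * kx) * (cF * ky).
Proof.
move=> uT x0 y0 kx0 ky0 cE0 cF0 dE dF ub hx hy; apply/ler_addgt0Pr => e e0.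
pose S := \sum_(s <- T) \sum_(t <- T) nrm (u (x s) (y t)) + 1.
have S0 : 0 < S.
  by rewrite ltr_wpDl// sumr_ge0// => s _; rewrite sumr_ge0// => t _; exact: nrm_ge0.
(* each coefficient is off by at most 3 th, and S bounds the sum of their weights *)
pose th := Num.min 1 (e / (3 * S)).
have th0 : 0 < th by rewrite lt_min ltr01/= divr_gt0// mulr_gt0.
have th1 : th <= 1 by rewrite ge_min lexx.
have thS : 3 * th * S <= e.
  have : th <= e / (3 * S) by rewrite ge_min lexx orbT.
  by rewrite ler_pdivlMr ?mulr_gt0// mulrCA mulrA.
have th2 : 0 < th ^+ 2 by exact: exprn_gt0.
have [U1 hU1] := lift_os uT x0 kx0 cE0 dE th2 hx.
have [U2 hU2] := lift_os uT y0 ky0 cF0 dF th2 hy.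
have [n [a [n0 aP afree]]] :=
  free_finite_action (U1 ++ U2 ++ [seq t^-1%g | t <- T]).
have [|p [p1 p2]] := hU1 n a aP _.
  by move=> w g h gU hU; apply: afree; rewrite mem_cat ?gU ?hU.
have [|q [q1 q2]] := hU2 n a aP _.
  by move=> w g h gU hU; apply: afree; rewrite !mem_cat ?gU ?hU orbT.
pose c s t := n%:R^-1 * \sum_i \sum_j p (a s^-1%g i) j * q (a t^-1%g i) j.
have hc s t : s \in T -> t \in T -> nrm (c s t - (s == t)%:R) <= 3 * th.
  move=> sT tT; apply: (@almost_orthogonal n a p q s t th) => // w /afree h; apply: invg_inj.
  by apply: h; rewrite !mem_cat map_f ?orbT.
have tbE : tb_form u (liftmx T x a p) (liftmx T y a q) =
    \sum_(s <- T) \sum_(t <- T) c s t * u (x s) (y t).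
  rewrite /tb_form mulr_sumr.
  under [RHS]eq_bigr do under eq_bigr do rewrite -mulrA mulr_suml mulr_sumr.
  under [RHS]eq_bigr do rewrite exchange_big /=.
  rewrite [RHS]exchange_big /=; apply: eq_bigr => i _.
  rewrite mulr_sumr.
  under [RHS]eq_bigr do under eq_bigr do rewrite mulr_suml mulr_sumr.
  under [RHS]eq_bigr do rewrite exchange_big /=.
  rewrite [RHS]exchange_big /=; apply: eq_bigr => j _.
  rewrite !mxE dual_suml mulr_sumr; apply: eq_bigr => s _.
  rewrite dualZl dual_sumr !mulr_sumr; apply: eq_bigr => t _.
  by rewrite dualZr; ring.
have := tbnorm_bound n0 (mulr_gt0 cE0 kx0) (mulr_gt0 cF0 ky0) ub p2 q2.
rewrite tbE => tb.
have -> : \sum_(t <- T) u (x t) (y t) =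
    \sum_(s <- T) \sum_(t <- T) c s t * u (x s) (y t) -
    \sum_(s <- T) \sum_(t <- T) (c s t - (s == t)%:R) * u (x s) (y t).
  rewrite -sumrB big_seq [RHS]big_seq; apply: eq_bigr => s sT.
  rewrite -sumrB -[LHS](sum_delta_seq (fun t => u (x s) (y t)) uT sT).
  by apply: eq_bigr => t _; rewrite -mulrBl subKr mulr_natl.
apply: le_trans (nrmD _ _) _; rewrite nrmN; apply: lerD => //.
apply: le_trans thS.
apply: (@le_trans _ _ (3 * th * \sum_(s <- T) \sum_(t <- T) nrm (u (x s) (y t)))); last first.
  by rewrite ler_wpM2l ?mulr_ge0 ?(ltW th0)// lerDl.
apply: le_trans (nrm_sum _ _ _) _.
rewrite mulr_sumr big_seq [leRHS]big_seq; apply: ler_sum => s sT.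
apply: le_trans (nrm_sum _ _ _) _.
rewrite mulr_sumr big_seq [leRHS]big_seq; apply: ler_sum => t tT.
by rewrite nrmM ler_wpM2r ?nrm_ge0// hc.
Qed.

End Core.

(** * Finite sections and the reduced tensor norm *)

Section EReal.
Context {R : realType}.

Lemma le_mul_lim (X A d : R) : 0 <= A ->
  (forall e, 0 < e -> X <= A * (d + e)) -> X <= A * d.
Proof.
move=> A0 h; apply/ler_addgt0Pr => e e0.
have A1 : 0 < A + 1 by rewrite ltr_wpDl.
apply: le_trans (h (e / (A + 1)) (divr_gt0 e0 A1)) _.
rewrite mulrDr lerD2l mulrCA ler_piMr ?(ltW e0)//.
by rewrite ler_pdivrMr// mul1r lerDl.
Qed.

Lemma dSK_fin_ge0 (H : hilbertType R) (E : opSpace H) : (0 <= dSK_fin E)%E.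
Proof.
apply: le_ereal_inf_tmp => _ [G [_ ->]].
apply: le_ereal_inf_tmp => _ [v [w [_ _ ->]]].
by rewrite mule_ge0// cbnorm_ge0.
Qed.

Lemma dSK_ge0 (H : hilbertType R) (E : opSpace H) : (0 <= dSK E)%E.
Proof.
have [X [_ _ h]] := fin_subspace (E := E) [::].
exact: le_trans (dSK_fin_ge0 X) h.
Qed.

Lemma tbnorm_ge0 (H K : hilbertType R) (E : opSpace H) (F : opSpace K)
  (u : {linear E -> os_dual F}) : (0 <= tbnorm u)%E.
Proof.
apply: (@le_trans _ _ (nrm (tb_form u (\matrix_(i < 1, j < 1) (0 : E)) (\matrix_(i < 1, j < 1) (0 : F))))%:E).
  by rewrite lee_fin nrm_ge0.
apply: ereal_sup_ubound; exists 1%N, (\matrix_(i, j) 0), (\matrix_(i, j) 0); split=> //.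
  by apply/(mx11_bound _ ler01); rewrite nrm0.
by apply/(mx11_bound _ ler01); rewrite nrm0.
Qed.

Lemma ge0_fin_ex (a : \bar R) : (0 <= a)%E -> (a < +oo)%E -> exists2 r : R, 0 <= r & a = r%:E.
Proof. by case: a => [r| |]//; rewrite lee_fin => r0 _; exists r. Qed.

(** The infima in d_SK need not be attained: let the strict bounds tend to
    them, one factor after the other. *)
Lemma exact_bilinear_ebound (H K : hilbertType R) (E : opSpace H) (F : opSpace K)
    (u : {linear E -> os_dual F}) (T : seq freeGroup) (x : freeGroup -> E)
    (y : freeGroup -> F) (kx ky : R) :
  exact_os E -> exact_os F -> tracially_bounded u ->
  uniq T -> (forall t, t \notin T -> x t = 0) -> (forall t, t \notin T -> y t = 0) ->
  0 <= kx -> 0 <= ky -> sec_bound x kx -> sec_bound y ky ->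
  ((nrm (\sum_(t <- T) u (x t) (y t)))%:E <=
    dSK E * dSK F * tbnorm u * kx%:E * ky%:E)%E.
Proof.
move=> eE eF eu uT x0 y0 kx0 ky0 hx hy.
have [dE dE0 dEE] := ge0_fin_ex (dSK_ge0 E) eE.
have [dF dF0 dFE] := ge0_fin_ex (dSK_ge0 F) eF.
have [b b0 bE] := ge0_fin_ex (tbnorm_ge0 u) eu.
rewrite dEE dFE bE -!EFinM lee_fin.
have sec_mono (L : hilbertType R) (G : opSpace L) (z : freeGroup -> G) (k e : R) :
    sec_bound z k -> 0 < e -> sec_bound z (k + e).
  by move=> zk e0 m s sinj; apply: le_trans (zk m s sinj) _; rewrite lee_fin lerDl ltW.
have key e1 e2 e3 e4 : 0 < e1 -> 0 < e2 -> 0 < e3 -> 0 < e4 ->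
    nrm (\sum_(t <- T) u (x t) (y t)) <=
      b * ((dE + e1) * (kx + e2)) * ((dF + e3) * (ky + e4)).
  move=> h1 h2 h3 h4; apply: exact_bilinear_bound => //; rewrite ?ltr_wpDl//.
  - by rewrite dEE lte_fin ltrDl.
  - by rewrite dFE lte_fin ltrDl.
  - by rewrite bE.
  - exact: sec_mono.
  - exact: sec_mono.
have p0 (d e : R) : 0 <= d -> 0 < e -> 0 <= d + e by move=> d0 e0; rewrite addr_ge0// ltW.
have -> : dE * dF * b * kx * ky = b * dE * dF * kx * ky by ring.
apply: le_mul_lim => [|e4 h4]; first by rewrite !mulr_ge0.
rewrite mulrAC; apply: le_mul_lim => [|e2 h2]; first by rewrite !mulr_ge0// p0.
rewrite mulrAC [X in _ <= X * _]mulrAC; apply: (@le_trans _ _ (b * dE * (ky + e4) * (kx + e2) * dF)); last first.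
  by rewrite le_eqVlt; apply/orP; left; apply/eqP; ring.
apply: le_mul_lim => [|e3 h3]; first by rewrite !mulr_ge0// p0.
apply: (@le_trans _ _ (b * (ky + e4) * (kx + e2) * (dF + e3) * dE)); last first.
  by rewrite le_eqVlt; apply/orP; left; apply/eqP; ring.
apply: le_mul_lim => [|e1 h1]; first by rewrite !mulr_ge0// p0.
apply: le_trans (key e1 e2 e3 e4 h1 h2 h3 h4) _.
by rewrite le_eqVlt; apply/orP; left; apply/eqP; ring.
Qed.

End EReal.

Section LregBound.
Context {R : realType}.
Local Notation dl := (@ell2_delta R freeGroup).

Lemma lreg_delta (t g : freeGroup) : lreg R t (dl g) = dl (t * g)%g.
Proof.
apply/val_inj/funext => s /=; congr (nat_of_bool _)%:R.
by apply/eqP/eqP => [<-|->]; rewrite ?mulVKg ?mulKg.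
Qed.

Lemma hdot_delta2 (g h : freeGroup) : hdot (dl g) (dl h) = (h == g)%:R.
Proof. by rewrite hdot_ell2_delta. Qed.

Lemma sum_eq_seq (L : seq freeGroup) (a b : freeGroup) : uniq L -> a \in L ->
  \sum_(g <- L) ((a == g)%:R * (b == g)%:R) = (b == a)%:R :> R[i].
Proof.
move=> uL aL; rewrite (bigD1_seq a)//= eqxx mul1r big1 ?addr0// => g ga.
by rewrite eq_sym (negPf ga) mul0r.
Qed.

(** Vectors delta_g (x) k with different g are orthogonal, so the squared norm of a sum
    is computed by grouping the terms according to g. *)
Lemma tensor_norm_delta (H : hilbertType R) (r : seq (freeGroup * H)) (L : seq freeGroup) :
  uniq L -> (forall q, q \in r -> q.1 \in L) ->
  complex.Re (\sum_(p <- [seq (dl q.1, q.2) | q <- r]) \sum_(q <- [seq (dl q.1, q.2) | q <- r])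
     hdot p.1 q.1 * hdot p.2 q.2) =
  \sum_(g <- L) nrm (\sum_(q <- r) (q.1 == g)%:R *: q.2) ^+ 2.
Proof.
move=> uL rL; rewrite big_map.
under [RHS]eq_bigr do rewrite nrm_sq_Re; rewrite -Re_sum; congr complex.Re.
under [RHS]eq_bigr do rewrite hdot_suml.
rewrite [RHS]exchange_big /= big_seq [RHS]big_seq; apply: eq_bigr => p pr.
rewrite big_map.
under [RHS]eq_bigr do rewrite hdot_sumr.
rewrite [RHS]exchange_big /=; apply: eq_bigr => q _.
under eq_bigr do rewrite hdotZl hdotZr rmorph_nat mulrA.
by rewrite -mulr_suml sum_eq_seq ?rL// hdot_delta2.
Qed.

Lemma minnorm_ge0 (K H : hilbertType R) (s : seq (BL K K * BL H H)) : (0 <= minnorm s)%E.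
Proof.
have t0 (K' H' : hilbertType R) : tensor_norm ([::] : seq (K' * H')) = 0.
  by rewrite /tensor_norm big_nil sqrtr0.
apply: ereal_sup_ubound; exists [::]; first by rewrite /= t0.
by rewrite /tensor_app; elim: s => [|p s IH]; rewrite /= ?t0.
Qed.

(** Test the tensor norm on the sum of the delta_(g_j) (x) h_j: the components of the
    image over the g_i are those of the finite section. *)
Lemma lreg_sec_bound (H : hilbertType R) (E : opSpace H) (s : seq (freeGroup * E))
    (x : freeGroup -> E) (k : R) :
  (forall t, x t = \sum_(p <- s | p.1 == t) p.2) -> 0 <= k ->
  (lreg_norm s <= k%:E)%E -> sec_bound x k.
Proof.
move=> xE k0 sk m g ginj; apply/(os_mxnormP _ k0) => h.
have S0 := sum_sq_ge0 h; set S := \sum_j nrm (h j) ^+ 2 in S0 *.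
have [Sz|Sn] := eqVneq S 0.
  rewrite Sz mulr0 big1// => i _; rewrite big1 ?nrm0 ?expr0n// => j _.
  by rewrite (sum_sq_eq0 Sz) linear0.
have Sp : 0 < S by rewrite lt_neqAle eq_sym Sn.
pose a := ((Num.sqrt S)^-1)%:C%C.
have a2 : nrm a ^+ 2 = S^-1.
  by rewrite nrmR ger0_norm ?invr_ge0 ?sqrtr_ge0// exprVn sqr_sqrtr.
pose r0 := [seq (g j, a *: h j) | j <- index_enum 'I_m].
pose z := [seq (dl q.1, q.2) | q <- r0].
have z1 : tensor_norm z <= 1.
  rewrite /tensor_norm (@tensor_norm_delta _ r0 (map g (index_enum 'I_m))).
  - rewrite big_map; under eq_bigr => i _.
      rewrite big_map (bigD1 i)//= eqxx scale1r big1 ?addr0 => [|j ji]; last first.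
        by rewrite (inj_eq ginj) (negPf ji) scale0r.
      rewrite nrmZ exprMn a2; over.
    by rewrite -mulr_sumr mulVf// sqrtr1.
  - by rewrite map_inj_uniq// index_enum_uniq.
  - by move=> q /mapP[j jm ->]; exact: map_f.
pose r1 := [seq ((p.1 * q.1)%g, os_val p.2 q.2) | p <- s, q <- r0].
have appE : tensor_app [seq (lreg R p.1, os_val p.2) | p <- s] z =
    [seq (dl q.1, q.2) | q <- r1].
  rewrite /tensor_app /r1 map_allpairs /z allpairs_mapl allpairs_mapr.
  by apply: eq_allpairs => p q; congr (_, _); exact: lreg_delta.
have : ((tensor_norm [seq (dl q.1, q.2) | q <- r1])%:E <= k%:E)%E.
  by rewrite -appE; apply: le_trans sk; apply: ereal_sup_ubound; exists z.
rewrite lee_fin -(@ler_pXn2r _ 2) ?nnegrE ?sqrtr_ge0//.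
pose L := undup (map fst r1 ++ map g (index_enum 'I_m)).
have gL : {subset map g (index_enum 'I_m) <= L}.
  by move=> t tg; rewrite mem_undup mem_cat tg orbT.
rewrite /tensor_norm (@tensor_norm_delta _ r1 L); first last.
- by move=> q qr; rewrite mem_undup mem_cat map_f.
- exact: undup_uniq.
rewrite sqr_sqrtr; last by apply: sumr_ge0 => t _; exact: sqr_ge0.
move=> hk; rewrite mulrC -ler_pdivrMl//; apply: le_trans hk.
pose Kv t := nrm (\sum_(q <- r1) (q.1 == t)%:R *: q.2) ^+ 2.
apply: (@le_trans _ _ (\sum_(t <- map g (index_enum 'I_m)) Kv t)); last first.
  rewrite [leRHS](bigID (mem (map g (index_enum 'I_m)))) /=.
  rewrite -[X in _ <= X + _]big_filter.
  rewrite (perm_big [seq t <- L | t \in map g (index_enum 'I_m)]) /=.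
    by rewrite lerDl sumr_ge0// => t _; exact: sqr_ge0.
  apply: uniq_perm; rewrite ?filter_uniq ?undup_uniq ?map_inj_uniq ?index_enum_uniq//.
  move=> t; rewrite mem_filter; case: (boolP (t \in map _ _)) => //= tg.
  by rewrite gL.
rewrite big_map mulr_sumr le_eqVlt; apply/orP; left; apply/eqP; apply: eq_bigr => i _.
rewrite /Kv -a2 -exprMn -nrmZ; congr (nrm _ ^+ 2).
rewrite /r1 big_allpairs_dep /= scaler_sumr.
under [RHS]eq_bigr do rewrite big_map.
rewrite [RHS]exchange_big /=; apply: eq_bigr => j _.
rewrite mxE xE os_val_sum scaler_sumr big_mkcond /=; apply: eq_bigr => p _.
rewrite linearZ.
have -> : ((p.1 * g j)%g == g i) = (p.1 == (g i * (g j)^-1)%g).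
  by apply/eqP/eqP => [<-|->]; rewrite ?mulgK ?mulgVK.
by case: eqP; rewrite ?scale1r ?scale0r.
Qed.

(** A finite bound that is always there; it settles the products in which one factor
    might be infinite and the other one 0. *)
Lemma finite_sec_bound (H : hilbertType R) (E : opSpace H) (T : seq freeGroup)
    (x : freeGroup -> E) : uniq T -> (forall t, t \notin T -> x t = 0) ->
  exists2 k : R, 0 <= k & sec_bound x k.
Proof.
move=> uT x0; pose k := \sum_(t <- T) nrm (x t).
have k0 : 0 <= k by apply: sumr_ge0 => t _; exact: nrm_ge0.
exists k => // m g ginj; apply/(os_mxnormP _ k0) => h.
have ipf := @hsdot_ip R H 'I_m.
pose f t i := \sum_j (g i * (g j)^-1 == t)%g%:R *: os_val (x t) (h j).
have fE : (fun i => \sum_j os_val ((\matrix_(i, j) x (g i * (g j)^-1)%g) i j) (h j)) =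
    \sum_(t <- T) f t.
  apply/funext => i; have -> : (\sum_(t <- T) f t) i = \sum_(t <- T) f t i.
    by elim/big_rec2 : _ => // t y1 y2 _ <-.
  rewrite [RHS]exchange_big; apply: eq_bigr => j _; rewrite mxE.
  have [tT|tT] := boolP ((g i * (g j)^-1)%g \in T).
    rewrite (bigD1_seq _ tT uT) /= eqxx scale1r big1 ?addr0// => t tg.
    by rewrite eq_sym (negPf tg) scale0r.
  rewrite x0// BL0E big_seq big1// => t tT'.
  by case: eqP => [E'|_]; [move: tT; rewrite E' tT'|rewrite scale0r].
pose S := \sum_j nrm (h j) ^+ 2; have S0 : 0 <= S by exact: sum_sq_ge0.
pose nn := ipn (@hsdot R H 'I_m).
have nnE v : nn v = Num.sqrt (\sum_i nrm (v i) ^+ 2) by rewrite /nn /ipn ipsq_hsdot.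
suff : nn (\sum_(t <- T) f t) <= k * Num.sqrt S.
  rewrite -fE nnE -(@ler_pXn2r _ 2) ?nnegrE ?sqrtr_ge0 ?mulr_ge0 ?sqrtr_ge0//.
  by rewrite exprMn !sqr_sqrtr// sum_sq_ge0.
apply: le_trans (ipn_sum ipf _ _ _) _; rewrite /k mulr_suml; apply: ler_sum => t _.
rewrite -/(nn _) nnE -(@ler_pXn2r _ 2) ?nnegrE ?sqrtr_ge0 ?mulr_ge0 ?sqrtr_ge0 ?nrm_ge0//.
rewrite exprMn !sqr_sqrtr ?sum_sq_ge0// mulr_sumr.
have -> : \sum_i nrm (f t i) ^+ 2 =
    \sum_i \sum_j (g i * (g j)^-1 == t)%g%:R * nrm (os_val (x t) (h j)) ^+ 2.
  apply: eq_bigr => i _.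
  have [j0 /eqP j0t|nj] := pickP (fun j => (g i * (g j)^-1 == t)%g).
    have other j : j != j0 -> ((g i * (g j)^-1 == t)%g) = false.
      move=> jj; apply: contraNF jj => /eqP jt; apply/eqP/ginj/invg_inj.
      by apply: (@mulgI _ (g i)); rewrite jt.
    rewrite /f (bigD1 j0)//= [in RHS](bigD1 j0)//= j0t eqxx scale1r mul1r.
    by rewrite !big1 ?addr0// => j /other ->; rewrite ?scale0r ?mul0r.
  rewrite /f !big1 ?nrm0 ?expr0n//= => j _; rewrite nj ?scale0r ?mul0r//.
rewrite exchange_big /=; apply: ler_sum => j _; rewrite -mulr_suml.
apply: (@le_trans _ _ (1 * nrm (os_val (x t) (h j)) ^+ 2)).
  rewrite ler_wpM2r ?sqr_ge0//.
  have [i0 /eqP i0t|nj] := pickP (fun i => (g i * (g j)^-1 == t)%g).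
    rewrite (bigD1 i0)//= i0t eqxx big1 ?addr0// => i ii.
    rewrite (_ : (_ == t) = false)//; apply: contraNF ii => /eqP it.
    by apply/eqP/ginj; apply: (@mulIg _ (g j)^-1%g); rewrite it.
  by rewrite big1// => i _; rewrite nj.
rewrite mul1r -exprMn.
by rewrite lerXn2r ?nnegrE ?mulr_ge0 ?nrm_ge0// nrm_opnorm.
Qed.

Lemma lreg_sec_bound_ex (H : hilbertType R) (E : opSpace H) (s : seq (freeGroup * E))
    (x : freeGroup -> E) (T : seq freeGroup) :
  uniq T -> (forall t, t \notin T -> x t = 0) ->
  (forall t, x t = \sum_(p <- s | p.1 == t) p.2) ->
  exists k : R, [/\ 0 <= k, (k%:E <= lreg_norm s)%E & sec_bound x k].
Proof.
move=> uT x0 xE; have := minnorm_ge0 [seq (lreg R p.1, os_val p.2) | p <- s].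
rewrite -/(lreg_norm s); case E': (lreg_norm s) => [r| |]//.
  rewrite lee_fin => r0; exists r; split=> //.
  by apply: lreg_sec_bound xE r0 _; rewrite E'.
move=> _; have [k k0 hk] := finite_sec_bound uT x0.
by exists k; split=> //; rewrite leey.
Qed.

Lemma exact_lreg_bound (H K : hilbertType R) (E : opSpace H) (F : opSpace K)
    (u : {linear E -> os_dual F}) (T : seq freeGroup) (x : freeGroup -> E)
    (y : freeGroup -> F) (s : seq (freeGroup * E)) (s' : seq (freeGroup * F)) :
  exact_os E -> exact_os F -> tracially_bounded u ->
  uniq T -> (forall t, t \notin T -> x t = 0) -> (forall t, t \notin T -> y t = 0) ->
  (forall t, x t = \sum_(p <- s | p.1 == t) p.2) ->
  (forall t, y t = \sum_(p <- s' | p.1 == t) p.2) ->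
  ((nrm (\sum_(t <- T) u (x t) (y t)))%:E <=
    dSK E * dSK F * tbnorm u * lreg_norm s * lreg_norm s')%E.
Proof.
move=> eE eF eu uT x0 y0 xs ys.
have [kx [kx0 kxl hx]] := lreg_sec_bound_ex uT x0 xs.
have [ky [ky0 kyl hy]] := lreg_sec_bound_ex uT y0 ys.
apply: le_trans (exact_bilinear_ebound eE eF eu uT x0 y0 kx0 ky0 hx hy) _.
have A0 : (0 <= dSK E * dSK F * tbnorm u)%E.
  by rewrite !mule_ge0 ?dSK_ge0 ?tbnorm_ge0.
apply: lee_pmul => //; first by rewrite mule_ge0.
by apply: lee_wpmul2l.
Qed.

End LregBound.

(** * Finite sections and the row and column norms *)

Section RowColumn.
Context {R : realType}.

Lemma nrm_sum_unique (V : normedModType R[i]) (I : finType) (P : pred I) (v : I -> V) :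
  (forall i j, P i -> P j -> i = j) ->
  nrm (\sum_(i | P i) v i) ^+ 2 = \sum_(i | P i) nrm (v i) ^+ 2.
Proof.
move=> uP; have [i Pi|P0] := pickP P; last first.
  by rewrite !big_pred0 ?nrm0 ?expr0n.
have PE : P =1 pred1 i.
  by move=> j; apply/idP/eqP => [Pj|->//]; exact: uP.
by rewrite !(eq_bigl _ _ PE) !big_pred1_eq.
Qed.

Lemma sum_unique_le (I : finType) (P : pred I) (c : R) : 0 <= c ->
  (forall i j, P i -> P j -> i = j) -> \sum_(i | P i) c <= c.
Proof.
move=> c0 uP; have [i Pi|P0] := pickP P; last by rewrite big_pred0.
have PE : P =1 pred1 i.
  by move=> j; apply/idP/eqP => [Pj|->//]; exact: uP.
by rewrite (eq_bigl _ _ PE) big_pred1_eq.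
Qed.

Definition col_bd (H : hilbertType R) (I : finType) (a : I -> BL H H) (r : R) :=
  forall h, \sum_i nrm (a i h) ^+ 2 <= r * nrm h ^+ 2.

(** |w|^2 = sum_i <v_i, b_i w> for the vector w in question. *)
Lemma row_bound (H : hilbertType R) (I : finType) (a b : I -> BL H H) (r : R) (v : I -> H) :
  (forall i, is_adjoint (a i) (b i)) -> 0 <= r -> col_bd b r ->
  nrm (\sum_i a i (v i)) ^+ 2 <= r * \sum_i nrm (v i) ^+ 2.
Proof.
move=> ab r0 br; set w := \sum_i _.
have ipf := @hsdot_ip R H I.
have S0 : 0 <= \sum_i nrm (v i) ^+ 2 by apply: sumr_ge0 => i _; exact: sqr_ge0.
have [->|w0] := eqVneq (nrm w) 0; first by rewrite expr0n mulr_ge0.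
have wp : 0 < nrm w ^+ 2 by rewrite exprn_gt0// lt_neqAle eq_sym w0 nrm_ge0.
have E : hdot w w = hsdot v (fun i => b i w).
  by rewrite {1}/w hdot_suml; apply: eq_bigr => i _; exact: ab.
rewrite -(ler_pM2r wp) -expr2.
have -> : (nrm w ^+ 2) ^+ 2 = nrm (hsdot v (fun i => b i w)) ^+ 2.
  by rewrite -E -nrm_sq_hdot nrmR ger0_norm ?sqr_ge0.
apply: le_trans (ip_cs_sq ipf _ _) _; rewrite !ipsq_hsdot.
by rewrite [leRHS](_ : _ = (\sum_i nrm (v i) ^+ 2) * (r * nrm w ^+ 2));
  [rewrite ler_wpM2l|rewrite mulrAC mulrC].
Qed.

Definition starts (k : nat) (g : freeGroup) : bool :=
  if fg_word g is l :: _ then l == (k, true) else false.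

Lemma starts_uniq k k' g : starts k g -> starts k' g -> k = k'.
Proof. by rewrite /starts; case: (fg_word g) => // l w /eqP -> /eqP []. Qed.

Lemma not_starts_mul k g : ~~ starts k (fgen k * g)%g ->
  exists w, fg_word g = (k, false) :: w.
Proof.
rewrite /starts /=; case: (fg_word g) => [|l w] /=; first by rewrite eqxx.
by case: ifPn => [/eqP -> _|_]; [exists w|rewrite /= eqxx].
Qed.

(** A product g_k g either starts with g_k, or cancels the first letter of g. In the
    first case k is a function of the product, in the second one of g: the sum of the first
    terms is bounded as a column, that of the others as a row. *)
Lemma row_col_sec_bound (H : hilbertType R) (A : opSpace H) n (a : 'I_n -> A)
    (b : 'I_n -> BL H H) (r : R) :
  (forall i, is_adjoint (os_val (a i)) (b i)) -> 0 <= r ->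
  col_bd (fun i => os_val (a i)) r -> col_bd b r ->
  sec_bound (fun t => \sum_(k < n | fgen k == t) a k) (2 * Num.sqrt r).
Proof.
move=> ab r0 ar br m g ginj.
have q0 : 0 <= 2 * Num.sqrt r by rewrite mulr_ge0 ?sqrtr_ge0.
apply/(os_mxnormP _ q0) => h.
pose e (k : 'I_n) i j := fgen k == (g i * (g j)^-1)%g.
have eE k i j : e k i j -> g i = (fgen k * g j)%g.
  by move=> /eqP ->; rewrite mulgVK.
(* fA collects the terms without cancellation, fB those with cancellation *)
pose fA i := \sum_(jk : 'I_m * 'I_n | e jk.2 i jk.1 && starts jk.2 (g i)) os_val (a jk.2) (h jk.1).
pose v i k := \sum_(j | e k i j && ~~ starts k (g i)) h j.
pose fB i := \sum_k os_val (a k) (v i k).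
have fE : (fun i => \sum_j os_val ((\matrix_(i, j)
    \sum_(k < n | fgen k == (g i * (g j)^-1)%g) a k) i j) (h j)) = fA + fB.
  apply/funext => i; rewrite -[RHS]/(fA i + fB i).
  have -> : fB i = \sum_(jk : 'I_m * 'I_n | e jk.2 i jk.1 && ~~ starts jk.2 (g i))
      os_val (a jk.2) (h jk.1).
    rewrite /fB /v; under eq_bigr do rewrite linear_sum.
    rewrite (exchange_big_dep predT)//= pair_big_dep /=.
    by apply: eq_bigl => jk.
  rewrite -bigID /= -(pair_big_dep predT (fun j k => e k i j) (fun j k => os_val (a k) (h j))) /=.
  by apply: eq_bigr => j _; rewrite mxE os_val_sum.
pose S := \sum_j nrm (h j) ^+ 2; have S0 : 0 <= S by exact: sum_sq_ge0.
have ginjM (k : 'I_n) i j j' : e k i j -> e k i j' -> j = j'.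
  move=> /eE h1 /eE h2; apply/ginj/(@mulgI _ (fgen k)).
  by rewrite -h1 -h2.
have hA : \sum_i nrm (fA i) ^+ 2 <= r * S.
  apply: (@le_trans _ _ (\sum_i \sum_(jk : 'I_m * 'I_n | e jk.2 i jk.1)
      nrm (os_val (a jk.2) (h jk.1)) ^+ 2)).
    apply: ler_sum => i _; rewrite nrm_sum_unique.
      rewrite [leRHS](bigID (fun jk : 'I_m * 'I_n => starts jk.2 (g i))) /= lerDl.
      by apply: sumr_ge0 => jk _; exact: sqr_ge0.
    move=> [j k] [j' k'] /= /andP[e1 s1] /andP[e2 s2].
    have kk : k = k' by apply/val_inj; exact: starts_uniq s1 s2.
    by rewrite kk in e1 *; rewrite (ginjM _ _ _ _ e1 e2).
  rewrite (exchange_big_dep predT)//=.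
  apply: (@le_trans _ _ (\sum_(jk : 'I_m * 'I_n) nrm (os_val (a jk.2) (h jk.1)) ^+ 2)).
    apply: ler_sum => -[j k] _; apply: sum_unique_le; first exact: sqr_ge0.
    by move=> i i' /eE h1 /eE h2; apply: ginj; rewrite h1 h2.
  rewrite sum_pair /S mulr_sumr; apply: ler_sum => j _ /=.
  exact: ar.
have hB : \sum_i nrm (fB i) ^+ 2 <= r * S.
  apply: (@le_trans _ _ (\sum_i r * \sum_k nrm (v i k) ^+ 2)).
    by apply: ler_sum => i _; exact: row_bound.
  rewrite -mulr_sumr ler_wpM2l//.
  apply: (@le_trans _ _ (\sum_(ik : 'I_m * 'I_n)
     \sum_(j | e ik.2 ik.1 j && ~~ starts ik.2 (g ik.1)) nrm (h j) ^+ 2)).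
    rewrite sum_pair; apply: ler_sum => i _; apply: ler_sum => k _ /=.
    rewrite nrm_sum_unique// => j j' /andP[e1 _] /andP[e2 _].
    exact: ginjM e1 e2.
  rewrite (exchange_big_dep predT)//=; apply: ler_sum => j _.
  apply: sum_unique_le; first exact: sqr_ge0.
  move=> [i k] [i' k'] /= /andP[/eE e1 s1] /andP[/eE e2 s2].
  move: s1 s2; rewrite {1}e1 {1}e2 => /not_starts_mul[w gw] /not_starts_mul[w'].
  rewrite gw => -[/val_inj kk _].
  by rewrite kk in e1 *; rewrite (ginj _ _ (etrans e1 (esym e2))).
have ipf := @hsdot_ip R H 'I_m.
pose nn := ipn (@hsdot R H 'I_m).
have nnE f : nn f = Num.sqrt (\sum_i nrm (f i) ^+ 2) by rewrite /nn /ipn ipsq_hsdot.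
suff : nn (fA + fB) <= 2 * Num.sqrt r * Num.sqrt S.
  have q1 : 0 <= 2 * Num.sqrt r * Num.sqrt S by rewrite mulr_ge0// sqrtr_ge0.
  rewrite -fE nnE -(@ler_pXn2r _ 2) ?nnegrE ?sqrtr_ge0//.
  by rewrite [leRHS]exprMn !sqr_sqrtr// sum_sq_ge0.
apply: le_trans (ipnD ipf _ _) _; rewrite -/(nn _) -/(nn _) !nnE.
have le1 (x : R) : x <= r * S -> Num.sqrt x <= Num.sqrt r * Num.sqrt S.
  by move=> xr; rewrite -sqrtrM// ler_wsqrtr.
by have := le1 _ hA; have := le1 _ hB; lra.
Qed.

Lemma sec_bound_isom (H HA : hilbertType R) (E : opSpace H) (A : opSpace HA)
    (j : {linear E -> A}) (x : freeGroup -> E) (k : R) :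
  complete_isometry j -> sec_bound (fun t => j (x t)) k -> sec_bound x k.
Proof.
move=> jiso h m g ginj; rewrite -jiso; have := h m g ginj.
rewrite (_ : map_mx j _ = \matrix_(i, l) j (x (g i * (g l)^-1)%g))//.
by apply/matrixP => i l; rewrite !mxE.
Qed.

Lemma is_adjointC (H : hilbertType R) (S T : BL H H) : is_adjoint S T -> is_adjoint T S.
Proof. by move=> ST x y; rewrite hdotC -ST -hdotC. Qed.

Lemma col_bd_gram (H : hilbertType R) (I : finType) (a b : I -> BL H H) :
  (forall i, is_adjoint (a i) (b i)) ->
  col_bd a (nrm (\sum_i BL_comp (b i) (a i))).
Proof.
move=> ab h; pose G : BL H H := \sum_i BL_comp (b i) (a i); rewrite -/G.
have GE : G h = \sum_i b i (a i h).
  rewrite /G; by elim/big_rec2 : _ => // i y1 y2 _ <-.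
have -> : \sum_i nrm (a i h) ^+ 2 = complex.Re (hdot (G h) h).
  rewrite GE hdot_suml Re_sum; apply: eq_bigr => i _.
  by rewrite (is_adjointC (ab i)) -nrm_sq_Re.
apply: le_trans (Re_le_nrm _) _; apply: le_trans (hdot_cs _ _) _.
by rewrite expr2 mulrA ler_wpM2r ?nrm_ge0// nrm_opnorm.
Qed.

Lemma col_bd_mono (H : hilbertType R) (I : finType) (a : I -> BL H H) (r s : R) :
  r <= s -> col_bd a r -> col_bd a s.
Proof. by move=> rs ar h; apply: le_trans (ar h) _; rewrite ler_wpM2r ?sqr_ge0. Qed.

Lemma row_col_max_bd (H : hilbertType R) n (a : 'I_n -> BL H H) :
  (forall i, exists S, is_adjoint (a i) S) ->
  [/\ forall i, is_adjoint (a i) (adjoint (a i)),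
      col_bd a (row_col_max a ^+ 2) &
      col_bd (fun i => adjoint (a i)) (row_col_max a ^+ 2)].
Proof.
move=> aS; have ad i : is_adjoint (a i) (adjoint (a i)).
  by have [S /adjointP] := aS i.
have sq (x y : R) : 0 <= x -> Num.sqrt x <= y -> x <= y ^+ 2.
  move=> x0 xy; rewrite -(sqr_sqrtr x0) lerXn2r ?nnegrE ?sqrtr_ge0//.
  exact: le_trans xy.
split=> //.
  apply: col_bd_mono (col_bd_gram ad); apply: sq; first exact: nrm_ge0.
  by rewrite le_max lexx.
apply: col_bd_mono (col_bd_gram (fun i => is_adjointC (ad i))).
by apply: sq; [exact: nrm_ge0|rewrite le_max lexx orbT].
Qed.

End RowColumn.

(** * The Hahn-Banach theorem *)

Section HahnBanach.
Context {R : realType} {V : lmodType R[i]}.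
Variables (S : set V) (p : V -> R).
Hypothesis SS : lin_closed S.
Hypothesis pD : forall x y, S x -> S y -> p (x + y) <= p x + p y.
Hypothesis pZ : forall (r : R) x, 0 < r -> S x -> p ((r%:C)%C *: x) <= r * p x.
Local Notation rs r v := ((r%:C)%C *: v).

(** The graph of a real linear functional on a subspace of S, dominated by p. *)
Definition dominated_graph (G : set (V * R)) : Prop :=
  (forall v c, G (v, c) -> S v /\ c <= p v) /\
  (forall v w c d (r : R), G (v, c) -> G (w, d) -> G (rs r v + w, r * c + d)).

Lemma graph0 (G : set (V * R)) v c : dominated_graph G -> G (v, c) -> G (0, 0).
Proof.
move=> [_ GD] Gv; have := GD _ _ _ _ (-1) Gv Gv.
by rewrite rmorphN rmorph1 scaleN1r mulN1r !addNr.
Qed.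

Lemma graph_fun (G : set (V * R)) v c d : dominated_graph G ->
  G (v, c) -> G (v, d) -> c = d.
Proof.
move=> gG Gc Gd; have [GS GD] := gG; have G0 := graph0 gG Gc.
have Gcd : G (0, d - c).
  have := GD _ _ _ _ (-1) Gc Gd.
  by rewrite rmorphN rmorph1 scaleN1r mulN1r addNr [- c + d]addrC.
have h r : r * (d - c) <= p 0.
  have := GD _ _ _ _ r Gcd G0; rewrite scaler0 !addr0.
  by move=> /GS[].
apply/eqP; rewrite eq_sym -subr_eq0; apply/negPn/negP => dc.
have := h ((p 0 + 1) / (d - c)); rewrite divfK//.
by rewrite gerDl ler10.
Qed.

(** The value at v may be any number between the suprema of c - p(m - v) and the infima
    of p(m + v) - c, over the points (m, c) of the graph. *)
Lemma graph_extend (G : set (V * R)) v : dominated_graph G -> G (0, 0) -> S v ->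
  (forall c, ~ G (v, c)) -> exists2 G', dominated_graph G' & G `<` G'.
Proof.
move=> gG G0 Sv nv; have [GS GD] := gG.
have SB x y : S x -> S y -> S (x - y) by exact: lin_closedB.
have SD x y : S x -> S y -> S (x + y).
  by move=> Sx Sy; rewrite -[x]scale1r; exact: SS.2.
have SZ a x : S x -> S (a *: x) by exact: lin_closedZ.
pose L := [set l : R | exists m c, G (m, c) /\ l = c - p (m - v)].
have key m c m' c' : G (m, c) -> G (m', c') -> c - p (m - v) <= p (m' + v) - c'.
  move=> Gm Gm'; have [Sm _] := GS _ _ Gm; have [Sm' _] := GS _ _ Gm'.
  have := GD _ _ _ _ 1 Gm Gm'; rewrite rmorph1 scale1r mul1r => /GS[_ h].
  have := pD (SB _ _ Sm Sv) (SD _ _ Sm' Sv).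
  by rewrite addrACA addNr addr0; lra.
have Lsup : has_sup L.
  split; first by exists (0 - p (0 - v)), 0, 0.
  exists (p (0 + v) - 0) => _ [m [c [Gm ->]]]; exact: key.
pose a := sup L.
have a1 m c : G (m, c) -> c - a <= p (m - v).
  move=> Gm; have : c - p (m - v) <= a.
    by apply: (ub_le_sup Lsup.2); exists m, c.
  by lra.
have a2 m c : G (m, c) -> c + a <= p (m + v).
  move=> Gm; have : a <= p (m + v) - c.
    apply: ge_sup; first exact: Lsup.1.
    by move=> _ [m' [c' [Gm' ->]]]; exact: key.
  by lra.
have pZ' r x : 0 < r -> S x -> r * p x <= p (rs r x).
  move=> r0 Sx; have r'0 : 0 < r^-1 by rewrite invr_gt0.
  have := pZ r'0 (SZ (r%:C)%C _ Sx).
  rewrite scalerA -rmorphM mulVf ?gt_eqF// rmorph1 scale1r => h.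
  by rewrite -ler_pdivlMl.
pose G' : set (V * R) := [set q | exists m c r, G (m, c) /\ q = (m + rs r v, c + r * a)].
exists G'.
  split=> [w d [m [c [r [Gm [-> ->]]]]]|w w' d d' r [m [c [q [Gm [-> ->]]]]] [m' [c' [q' [Gm' [-> ->]]]]]].
    have [Sm cm] := GS _ _ Gm; split; first by apply: SD => //; exact: SZ.
    have scl s : 0 < s -> G (rs s^-1 m, s^-1 * c).
      by move=> s0; have := GD _ _ _ _ s^-1 Gm G0; rewrite !addr0.
    have [r0|r0|->] := ltgtP r 0; last by rewrite mul0r addr0 scale0r addr0.
    - have s0 : 0 < - r by rewrite oppr_gt0.
      have Gs := scl _ s0; have [Ss _] := GS _ _ Gs.
      have := pZ' _ _ s0 (SB _ _ Ss Sv).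
      rewrite scalerBr scalerA -rmorphM mulfV ?gt_eqF// rmorph1 scale1r.
      rewrite [rs (- r) v](_ : _ = - rs r v); last by rewrite rmorphN scaleNr.
      rewrite opprK; apply: le_trans.
      have := a1 _ _ Gs; rewrite -(ler_pM2l s0) => h; apply: le_trans h.
      by rewrite mulrBr mulrA mulfV ?gt_eqF// mul1r mulNr opprK.
    - have Gs := scl _ r0; have [Ss _] := GS _ _ Gs.
      have := pZ' _ _ r0 (SD _ _ Ss Sv).
      rewrite scalerDr scalerA -rmorphM mulfV ?gt_eqF// rmorph1 scale1r.
      apply: le_trans.
      have := a2 _ _ Gs; rewrite -(ler_pM2l r0) => h; apply: le_trans h.
      by rewrite mulrDr mulrA mulfV ?gt_eqF// mul1r.
  exists (rs r m + m'), (r * c + c'), (r * q + q'); split; first exact: GD.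
  congr (_, _); last by ring.
  by rewrite scalerDr addrACA rmorphD rmorphM scalerDl scalerA.
split=> [[m c] Gm|GG'].
  by exists m, c, 0; split=> //; rewrite scale0r mul0r !addr0.
apply: (nv a); apply: GG'; exists 0, 0, 1; split=> //.
by rewrite rmorph1 scale1r mul1r !add0r.
Qed.

(** Zorn's lemma for graphs. The empty graph is admitted in the ordered set, because it is
    the union of the empty chain. *)
Theorem hahn_banach (G0 : set (V * R)) : dominated_graph G0 -> G0 (0, 0) ->
  exists g : V -> R, [/\ forall v c, G0 (v, c) -> g v = c,
    forall v, S v -> g v <= p v &
    forall v w (r : R), S v -> S w -> g (rs r v + w) = r * g v + g w].
Proof.
move=> gG0 G00.
pose P (G : set (V * R)) := dominated_graph G /\ (G !=set0 -> G0 `<=` G).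
have [F FP totF|G [[gG GG0] Gmax]] := @Zorn_bigcup (V * R)%type P.
  split; last first.
    move=> [x [X FX Xx]] q qG0; exists X => //.
    by apply: (FP _ FX).2 => //; exists x.
  split=> [v c [X FX Xv]|v w c d r [X FX Xv] [Y FY Yw]].
    exact: (FP _ FX).1.1.
  have [XY|YX] := totF _ _ FX FY.
    by exists Y => //; apply: (FP _ FY).1.2 => //; exact: XY.
  by exists X => //; apply: (FP _ FX).1.2 => //; exact: YX.
have Gne : G !=set0.
  apply: contrapT => Ge; apply: (Gmax G0); last by split=> // _; exact: subset_refl.
  split=> [q Gq|G0G]; first by case: Ge; exists q.
  by apply: Ge; exists (0, 0); exact: G0G.
have G0G := GG0 Gne; have G'0 := G0G _ G00.
have tot v : S v -> exists c, G (v, c).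
  move=> Sv; apply: contrapT => /forallNP nv.
  have [G' gG' GG'] := graph_extend gG G'0 Sv nv.
  apply: (Gmax G') => //; split=> // _.
  exact: subset_trans G0G (properW GG').
have /choice[g gP] : forall v, exists c, S v -> G (v, c).
  move=> v; have [/tot[c Gc]|nS] := pselect (S v); first by exists c.
  by exists 0.
have [GS GD] := gG.
exists g; split=> [v c G0v|v Sv|v w r Sv Sw].
- have Gv := G0G _ G0v; apply: (graph_fun gG _ Gv).
  exact: gP (GS _ _ Gv).1.
- exact: (GS _ _ (gP _ Sv)).2.
- apply: (graph_fun gG (gP _ _)); first exact: SS.2.
  exact: GD (gP _ Sv) (gP _ Sw).
Qed.

End HahnBanach.

(** * The tensor product and its restriction to subspaces *)

Section MaximalOnsys.
Context {R : realType} {J : finType}.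
Local Notation dot := (@fdot R J).

Lemma onsys_sq1 (B : seq (J -> R[i]^o)) w : onsys (f := dot) B -> w \in B -> ipsq dot w = 1.
Proof.
elim: B => //= v B IH [v1 _ oB].
by rewrite inE => /predU1P[->//|]; exact: IH.
Qed.

Lemma onsys_size (B : seq (J -> R[i]^o)) : onsys (f := dot) B -> (size B <= #|J|)%N.
Proof.
move=> oB; have ipf := @fdot_ip R J.
rewrite -(ler_nat R) -sum1_size natr_sum big_seq.
rewrite (eq_bigr (fun w => \sum_j nrm (dot (delta j) w) ^+ 2)); last first.
  move=> w wB; rewrite -(onsys_sq1 oB wB) ipsq_fdot; apply: eq_bigr => j _.
  by rewrite (ipC ipf) dot_delta nrm_conj.
rewrite -big_seq exchange_big /= -sum1_card natr_sum; apply: ler_sum => j _.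
apply: le_trans (bessel ipf _ oB) _.
by rewrite /ipsq dot_delta /delta eqxx.
Qed.

(** A system of maximal size is an orthonormal basis of the span of L. *)
Lemma maximal_onsys (L : set (J -> R[i]^o)) : exists B, [/\ onsys (f := dot) B,
  forall v, L v -> v = ipproj (f := dot) B v &
  forall S, lin_closed S -> L `<=` S -> forall w, w \in B -> S w].
Proof.
pose good B := onsys (f := dot) B /\
  forall S, lin_closed S -> L `<=` S -> forall w, w \in B -> S w.
pose Q k := `[< exists B, good B /\ size B = k >].
have Q0 : exists k, Q k by exists 0%N; apply/asboolP; exists [::].
have Qm k : Q k -> (k <= #|J|)%N.
  by move=> /asboolP[B [[oB _] <-]]; exact: onsys_size.
case: (ex_maxnP Q0 Qm) => k /asboolP[B [[oB BS] Bk]] kmax.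
exists B; split=> // v Lv; apply/eqP/negPn/negP => vB.
have [a oa] := onsys_extend (@fdot_ip R J) (@fdot_def R J) oB vB.
have : Q k.+1.
  apply/asboolP; exists (a *: (v - ipproj (f := dot) B v) :: B).
  split; last by rewrite /= Bk.
  split=> // S SS LS w; rewrite inE => /predU1P[->|]; last exact: BS.
  apply: lin_closedZ => //; apply: lin_closedB => //; first exact: LS.
  rewrite /ipproj big_seq; apply: (big_ind S) => [|y z Sy Sz|y yB].
  - exact: SS.1.
  - by rewrite -[y]scale1r; exact: SS.2.
  - by apply: lin_closedZ => //; exact: BS yB.
by move/kmax; rewrite ltnn.
Qed.

Lemma is_proj_tr (p : J -> J -> R[i]) : is_proj p -> is_proj (fun i j => p j i).
Proof.
move=> [pC pp]; split=> i j; first exact: pC.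
by under eq_bigr do rewrite mulrC; exact: pp.
Qed.

End MaximalOnsys.

Section Tensors.
Context {R : realType}.
Implicit Types (HA HB : hilbertType R).

(** The sum of the a_i (x) b_i, encoded by its matrix coefficients; two sums are equal in
    the algebraic tensor product exactly when these agree. *)
Definition etens HA HB (A : opSpace HA) (B : opSpace HB) (I : finType)
    (a : I -> A) (b : I -> B) : (HA * HA) * (HB * HB) -> R[i]^o :=
  fun q => \sum_i hdot (os_val (a i) q.1.1) q.1.2 * hdot (os_val (b i) q.2.1) q.2.2.

Lemma os_ext HA (A : opSpace HA) (S T : A) :
  (forall h k, hdot (os_val S h) k = hdot (os_val T h) k) -> S = T.
Proof.
move=> ST; apply/val_inj/val_inj/funext => h /=; apply/eqP; rewrite -subr_eq0; apply/eqP.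
have : hdot (os_val S h - os_val T h) (os_val S h - os_val T h) = 0.
  by rewrite hdotBl ST subrr.
rewrite -nrm_sq_hdot => /complexI/eqP; rewrite sqrf_eq0 => /eqP.
exact: nrm0_eq0.
Qed.

Lemma hdot_os_sum HA (A : opSpace HA) (I : finType) (c : I -> R[i]) (a : I -> A) h k :
  hdot (os_val (\sum_i c i *: a i) h) k = \sum_i c i * hdot (os_val (a i) h) k.
Proof.
rewrite os_val_sum hdot_suml; apply: eq_bigr => i _.
by rewrite os_valZ BLZE hdotZl.
Qed.

Lemma etens_swap HA HB (A : opSpace HA) (B : opSpace HB) (I : finType)
    (a : I -> A) (b : I -> B) q : etens b a q = etens a b (q.2, q.1).
Proof. by apply: eq_bigr => i _; rewrite mulrC. Qed.

(** The matrix P moves from the second factors to the first ones. *)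
Lemma etens_mx HA HB (A : opSpace HA) (B : opSpace HB) (J : finType)
    (a : J -> A) (b : J -> B) (P : J -> J -> R[i]) :
  (forall j, b j = \sum_l P j l *: b l) ->
  etens a b = etens (fun l => \sum_j P j l *: a j) b.
Proof.
move=> bP; apply/funext => q; rewrite /etens.
under eq_bigr do rewrite bP hdot_os_sum mulr_sumr.
rewrite exchange_big /=; apply: eq_bigr => l _.
by rewrite hdot_os_sum mulr_suml; apply: eq_bigr => j _; rewrite mulrCA mulrA.
Qed.

Lemma lin_closed_sum (V : lmodType R[i]) (M : set V) (I : Type) (r : seq I) (v : I -> V) :
  lin_closed M -> (forall i, M (v i)) -> M (\sum_(i <- r) v i).
Proof.
move=> MM Mv; apply: (big_ind M) => // [|y z My Mz]; first exact: MM.1.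
by rewrite -[y]scale1r; exact: MM.2.
Qed.

(** P projects onto the span of the scalar families <b_j h, k>, so it fixes b. Its
    columns are combinations of such families; and combining the a_j along one of them gives a
    slice of the tensor, which the other representation shows to lie in M. *)
Lemma etens_factor HA HB (A : opSpace HA) (B : opSpace HB) (M : set A) (I J : finType)
    (a' : I -> A) (f : I -> B) (a : J -> A) (b : J -> B) :
  lin_closed M -> (forall i, M (a' i)) -> etens a' f = etens a b ->
  exists P : J -> J -> R[i], [/\ is_proj P, forall j, b j = \sum_l P j l *: b l &
    forall l, M (\sum_j P j l *: a j)].
Proof.
move=> MM Ma' a'fab.
(* the coordinates of the family b *)
pose L := [set v : J -> R[i]^o | exists h k, v = fun j => hdot (os_val (b j) h) k].
have [W [oW LW WS]] := maximal_onsys L.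
exists (projmx W); split=> [|j|l]; first exact: projmx_proj.
  apply: os_ext => h k; rewrite hdot_os_sum.
  pose v : J -> R[i]^o := fun l => hdot (os_val (b l) h) k.
  rewrite (projmxE W v) -LW//; by exists h, k.
pose S := [set w : J -> R[i]^o | M (\sum_j w j *: a j)].
have SS : lin_closed S.
  split=> [|c v w Sv Sw].
    by rewrite /S /= big1 => [|j _]; [exact: MM.1|exact: scale0r].
  rewrite /S /= (_ : \sum_j _ = c *: \sum_j v j *: a j + \sum_j w j *: a j).
    exact: MM.2.
  rewrite scaler_sumr -big_split; apply: eq_bigr => j _ /=.
  by rewrite scalerA -scalerDl.
have LS : L `<=` S.
  move=> _ [h [k ->]]; rewrite /S /=.
  rewrite (_ : \sum_j _ = \sum_i hdot (os_val (f i) h) k *: a' i).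
    by apply: lin_closed_sum => // i; exact: lin_closedZ.
  apply: os_ext => h' k'; rewrite !hdot_os_sum.
  have := congr1 (fun w => w ((h', k'), (h, k))) a'fab; rewrite /etens /= => E'.
  by under eq_bigr do rewrite mulrC; under [RHS]eq_bigr do rewrite mulrC.
suff : S (fun j => projmx W j l) by [].
rewrite (_ : (fun j => projmx W j l) = \sum_(w <- W) (w l)^* *: w).
  rewrite big_seq; apply: (big_ind S) => [|y z Sy Sz|w wW].
  - exact: SS.1.
  - by rewrite -[y]scale1r; exact: SS.2.
  - by apply: lin_closedZ => //; exact: WS SS LS _ wW.
apply/funext => j; rewrite /projmx.
have -> : (\sum_(w <- W) (w l)^* *: w) j = \sum_(w <- W) (w l)^* * w j.
  by elim/big_rec2 : _ => // w y z _ <-.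
by apply: eq_bigr => w _; rewrite mulrC.
Qed.

Lemma complete_isometry_inj (HE HA : hilbertType R) (E : opSpace HE) (A : opSpace HA)
    (jE : {linear E -> A}) : complete_isometry jE -> injective jE.
Proof.
move=> jiso x y xy; apply/eqP; rewrite -subr_eq0; apply/eqP/nrm0_eq0/le_anti.
rewrite nrm_ge0 andbT; apply/(mx11_bound _ (lexx 0)).
rewrite -jiso.
have -> : map_mx jE (\matrix_(i < 1, j < 1) (x - y)) = \matrix_(i < 1, j < 1) 0.
  by apply/matrixP => i j; rewrite !mxE linearB xy subrr.
by apply/(mx11_bound _ (lexx 0)); rewrite nrm0.
Qed.

Section Extension.
Variables (HE HF HA HB : hilbertType R) (E : opSpace HE) (F : opSpace HF)
  (A : opSpace HA) (B : opSpace HB) (jE : {linear E -> A}) (jF : {linear F -> B})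
  (u : {linear E -> os_dual F}).
Hypotheses (iE : injective jE) (iF : injective jF).

Lemma range_lin (V W : lmodType R[i]) (j : {linear V -> W}) :
  lin_closed [set w | exists v, w = j v].
Proof.
split=> [|c _ _ [v ->] [v' ->]]; first by exists 0; rewrite linear0.
by exists (c *: v + v'); rewrite linearP.
Qed.

(** [etens_factor] for the null subspace: a projection that fixes y kills x. *)
Lemma etens0_pair (I : finType) (x : I -> E) (y : I -> F) :
  etens (fun i => jE (x i)) (fun i => jF (y i)) = 0 -> \sum_i u (x i) (y i) = 0.
Proof.
move=> xy0; pose a0 : 'I_0 -> A := fun=> 0; pose b0 : 'I_0 -> B := fun=> 0.
have e0 : etens a0 b0 = etens (fun i => jE (x i)) (fun i => jF (y i)).
  by rewrite xy0; apply/funext => q; rewrite /etens big_ord0.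
have M0 : lin_closed [set 0 : A] by split=> // c v w -> ->; rewrite scaler0 addr0.
have [P [pP yP xP]] := etens_factor M0 (fun i => erefl) e0.
have yE j : y j = \sum_l P j l *: y l.
  apply: iF; rewrite yP linear_sum; apply: eq_bigr => l _.
  by rewrite linearZ.
have xE l : \sum_j P j l *: x j = 0.
  apply: iE; rewrite linear0 -(xP l) linear_sum; apply: eq_bigr => j _.
  by rewrite linearZ.
under eq_bigr do rewrite yE dual_sumr.
rewrite exchange_big /= big1// => l _.
transitivity (u (\sum_j P j l *: x j) (y l)); last by rewrite xE linear0.
by rewrite dual_suml; apply: eq_bigr => j _; rewrite dualZl dualZr.
Qed.

Lemma etens_pair_eq (I J : finType) (x : I -> E) (y : I -> F) (x' : J -> E) (y' : J -> F) :
  etens (fun i => jE (x i)) (fun i => jF (y i)) =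
  etens (fun i => jE (x' i)) (fun i => jF (y' i)) ->
  \sum_i u (x i) (y i) = \sum_i u (x' i) (y' i).
Proof.
move=> xy; apply/eqP; rewrite -subr_eq0; apply/eqP.
pose X (k : I + J) := match k with inl i => x i | inr j => - x' j end.
pose Y (k : I + J) := match k with inl i => y i | inr j => y' j end.
have XY0 : \sum_k u (X k) (Y k) = 0; last first.
  rewrite big_sumType /= in XY0; rewrite -[RHS]XY0 -sumrN; congr (_ + _).
  by apply: eq_bigr => j _; rewrite linearN.
apply: etens0_pair.
apply/funext => q; rewrite /etens big_sumType /=.
have := congr1 (fun w => w q) xy; rewrite /etens /= => ->.
rewrite -big_split big1// => j _ /=.
by rewrite linearN /= (ipNl (hdot_ip HA)) mulNr subrr.
Qed.

(** Bounded both as a column and as a row; b is the family of the adjoints. *)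
Definition rc_bd (H : hilbertType R) (C : opSpace H) (I : finType) (a : I -> C) (r : R) :=
  0 <= r /\ exists b : I -> BL H H,
    [/\ forall i, is_adjoint (os_val (a i)) (b i),
        col_bd (fun i => os_val (a i)) r & col_bd b r].

Lemma is_adjoint_sum (H : hilbertType R) (I : finType) (c : I -> R[i]) (a b : I -> BL H H) :
  (forall i, is_adjoint (a i) (b i)) ->
  is_adjoint (\sum_i c i *: a i) (\sum_i (c i)^* *: b i).
Proof.
move=> ab h k.
have E1 (d : I -> R[i]) (S : I -> BL H H) g : (\sum_i d i *: S i) g = \sum_i d i *: S i g.
  by elim/big_rec2 : _ => // i y1 y2 _ <-.
rewrite !E1 hdot_suml hdot_sumr; apply: eq_bigr => i _.
by rewrite hdotZl hdotZr conjCK ab.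
Qed.

Lemma rc_bd_proj (H : hilbertType R) (C : opSpace H) (I : finType) (a : I -> C) (r : R)
    (P : I -> I -> R[i]) :
  is_proj P -> rc_bd a r -> rc_bd (fun l => \sum_j P j l *: a j) r.
Proof.
move=> pP [r0 [b [ab ar br]]]; split=> //.
have E1 (d : I -> R[i]) (S : I -> BL H H) g : (\sum_i d i *: S i) g = \sum_i d i *: S i g.
  by elim/big_rec2 : _ => // i y1 y2 _ <-.
have E2 (d : I -> R[i]) : os_val (\sum_j d j *: a j) = \sum_j d j *: os_val (a j).
  by elim/big_rec2 : _ => // i y1 y2 _ <-.
exists (fun l => \sum_j (P j l)^* *: b j); split=> [l|h|h].
- by rewrite E2; exact: is_adjoint_sum.
- under eq_bigr do rewrite E2 E1.
  by apply: le_trans (proj_contraction _ (is_proj_tr pP)) (ar h).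
- under eq_bigr do rewrite E1.
  under eq_bigr do under eq_bigr do rewrite -pP.1.
  by apply: le_trans (proj_contraction _ pP) (br h).
Qed.

(** The injectivity of the norm: [etens_factor] is used once for each factor, and
    projections do not increase row and column norms. *)
Lemma etens_restrict (I J : finType) (x : I -> E) (y : I -> F) (a : J -> A) (b : J -> B)
    (r s : R) :
  etens (fun i => jE (x i)) (fun i => jF (y i)) = etens a b ->
  rc_bd a r -> rc_bd b s ->
  exists (x' : J -> E) (y' : J -> F),
    [/\ rc_bd (fun j => jE (x' j)) r, rc_bd (fun j => jF (y' j)) s &
        \sum_i u (x i) (y i) = \sum_j u (x' j) (y' j)].
Proof.
move=> xyab ar bs.
have [P [pP bP aP]] := etens_factor (range_lin jE) (fun i => ex_intro _ (x i) erefl) xyab.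
have /choice[x' x'E] := aP.
have E1 : etens (fun i => jE (x i)) (fun i => jF (y i)) = etens (fun j => jE (x' j)) b.
  rewrite xyab (etens_mx a bP); congr etens; apply/funext => l; exact: x'E.
have E2 : etens (fun i => jF (y i)) (fun i => jE (x i)) = etens b (fun j => jE (x' j)).
  by apply/funext => q; rewrite [LHS]etens_swap [RHS]etens_swap E1.
have [Q [pQ xQ bQ]] := etens_factor (range_lin jF) (fun i => ex_intro _ (y i) erefl) E2.
have /choice[y' y'E] := bQ.
have E3 : etens (fun i => jF (y i)) (fun i => jE (x i)) =
    etens (fun j => jF (y' j)) (fun j => jE (x' j)).
  rewrite E2 (etens_mx b xQ); congr etens; apply/funext => l; exact: y'E.
exists x', y'; split.
- have -> : (fun j => jE (x' j)) = (fun l => \sum_j P j l *: a j).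
    by apply/funext => l; rewrite x'E.
  exact: rc_bd_proj.
- have -> : (fun j => jF (y' j)) = (fun l => \sum_j Q j l *: b j).
    by apply/funext => l; rewrite y'E.
  exact: rc_bd_proj.
- apply: etens_pair_eq; apply/funext => q.
  by rewrite [LHS]etens_swap [RHS]etens_swap E3.
Qed.

End Extension.

End Tensors.

(** * Extension of the bilinear form *)

Lemma sum_unit (V : nmodType) (F : unit -> V) : \sum_i F i = F tt.
Proof. by rewrite (bigD1 tt)//= big1 ?addr0// => -[]. Qed.

Section RcBd.
Context {R : realType}.

Lemma adjoint_nrm (H : hilbertType R) (S T : BL H H) h : is_adjoint S T ->
  nrm (T h) <= opnorm S * nrm h.
Proof.
move=> ST; have [->|t0] := eqVneq (nrm (T h)) 0.
  by rewrite mulr_ge0 ?opnorm_ge0 ?nrm_ge0.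
have tp : 0 < nrm (T h) by rewrite lt_neqAle eq_sym t0 nrm_ge0.
rewrite -(ler_pM2r tp) -expr2.
have -> : nrm (T h) ^+ 2 = nrm (hdot (S (T h)) h).
  by rewrite ST -nrm_sq_hdot nrmR ger0_norm// sqr_ge0.
apply: le_trans (hdot_cs _ _) _; rewrite mulrAC ler_wpM2r ?nrm_ge0//.
exact: nrm_opnorm.
Qed.

Lemma rc_bd_ex (H : hilbertType R) (C : opSpace H) (I : finType) (a : I -> C) :
  (forall i, exists S, is_adjoint (os_val (a i)) S) ->
  rc_bd a (\sum_i nrm (a i) ^+ 2).
Proof.
move=> /choice[b ab]; split; first by apply: sumr_ge0 => i _; exact: sqr_ge0.
exists b; split=> // h; rewrite mulr_suml; apply: ler_sum => i _; rewrite -exprMn.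
  by rewrite lerXn2r ?nnegrE ?mulr_ge0 ?nrm_ge0// nrm_opnorm.
by rewrite lerXn2r ?nnegrE ?mulr_ge0 ?nrm_ge0// adjoint_nrm.
Qed.

Lemma rc_bd_scale (H : hilbertType R) (C : opSpace H) (I : finType) (a : I -> C) (r : R)
    (c : R[i]) : rc_bd a r -> rc_bd (fun i => c *: a i) (nrm c ^+ 2 * r).
Proof.
move=> [r0 [b [ab ar br]]]; split; first by rewrite mulr_ge0// sqr_ge0.
exists (fun i => c^* *: b i); split=> [i h k|h|h].
- by rewrite os_valZ !BLZE hdotZl hdotZr conjCK ab.
- under eq_bigr do rewrite os_valZ BLZE nrmZ exprMn.
  by rewrite -mulr_sumr -mulrA ler_wpM2l ?sqr_ge0.
- under eq_bigr do rewrite BLZE nrmZ nrm_conj exprMn.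
  by rewrite -mulr_sumr -mulrA ler_wpM2l ?sqr_ge0.
Qed.

(** Concatenation of families indexed by finite types. *)
Definition sum_fam (T : Type) (I J : Type) (a : I -> T) (a' : J -> T) (k : I + J) : T :=
  match k with inl i => a i | inr j => a' j end.

Lemma rc_bd_sum (H : hilbertType R) (C : opSpace H) (I J : finType) (a : I -> C)
    (a' : J -> C) (r r' : R) :
  rc_bd a r -> rc_bd a' r' -> rc_bd (sum_fam a a') (r + r').
Proof.
move=> [r0 [b [ab ar br]]] [r0' [b' [ab' ar' br']]]; split; first exact: addr_ge0.
exists (sum_fam b b'); split=> [[i|j]|h|h].
- exact: ab.
- exact: ab'.
- by rewrite big_sumType /= mulrDl lerD.
- by rewrite big_sumType /= mulrDl lerD.
Qed.

(** Each column and each row of a contraction is bounded by 1, and there are n of them. *)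
Lemma rc_bd_matrix (H : hilbertType R) (C : opSpace H) n (x : 'M[C]_n) :
  (forall S : C, exists T, is_adjoint (os_val S) T) -> (os_mxnorm x <= 1)%E ->
  rc_bd (fun ij : 'I_n * 'I_n => x ij.1 ij.2) n%:R.
Proof.
move=> Cadj /(os_mxnormP _ ler01) x1; split; first exact: ler0n.
have /choice[b xb] : forall ij : 'I_n * 'I_n, exists T, is_adjoint (os_val (x ij.1 ij.2)) T.
  by move=> ij; exact: Cadj.
exists b; split=> // h.
  rewrite sum_pair exchange_big /= -[n in n%:R](card_ord n) mulr_natl -sumr_const.
  apply: ler_sum => j _.
  pose v k := if k == j then h else 0.
  have v1 : \sum_k nrm (v k) ^+ 2 = nrm h ^+ 2.
    rewrite (bigD1 j)//= /v eqxx big1 ?addr0// => k /negPf ->.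
    by rewrite nrm0 expr0n.
  have v2 i : \sum_k os_val (x i k) (v k) = os_val (x i j) h.
    rewrite (bigD1 j)//= /v eqxx big1 ?addr0// => k /negPf ->.
    exact: linear0.
  have := x1 v; rewrite v1 expr1n mul1r => hx; apply: le_trans hx.
  by apply: ler_sum => i _; rewrite v2.
rewrite sum_pair -[n in n%:R](card_ord n) mulr_natl -sumr_const.
apply: ler_sum => i _ /=.
pose k j := b (i, j) h; pose S := \sum_j nrm (k j) ^+ 2.
have S0 : 0 <= S by exact: sum_sq_ge0.
rewrite -/S; have [->|Sn] := eqVneq S 0; first exact: sqr_ge0.
have Sp : 0 < S by rewrite lt_neqAle eq_sym Sn.
rewrite -(ler_pM2r Sp) -expr2.
have SE : (S%:C)%C = hdot (\sum_j os_val (x i j) (k j)) h.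
  rewrite hdot_suml rmorph_sum; apply: eq_bigr => j _.
  by rewrite (xb (i, j)) -nrm_sq_hdot.
have -> : S ^+ 2 = nrm (hdot (\sum_j os_val (x i j) (k j)) h) ^+ 2.
  by rewrite -SE nrmR ger0_norm.
apply: (@le_trans _ _ (nrm (\sum_j os_val (x i j) (k j)) ^+ 2 * nrm h ^+ 2)).
  by rewrite -exprMn lerXn2r ?nnegrE ?mulr_ge0 ?nrm_ge0// hdot_cs.
rewrite mulrC ler_wpM2l ?sqr_ge0//.
have := x1 k; rewrite expr1n mul1r; apply: le_trans.
by rewrite [leRHS](bigD1 i)//= lerDl sumr_ge0// => l _; exact: sqr_ge0.
Qed.

End RcBd.

Section ExtensionTheorem.
Context {R : realType}.
Variables (HE HF HA HB : hilbertType R) (E : opSpace HE) (F : opSpace HF)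
  (A : opSpace HA) (B : opSpace HB) (jE : {linear E -> A}) (jF : {linear F -> B})
  (u : {linear E -> os_dual F}).
Hypotheses (iE : injective jE) (iF : injective jF).
Hypothesis adjA : forall S : A, exists T, is_adjoint (os_val S) T.
Hypothesis adjB : forall S : B, exists T, is_adjoint (os_val S) T.
Variable K : R.
Hypothesis K0 : 0 <= K.
Local Notation V := ((HA * HA) * (HB * HB) -> R[i]^o).

(** The norm on A (x) B for which the inequality with rows and columns says that u is
    bounded; half a sum of squares replaces a product of norms, which makes the triangle
    inequality immediate. *)
Definition tcost (w : V) : set R := [set c | exists (I : finType) (a : I -> A) (b : I -> B) (r s : R),
  [/\ w = etens a b, rc_bd a r, rc_bd b s & c = K * ((r + s) / 2)]].
Definition tnorm (w : V) : R := inf (tcost w).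
Definition tspace : set V := [set w | exists (I : finType) (a : I -> A) (b : I -> B), w = etens a b].

Lemma etens_sum (I J : finType) (a : I -> A) (b : I -> B) (a' : J -> A) (b' : J -> B) :
  etens (sum_fam a a') (sum_fam b b') = etens a b + etens a' b'.
Proof. by apply/funext => q; rewrite /etens big_sumType. Qed.

Lemma etens_scale (I : finType) (a : I -> A) (b : I -> B) c :
  etens (fun i => c *: a i) b = c *: etens a b.
Proof.
apply/funext => q; rewrite -[RHS]/(c * etens a b q) mulr_sumr; apply: eq_bigr => i _.
by rewrite os_valZ BLZE hdotZl mulrA.
Qed.

Lemma etens_scaler (I : finType) (a : I -> A) (b : I -> B) (r : R) :
  etens a (fun i => r%:C%C *: b i) = r%:C%C *: etens a b.
Proof.
apply/funext => q; rewrite -[RHS]/(r%:C%C * etens a b q) mulr_sumr; apply: eq_bigr => i _.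
by rewrite os_valZ BLZE hdotZl mulrCA.
Qed.

Lemma tspace_lin : lin_closed tspace.
Proof.
split=> [|c _ _ [I [a [b ->]]] [J [a' [b' ->]]]].
  exists 'I_0, (fun=> 0), (fun=> 0); apply/funext => q; by rewrite /etens big_ord0.
exists (I + J)%type, (sum_fam (fun i => c *: a i) a'), (sum_fam b b').
by rewrite etens_sum etens_scale.
Qed.

Lemma tcost_inf w : tspace w -> has_inf (tcost w).
Proof.
move=> [I [a [b ->]]]; split.
  eexists; exists I, a, b; do 2 eexists; split; first reflexivity.
  - by apply: rc_bd_ex => i; exact: adjA.
  - by apply: rc_bd_ex => i; exact: adjB.
  - reflexivity.
exists 0 => _ [J [a' [b' [r [s [_ [r0 _] [s0 _] ->]]]]]].
by rewrite mulr_ge0// divr_ge0// addr_ge0.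
Qed.

Lemma tnorm_le (I : finType) (a : I -> A) (b : I -> B) r s :
  rc_bd a r -> rc_bd b s -> tnorm (etens a b) <= K * ((r + s) / 2).
Proof.
move=> ar bs; apply: ge_inf; first by apply: (tcost_inf _).2; exists I, a, b.
by exists I, a, b, r, s.
Qed.

Lemma tnormD x y : tspace x -> tspace y -> tnorm (x + y) <= tnorm x + tnorm y.
Proof.
move=> Sx Sy; rewrite -lerBlDr; apply: lb_le_inf; first exact: (tcost_inf Sx).1.
move=> _ [I [a [b [r [s [-> ar bs ->]]]]]].
rewrite lerBlDr [leRHS]addrC -lerBlDr; apply: lb_le_inf; first exact: (tcost_inf Sy).1.
move=> _ [J [a' [b' [r' [s' [-> ar' bs' ->]]]]]].
rewrite lerBlDr -etens_sum; apply: le_trans (tnorm_le (rc_bd_sum ar ar') (rc_bd_sum bs bs')) _.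
by rewrite le_eqVlt; apply/orP; left; apply/eqP; field.
Qed.

Lemma tnormZ (r : R) x : 0 < r -> tspace x -> tnorm (r%:C%C *: x) <= r * tnorm x.
Proof.
move=> r0 Sx; rewrite mulrC -ler_pdivrMr//; apply: lb_le_inf; first exact: (tcost_inf Sx).1.
move=> _ [I [a [b [s [t [-> sa tb ->]]]]]]; rewrite ler_pdivrMr//.
pose q := Num.sqrt r; have q2 : nrm (q%:C)%C ^+ 2 = r.
  by rewrite nrmR ger0_norm ?sqrtr_ge0// sqr_sqrtr// ltW.
have -> : r%:C%C *: etens a b = etens (fun i => q%:C%C *: a i) (fun i => q%:C%C *: b i).
  by rewrite etens_scale etens_scaler scalerA -rmorphM /q -expr2 sqr_sqrtr// ltW.
apply: le_trans (tnorm_le (rc_bd_scale _ sa) (rc_bd_scale _ tb)) _; rewrite q2.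
by rewrite le_eqVlt; apply/orP; left; apply/eqP; field.
Qed.

Hypothesis uK : forall (I : finType) (x : I -> E) (y : I -> F) r s,
  rc_bd (fun i => jE (x i)) r -> rc_bd (fun i => jF (y i)) s ->
  nrm (\sum_i u (x i) (y i)) <= K * ((r + s) / 2).

Definition ugraph : set (V * R) := [set q | exists (I : finType) (x : I -> E) (y : I -> F),
  q = (etens (fun i => jE (x i)) (fun i => jF (y i)), complex.Re (\sum_i u (x i) (y i)))].

Lemma ugraph_dominated : dominated_graph tspace tnorm ugraph.
Proof.
split=> [v c [I [x [y [-> ->]]]]|v w c d r [I [x [y [-> ->]]]] [J [x' [y' [-> ->]]]]].
  have Sv : tspace (etens (fun i => jE (x i)) (fun i => jF (y i))).
    by exists I, (fun i => jE (x i)), (fun i => jF (y i)).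
  split=> //; apply: lb_le_inf; first exact: (tcost_inf Sv).1.
  move=> _ [J [a [b [r [s [xyab ar bs ->]]]]]].
  have [x' [y' [xr ys ->]]] := etens_restrict u iE iF xyab ar bs.
  exact: le_trans (Re_le_nrm _) (uK xr ys).
exists (I + J)%type, (sum_fam (fun i => r%:C%C *: x i) x'), (sum_fam y y').
congr (_, _).
  rewrite -etens_scale -etens_sum; congr etens; apply/funext => -[i|j] //=.
  by rewrite linearZ.
rewrite big_sumType /= ReDr; congr (_ + _); rewrite -ReRr mulr_sumr.
by congr complex.Re; apply: eq_bigr => i _; rewrite dualZl.
Qed.

(** Hahn-Banach yields a real functional g. Then G(w) = g(w) - i g(i w) is complex
    linear, and |G(w)| is the value of g at w rotated by a scalar of modulus 1. *)
Lemma bilinear_extension : exists ut : {linear A -> os_dual B},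
  (forall (I : finType) (a : I -> A) (b : I -> B) r s, rc_bd a r -> rc_bd b s ->
     nrm (\sum_i ut (a i) (b i)) <= K * ((r + s) / 2)) /\
  (forall x y, ut (jE x) (jF y) = u x y).
Proof.
have [|g [gu gp glin]] := hahn_banach tspace_lin tnormD tnormZ ugraph_dominated.
  exists 'I_0, (fun=> 0), (fun=> 0); congr (_, _); last by rewrite big_ord0.
  by apply/funext => q; rewrite /etens big_ord0.
pose ii : R[i] := (0 +i* 1)%C.
pose G (w : V) : R[i] := (g w +i* (- g (ii *: w)))%C.
have SZ c w : tspace w -> tspace (c *: w) by apply: lin_closedZ; exact: tspace_lin.
have glin2 (r s : R) v w z : tspace v -> tspace w -> tspace z ->
    g (r%:C%C *: v + (s%:C%C *: w + z)) = r * g v + (s * g w + g z).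
  by move=> Sv Sw Sz; rewrite !glin//; exact: tspace_lin.2.
have Glin c v w : tspace v -> tspace w -> G (c *: v + w) = c * G v + G w.
  case: c => al be Sv Sw; rewrite /G.
  have -> : (al +i* be)%C *: v + w = al%:C%C *: v + (be%:C%C *: (ii *: v) + w).
    rewrite scalerA addrA -scalerDl; congr (_ *: _ + _).
    by apply/eqP; rewrite eq_complex /=; apply/andP; split; apply/eqP; ring.
  have -> : ii *: (al%:C%C *: v + (be%:C%C *: (ii *: v) + w)) =
      al%:C%C *: (ii *: v) + ((- be)%:C%C *: v + ii *: w).
    rewrite !scalerDr !scalerA; congr (_ *: _ + (_ *: _ + _)); first by rewrite mulrC.
    by apply/eqP; rewrite eq_complex /=; apply/andP; split; apply/eqP; ring.
  have Siv := SZ ii v Sv; have Siw := SZ ii w Sw.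
  rewrite (glin2 al be v _ w Sv Siv Sw) (glin2 al _ _ v _ Siv Sv Siw).
  apply/eqP; rewrite eq_complex /=; apply/andP; split; apply/eqP; ring.
have GZ c w : tspace w -> G (c *: w) = c * G w.
  move=> Sw; have := Glin c w 0 Sw tspace_lin.1; rewrite addr0 => ->.
  have := Glin 1 0 0 tspace_lin.1 tspace_lin.1; rewrite scale1r mul1r addr0 => h.
  have -> : G 0 = 0 by apply: (addIr (G 0)); rewrite add0r -h.
  by rewrite addr0.
have Gbd (I : finType) (a : I -> A) (b : I -> B) r s : rc_bd a r -> rc_bd b s ->
    nrm (G (etens a b)) <= K * ((r + s) / 2).
  move=> ar bs; set w := etens a b; have Sw : tspace w by exists I, a, b.
  have [->|z0] := eqVneq (nrm (G w)) 0.
    by rewrite mulr_ge0// divr_ge0// addr_ge0 ?ar.1 ?bs.1.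
  have zp : 0 < nrm (G w) by rewrite lt_neqAle eq_sym z0 nrm_ge0.
  pose th := ((nrm (G w))^-1)%:C%C * (G w)^*.
  have th1 : nrm th = 1.
    by rewrite nrmM nrm_conj nrmR ger0_norm ?invr_ge0 ?nrm_ge0// mulVf.
  have -> : nrm (G w) = g (th *: w).
    rewrite -[RHS]/(complex.Re (G (th *: w))) (GZ _ _ Sw).
    rewrite -mulrA [_^* * _]mulrC nrmC_sq ReRr /=.
    by rewrite expr2 mulrA mulVf// mul1r.
  apply: le_trans (gp _ (SZ _ _ Sw)) _; rewrite /w -etens_scale.
  have := tnorm_le (rc_bd_scale th ar) bs.
  by rewrite th1 expr1n mul1r.
pose e1 (a : A) (b : B) : V := etens (fun=> a : A) (fun _ : unit => b).
have Se a b : tspace (e1 a b) by exists unit, (fun=> a), (fun=> b).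
have e1l c a a' b : e1 (c *: a + a') b = c *: e1 a b + e1 a' b.
  apply/funext => q; rewrite -[RHS]/(c * e1 a b q + e1 a' b q) /e1 /etens !sum_unit.
  by rewrite os_valD BLDE os_valZ BLZE hdotDl hdotZl mulrDl mulrA.
have e1r c a b b' : e1 a (c *: b + b') = c *: e1 a b + e1 a b'.
  apply/funext => q; rewrite -[RHS]/(c * e1 a b q + e1 a b' q) /e1 /etens !sum_unit.
  by rewrite os_valD BLDE os_valZ BLZE hdotDl hdotZl mulrDr mulrCA.
have e1r0 a : e1 a 0 = 0.
  apply/funext => q; rewrite /e1 /etens sum_unit.
  by rewrite BL0E (ip0l (hdot_ip HB)) mulr0.
have e1l0 b : e1 0 b = 0.
  apply/funext => q; rewrite /e1 /etens sum_unit.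
  by rewrite BL0E (ip0l (hdot_ip HA)) mul0r.
have G0 : G 0 = 0 by have := GZ 0 0 tspace_lin.1; rewrite scale0r mul0r.
have lin2 a : linear (fun b => G (e1 a b) : R[i]^o).
  by move=> c b b'; rewrite e1r Glin.
have bnd a : (fun b => G (e1 a b) : R[i]^o) \in @bounded_op R B R[i]^o.
  apply/asboolP; split; first exact: lin2.
  exists (K * ((nrm a ^+ 2 + 1) / 2)) => b.
  have [->|b0] := eqVneq b 0.
    by rewrite e1r0 G0 !nrm0 mulr0.
  have bp : 0 < nrm b.
    by rewrite lt_neqAle nrm_ge0 andbT eq_sym; apply: contra_neq b0 => /nrm0_eq0.
  pose b1 : B := ((nrm b)^-1)%:C%C *: b.
  have nb1 : nrm b1 = 1.
    by rewrite nrmZ nrmR ger0_norm ?invr_ge0 ?nrm_ge0// mulVf// gt_eqF.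
  have -> : e1 a b = (nrm b)%:C%C *: e1 a b1.
    have := e1r (nrm b)%:C%C a b1 0; rewrite addr0 /b1 scalerA -rmorphM mulfV ?gt_eqF//.
    by rewrite rmorph1 scale1r => ->; rewrite e1r0 addr0.
  rewrite GZ// nrmM nrmR ger0_norm ?nrm_ge0// mulrC ler_wpM2r ?nrm_ge0//.
  have := Gbd _ (fun _ : unit => a) (fun=> b1) _ _
    (rc_bd_ex (fun=> adjA a)) (rc_bd_ex (fun=> adjB b1)).
  by rewrite !sum_unit nb1 expr1n.
pose ut (a : A) : os_dual B := MkBL (bnd a).
have utlin : linear ut.
  move=> c a a'; apply/val_inj/funext => b.
  by rewrite -[LHS]/(G _) -[RHS]/(c * G (e1 a b) + G (e1 a' b)) e1l Glin.
pose utL : {linear A -> os_dual B} := HB.pack ut (GRing.isLinear.Build _ _ _ _ ut utlin).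
exists utL; split=> [I a b r s ar bs|x y].
  suff -> : \sum_i utL (a i) (b i) = G (etens a b) by exact: Gbd.
  have GD v w : tspace v -> tspace w -> G (v + w) = G v + G w.
    by move=> Sv Sw; have := Glin 1 v w Sv Sw; rewrite scale1r mul1r.
  have -> : etens a b = \sum_i e1 (a i) (b i).
    apply/funext => q; rewrite /etens.
    have -> : (\sum_i e1 (a i) (b i)) q = \sum_i e1 (a i) (b i) q.
      by elim/big_rec2 : _ => // i y1 y2 _ <-.
    by apply: eq_bigr => i _; rewrite /e1 /etens sum_unit.
  have : tspace (\sum_i e1 (a i) (b i)) /\ \sum_i utL (a i) (b i) = G (\sum_i e1 (a i) (b i)).
    elim/big_rec2 : _ => [|i v w _ [Sw ->]].
      by split; [exact: tspace_lin.1|have := GZ 0 0 tspace_lin.1; rewrite scale0r mul0r].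
    split; last by rewrite GD.
    by rewrite -[e1 _ _]scale1r; exact: tspace_lin.2.
  by case.
rewrite -[LHS]/(G (e1 (jE x) (jF y))).
have gE z : g (e1 (jE z) (jF y)) = complex.Re (u z y).
  by apply: gu; exists unit, (fun=> z), (fun=> y); rewrite sum_unit.
rewrite /G gE.
have -> : ii *: e1 (jE x) (jF y) = e1 (jE (ii *: x)) (jF y).
  have := e1l ii (jE x) 0 (jF y); rewrite addr0 linearZ => ->.
  by rewrite e1l0 addr0.
rewrite gE dualZl; case: (u x y) => c d /=; congr (_ +i* _)%C; ring.
Qed.

End ExtensionTheorem.

(** * The theorem *)

Section GeneratorFamilies.
Context {R : realType}.

(** The family with value x_i at the generator g_i, and 0 elsewhere. *)
Definition gen_fam (V : nmodType) n (x : 'I_n -> V) (t : freeGroup) : V :=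
  \sum_(i < n | fgen i == t) x i.

Lemma fgen_inj n : injective (fun i : 'I_n => fgen i).
Proof. by move=> i j [] /val_inj. Qed.

Definition gens n : seq freeGroup := map (fun i : 'I_n => fgen i) (index_enum 'I_n).

Lemma gens_uniq n : uniq (gens n).
Proof. by rewrite map_inj_uniq ?index_enum_uniq//; exact: fgen_inj. Qed.

Lemma gen_fam0 (V : nmodType) n (x : 'I_n -> V) t : t \notin gens n -> gen_fam x t = 0.
Proof.
move=> tn; rewrite /gen_fam big_pred0// => i; apply: contraNF tn => /eqP <-.
exact: (map_f (fun i : 'I_n => fgen i) (mem_index_enum i)).
Qed.

Lemma gen_famE (V : nmodType) n (x : 'I_n -> V) (i : 'I_n) : gen_fam x (fgen i) = x i.
Proof.
rewrite /gen_fam (eq_bigl (pred1 i)) ?big_pred1_eq// => j /=.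
by rewrite (inj_eq (@fgen_inj n)).
Qed.

Lemma gen_fam_list (V : nmodType) n (x : 'I_n -> V) t :
  gen_fam x t = \sum_(p <- [seq (fgen i, x i) | i : 'I_n] | p.1 == t) p.2.
Proof. by rewrite /gen_fam /image_mem big_map /= big_enum_cond. Qed.

End GeneratorFamilies.

Section Assembly.
Context {R : realType} (HE HF : hilbertType R).
Variables (E : opSpace HE) (F : opSpace HF) (u : {linear E -> os_dual F}).

Lemma gen_sum n (x : 'I_n -> E) (y : 'I_n -> F) :
  \sum_(t <- gens n) u (gen_fam x t) (gen_fam y t) = \sum_i u (x i) (y i).
Proof. by rewrite big_map; apply: eq_bigr => i _; rewrite !gen_famE. Qed.

Lemma fsupp_list (H : hilbertType R) (C : opSpace H) (x : freeGroup -> C) t :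
  finite_set [set t | x t != 0] ->
  x t = \sum_(p <- fsupp_seq x | p.1 == t) p.2.
Proof.
move=> fx; rewrite /fsupp_seq big_map /=.
have [tx|tx] := boolP (t \in fset_set [set t | x t != 0]).
  by rewrite -big_filter (filter_pred1_uniq (fset_uniq _) tx) big_seq1.
rewrite big_seq_cond big1 => [|s /andP[sx /eqP st]]; last by rewrite -st sx in tx.
by apply/eqP; move: tx; rewrite in_fset_set// notin_setE /= => /negP; rewrite negbK.
Qed.

Hypotheses (eE : exact_os E) (eF : exact_os F) (eu : tracially_bounded u).

Lemma rc_bilinear_bound (HA HB : hilbertType R) (A : opSpace HA) (B : opSpace HB)
    (jE : {linear E -> A}) (jF : {linear F -> B}) n (x : 'I_n -> E) (y : 'I_n -> F) r s :
  complete_isometry jE -> complete_isometry jF ->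
  rc_bd (fun i => jE (x i)) r -> rc_bd (fun i => jF (y i)) s ->
  ((nrm (\sum_i u (x i) (y i)))%:E <=
    dSK E * dSK F * tbnorm u * (2 * Num.sqrt r)%:E * (2 * Num.sqrt s)%:E)%E.
Proof.
move=> jEi jFi [r0 [a [xa xr ar]]] [s0 [b [yb ys bs]]].
have q0 (q : R) : 0 <= 2 * Num.sqrt q by rewrite mulr_ge0 ?sqrtr_ge0.
rewrite -gen_sum; apply: (exact_bilinear_ebound eE eF eu (gens_uniq n)
  (@gen_fam0 _ _ x) (@gen_fam0 _ _ y) (q0 r) (q0 s)).
- apply: (sec_bound_isom jEi).
  rewrite (_ : (fun t => jE (gen_fam x t)) = gen_fam (fun i => jE (x i))).
    exact: row_col_sec_bound xa r0 xr ar.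
  by apply/funext => t; rewrite /gen_fam linear_sum.
- apply: (sec_bound_isom jFi).
  rewrite (_ : (fun t => jF (gen_fam y t)) = gen_fam (fun i => jF (y i))).
    exact: row_col_sec_bound yb s0 ys bs.
  by apply/funext => t; rewrite /gen_fam linear_sum.
Qed.

Lemma rc_bd_reindex (H : hilbertType R) (C : opSpace H) (I J : finType) (f : J -> I)
  (a : I -> C) r : bijective f -> rc_bd a r -> rc_bd (a \o f) r.
Proof.
move=> fb [r0 [b [ab ar br]]]; split=> //; exists (b \o f); split=> [j|h|h].
- exact: ab.
- by apply: le_trans (ar h); rewrite [leRHS](reindex f)//=; exact: onW_bij.
- by apply: le_trans (br h); rewrite [leRHS](reindex f)//=; exact: onW_bij.
Qed.

Lemma lnorm_le_tbnorm (HA HB : hilbertType R) (A : opSpace HA) (B : opSpace HB)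
  (v : {linear A -> os_dual B}) : (lnorm v <= tbnorm v)%E.
Proof.
apply: ge_ereal_sup => _ [x /= x1 <-].
have key y : nrm y <= 1 -> ((nrm (v x y))%:E <= tbnorm v)%E.
  move=> y1; apply: ereal_sup_ubound.
  exists 1%N, (\matrix_(i < 1, j < 1) x), (\matrix_(i < 1, j < 1) y); split=> //.
  - exact/(mx11_bound _ ler01).
  - exact/(mx11_bound _ ler01).
  - by rewrite /tb_form !big_ord1 !mxE invr1 mul1r.
case E' : (tbnorm v) key => [b| |] key; last 2 first.
- by rewrite leey.
- by have := tbnorm_ge0 v; rewrite E'.
rewrite lee_fin; apply: opnorm_le => y y1.
by have := key y y1; rewrite lee_fin.
Qed.

(** The product of the square roots of r and s is at most (r + s) / 2. *)
Theorem rc_extension (HA HB : hilbertType R) (A : opSpace HA) (B : opSpace HB)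
    (jE : {linear E -> A}) (jF : {linear F -> B}) :
  Cstar_algebra A -> Cstar_algebra B -> complete_isometry jE -> complete_isometry jF ->
  exists ut : {linear A -> os_dual B},
    (tbnorm ut <= 4%:E * (dSK E * dSK F) * tbnorm u)%E /\
    forall x y, ut (jE x) (jF y) = u x y.
Proof.
move=> [_ cA] [_ cB] jEi jFi.
have adjA (S : A) : exists T, is_adjoint (os_val S) T.
  by have [T _ ST] := cA _ (os_valP S); exists T.
have adjB (S : B) : exists T, is_adjoint (os_val S) T.
  by have [T _ ST] := cB _ (os_valP S); exists T.
have [dE dE0 dEE] := ge0_fin_ex (dSK_ge0 E) eE.
have [dF dF0 dFE] := ge0_fin_ex (dSK_ge0 F) eF.
have [b b0 bE] := ge0_fin_ex (tbnorm_ge0 u) eu.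
pose K := 4 * (dE * dF) * b.
have K0 : 0 <= K by rewrite !mulr_ge0.
have uK (I : finType) (x : I -> E) (y : I -> F) r s :
    rc_bd (fun i => jE (x i)) r -> rc_bd (fun i => jF (y i)) s ->
    nrm (\sum_i u (x i) (y i)) <= K * ((r + s) / 2).
  move=> xr ys; have fb : bijective (@enum_val I I).
    exact: enum_val_bij.
  rewrite (reindex (@enum_val I I)) /=; last exact: onW_bij.
  have := rc_bilinear_bound jEi jFi (rc_bd_reindex fb xr) (rc_bd_reindex fb ys).
  rewrite dEE dFE bE -!EFinM lee_fin => /le_trans; apply.
  have -> : dE * dF * b * (2 * Num.sqrt r) * (2 * Num.sqrt s) =
      K * (Num.sqrt r * Num.sqrt s) by rewrite /K; ring.
  rewrite ler_wpM2l//.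
  have r2 : Num.sqrt r ^+ 2 = r by rewrite sqr_sqrtr// xr.1.
  have s2 : Num.sqrt s ^+ 2 = s by rewrite sqr_sqrtr// ys.1.
  rewrite -[in leRHS]r2 -[in leRHS]s2.
  have := sqr_ge0 (Num.sqrt r - Num.sqrt s); rewrite sqrrB; lra.
have [ut [utK ute]] := bilinear_extension (complete_isometry_inj jEi)
  (complete_isometry_inj jFi) adjA adjB K0 uK.
exists ut; split=> //; apply: ge_ereal_sup => _ [n [x [y [n0 x1 y1 ->]]]].
rewrite dEE dFE bE -!EFinM lee_fin -/K.
have := utK _ _ _ _ _ (rc_bd_matrix adjA x1) (rc_bd_matrix adjB y1).
rewrite sum_pair /= -/(tb_form _ _ _) => h.
have nR : 0 < n%:R :> R by rewrite ltr0n.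
rewrite /tb_form nrmM; have -> : nrm (n%:R^-1 : R[i]) = n%:R^-1.
  have -> : n%:R^-1 = (n%:R^-1)%:C%C :> R[i] by rewrite fmorphV rmorph_nat.
  by rewrite nrmR ger0_norm// invr_ge0 ler0n.
rewrite ler_pdivrMl// mulrC; apply: le_trans h _.
by rewrite le_eqVlt; apply/orP; left; apply/eqP; field.
Qed.

End Assembly.

Theorem theorem1p4 (R : realType) (H K : hilbertType R)
    (E : opSpace H) (F : opSpace K) (u : {linear E -> os_dual F}) :
  exact_os E -> exact_os F -> tracially_bounded u ->
  let C := (dSK E * dSK F)%E in
  [/\ forall (x : freeGroup -> E) (y : freeGroup -> F),
        finite_set [set t | x t != 0] -> finite_set [set t | y t != 0] ->
        ((nrm (\sum_(t \in [set: freeGroup]) u (x t) (y t))%R)%:E <=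
          C * tbnorm u
            * lreg_norm (fsupp_seq x)
            * lreg_norm (fsupp_seq y))%E,
      forall (n : nat) (x : 'I_n -> E) (y : 'I_n -> F),
        ((nrm (\sum_(i < n) u (x i) (y i))%R)%:E <=
          C * tbnorm u
            * lreg_norm [seq (fgen i, x i) | i : 'I_n]
            * lreg_norm [seq (fgen i, y i) | i : 'I_n])%E
    & forall (HA HB : hilbertType R) (A : opSpace HA) (B : opSpace HB)
        (jE : {linear E -> A}) (jF : {linear F -> B}),
        Cstar_algebra A -> Cstar_algebra B ->
        complete_isometry jE -> complete_isometry jF ->
        (forall (n : nat) (x : 'I_n -> E) (y : 'I_n -> F),
          ((nrm (\sum_(i < n) u (x i) (y i))%R)%:E <=
            4%:E * C * tbnorm u
              * (row_col_max (fun i => os_val (jE (x i))))%:E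
              * (row_col_max (fun i => os_val (jF (y i))))%:E)%E) /\
        (exists ut : {linear A -> os_dual B},
          [/\ (lnorm ut <= tbnorm ut)%E,
              (tbnorm ut <= 4%:E * C * tbnorm u)%E
            & forall (x : E) (y : F), ut (jE x) (jF y) = u x y])].
Proof.
move=> eE eF eu C; split=> [x y fx fy|n x y|HA HB A B jE jF cA cB jEi jFi].
- pose T := (fset_set [set t | x t != 0] `|` fset_set [set t | y t != 0])%fset.
  have x0 t : t \notin T -> x t = 0.
    rewrite in_fsetU negb_or => /andP[+ _]; rewrite in_fset_set// notin_setE /= => /negP.
    by rewrite negbK => /eqP.
  have y0 t : t \notin T -> y t = 0.
    rewrite in_fsetU negb_or => /andP[_]; rewrite in_fset_set// notin_setE /= => /negP.
    by rewrite negbK => /eqP.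
  rewrite (fsbigTE T) => [|t /x0 ->]; last by rewrite linear0.
  apply: exact_lreg_bound => //; [exact: fset_uniq|by move=> t; exact: fsupp_list..].
- rewrite -gen_sum; apply: exact_lreg_bound => //.
  + exact: gens_uniq.
  + by move=> t; exact: gen_fam0.
  + by move=> t; exact: gen_fam0.
  + by move=> t; exact: gen_fam_list.
  + by move=> t; exact: gen_fam_list.
- split=> [n x y|]; last first.
    have [ut [utb ute]] := rc_extension eE eF eu cA cB jEi jFi.
    by exists ut; split=> //; exact: lnorm_le_tbnorm.
  have adjA i : exists S, is_adjoint (os_val (jE (x i))) S.
    by have [S _ h] := cA.2 _ (os_valP (jE (x i))); exists S.
  have adjB i : exists S, is_adjoint (os_val (jF (y i))) S.
    by have [S _ h] := cB.2 _ (os_valP (jF (y i))); exists S.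
  have [xa xr ar] := row_col_max_bd adjA; have [yb ys bs] := row_col_max_bd adjB.
  have rcx : rc_bd (fun i => jE (x i)) (row_col_max (fun i => os_val (jE (x i))) ^+ 2).
    by split; [exact: sqr_ge0|exists (fun i => adjoint (os_val (jE (x i))))].
  have rcy : rc_bd (fun i => jF (y i)) (row_col_max (fun i => os_val (jF (y i))) ^+ 2).
    by split; [exact: sqr_ge0|exists (fun i => adjoint (os_val (jF (y i))))].
  apply: le_trans (rc_bilinear_bound eE eF eu jEi jFi rcx rcy) _.
  have rho0 (L : hilbertType R) (a : 'I_n -> BL L L) : 0 <= row_col_max a.
    by rewrite le_max sqrtr_ge0.
  rewrite !sqrtr_sqr !ger0_norm// /C.
  have [dE _ ->] := ge0_fin_ex (dSK_ge0 E) eE.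
  have [dF _ ->] := ge0_fin_ex (dSK_ge0 F) eF.
  have [b _ ->] := ge0_fin_ex (tbnorm_ge0 u) eu.
  rewrite -!EFinM lee_fin le_eqVlt; apply/orP; left; apply/eqP; ring.
Qed.
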